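(* Let $N\ge1$, $p\in(p_c,2)$ with $p>1$, $q>0$, let $u_0\in L^1(\mathbb{R}^N)\cap W^{1,\infty}(\mathbb{R}^N)$ with $u_0\ge0$, $u_0\not\equiv0$, and let $u$ be the corresponding non-negative viscosity solution to $$\partial_t u-\Delta_p u+|\nabla u|^q=0\ \text{ in } Q_\infty,\qquad u(0,\cdot)=u_0.$$ (i) If $q\in(p/2,q_\star)$ and there is $C_0>0$ such that $$u_0(x)\le C_0\,|x|^{-(p-q)/(q-p+1)},\quad x\in\mathbb{R}^N,\qquad(\ast)$$ then $$t^{(N+1)(q_\star-q)/(2q-p)}\,\|u(t)\|_1+t^{(p-q)/(2q-p)}\,\|u(t)\|_\infty\le C(u_0),\quad t>0.$$ (ii) If $q=p/2$ and $u_0$ satisfies $(\ast)$ for some $C_0>0$, then $$\|u(t)\|_1+\|u(t)\|_\infty\le C'(u_0)\,e^{-C(u_0)t},\quad t>0.$$ (iii) If $q\in(0,p/2)$ and there are $C_0>0$ and $Q>0$ such that $$u_0(x)\le C_0\,|x|^{-(p-Q)/(Q-p+1)},\quad x\in\mathbb{R}^N,$$ with $Q=q$ if $q\in(q_1,p/2)$ and $Q\in(q_1,p/2)$ if $q\in(0,q_1]$, then there is $T_e>0$ depending only on $N$, $p$, $q$, and $u_0$ such that $u(t,x)\equiv0$ for $(t,x)\in[T_e,\infty)\times\mathbb{R}^N$.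
   Context: Notation: $Q_\infty=(0,\infty)\times\mathbb{R}^N$; $\Delta_p u=\mathrm{div}(|\nabla u|^{p-2}\nabla u)$; $\nabla$ is the spatial gradient; $\|\cdot\|_r$ is the norm of $L^r(\mathbb{R}^N)$; $p_c=\frac{2N}{N+1}$, $q_\star=p-\frac{N}{N+1}$, $q_1=\max\{p-1,\frac{N}{N+1}\}$. $C(u_0),C'(u_0)$ denote positive constants depending only on $N,p,q$ and $u_0$. For $u_0$ as in the claim the Cauchy problem has a unique non-negative viscosity solution, called the corresponding solution. Viscosity solutions. Let $\mathcal{F}$ be the set of $f\in C^2([0,\infty))$ with $f(0)=f'(0)=f''(0)=0$, $f''(r)>0$ for all $r>0$, and $\lim_{r\to0}|f'(r)|^{p-2}f''(r)=0$. Let $\mathcal{A}$ be the set of $\psi\in C^2(Q_\infty)$ such that for any $(t_0,x_0)\in Q_\infty$ with $\nabla\psi(t_0,x_0)=0$ there are $\delta>0$, $f\in\mathcal{F}$ and a non-negative $\omega\in C([0,\infty))$ with $\omega(r)/r\to0$ as $r\to 0$ such that $|\psi(t,x)-\psi(t_0,x_0)-\partial_t\psi(t_0,x_0)(t-t_0)|\le f(|x-x_0|)+\omega(|t-t_0|)$ for all $(t,x)\in Q_\infty$ with $|x-x_0|+|t-t_0|<\delta$. An upper semicontinuous $u:Q_\infty\to\mathbb{R}$ is a viscosity subsolution if, whenever $\psi\in\mathcal{A}$ and $(t_0,x_0)\in Q_\infty$ satisfy $u(t_0,x_0)=\psi(t_0,x_0)$ and $u<\psi$ on $Q_\infty\setminus\{(t_0,x_0)\}$,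 one has $\partial_t\psi(t_0,x_0)\le\Delta_p\psi(t_0,x_0)-|\nabla\psi(t_0,x_0)|^q$ if $\nabla\psi(t_0,x_0)\ne0$ and $\partial_t\psi(t_0,x_0)\le0$ if $\nabla\psi(t_0,x_0)=0$. Viscosity supersolutions are lower semicontinuous and defined symmetrically ($u>\psi$ away from the contact point and both inequalities reversed). A viscosity solution is a continuous function that is both a sub- and a supersolution; a solution to the Cauchy problem is moreover continuous on $[0,\infty)\times\mathbb{R}^N$ with $u(0,\cdot)=u_0$. *)

(* Defs.v *)
From HB Require Import structures.
From mathcomp Require Import all_boot all_order all_algebra.
From mathcomp Require Import all_classical all_reals all_analysis.

Set Implicit Arguments.
Unset Strict Implicit.
Unset Printing Implicit Defensive.

Import Order.TTheory GRing.Theory Num.Theory.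
Import numFieldNormedType.Exports.

Local Open Scope classical_set_scope.
Local Open Scope ring_scope.

Definition measure_rV_display : measure_display.
Proof. exact: (measure_tuple_display default_measure_display). Qed.

Section measurable_rV.
Context (R : realType) (n : nat).

(* The sigma-algebra of ['rV[R]_n] is generated by the coordinates. *)
Let coord (i : 'I_n) (x : 'rV[R]_n) : measurableTypeR R := x ord0 i.

Let rV_set0 : g_sigma_preimage coord set0.
Proof. exact: sigma_algebra0. Qed.

Let rV_setC A : g_sigma_preimage coord A -> g_sigma_preimage coord (~` A).
Proof. exact: sigma_algebraC. Qed.

Let rV_bigcup (F : (set 'rV[R]_n)^nat) :
  (forall i, g_sigma_preimage coord (F i)) ->
  g_sigma_preimage coord (\bigcup_i (F i)).
Proof. exact: sigma_algebra_bigcup. Qed.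

HB.instance Definition _ := @isMeasurable.Build measure_rV_display
  'rV[R]_n (g_sigma_preimage coord) rV_set0 rV_setC rV_bigcup.

Lemma measurable_fun_rVP d (T : measurableType d) (f : T -> 'rV[R]_n) :
  (forall i, measurable_fun [set: T] (fun x => f x ord0 i : measurableTypeR R)) ->
  measurable_fun [set: T] f.
Proof.
move=> mf.
have H : g_sigma_preimage (fun i x => coord i (f x)) `<=` @measurable _ T.
  apply: smallest_sub; first exact: sigma_algebra_measurable.
  rewrite -bigcup_seq; apply: bigcup_sub => i _ A [B mB <-].
  exact: mf.
move=> _ A mA; apply: H; rewrite (g_sigma_preimage_comp coord f).
by exists A.
Qed.

Lemma measurable_coord_rV (i : 'I_n) :
  measurable_fun [set: 'rV[R]_n] (fun x : 'rV[R]_n => x ord0 i : measurableTypeR R).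
Proof.
move=> _ Y mY; rewrite setTI; apply: sub_sigma_algebra => /=.
rewrite -bigcup_seq/=; exists i => /=; first by rewrite mem_index_enum.
by exists Y => //; rewrite setTI.
Qed.

End measurable_rV.

Section lebesgue_rV.
Context (R : realType).

Definition cons_rV n (z : R * 'rV[R]_n) : 'rV[R]_n.+1 :=
  \row_i (if unlift ord0 i is Some j then z.2 ord0 j else z.1).

Lemma cons_rV0 n (z : R * 'rV[R]_n) : cons_rV z ord0 ord0 = z.1.
Proof. by rewrite mxE unlift_none. Qed.

Lemma cons_rVS n (z : R * 'rV[R]_n) i :
  cons_rV z ord0 (lift ord0 i) = z.2 ord0 i.
Proof. by rewrite mxE liftK. Qed.

Lemma measurable_cons_rV n :
  measurable_fun [set: measurableTypeR R * 'rV[R]_n] (@cons_rV n).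
Proof.
apply: measurable_fun_rVP => i; case: (unliftP ord0 i) => [j|] ->.
  under eq_fun do rewrite cons_rVS.
  by apply: (measurableT_comp (measurable_coord_rV j)); exact: measurable_snd.
under eq_fun do rewrite cons_rV0.
exact: measurable_fst.
Qed.

Fixpoint lebesgue_rV n : {measure set 'rV[R]_n -> \bar R} :=
  if n is m.+1 then
    @measure_function_pushforward__canonical__measure_function_Measure
      _ _ _ _ R ((@lebesgue_measure R) \x^ lebesgue_rV m)%E _
      (@measurable_cons_rV m)
  else dirac (0 : 'rV[R]_0).

Lemma lebesgue_rV_box n (A : 'I_n -> set (measurableTypeR R)) :
  (forall i, measurable (A i)) ->
  lebesgue_rV n [set x | forall i, A i (x ord0 i)] =
  (\prod_(i < n) lebesgue_measure (A i))%E.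
Proof.
elim: n A => [|n IHn] A mA.
  by rewrite big_ord0 /= diracE mem_set// => -[].
rewrite big_ord_recl -IHn//= /pushforward.
pose B := [set x : 'rV[R]_n | forall i, A (lift ord0 i) (x ord0 i)].
have mB : measurable B.
  rewrite (_ : B = \bigcap_(i in [set: 'I_n])
      ((fun x : 'rV[R]_n => x ord0 i : measurableTypeR R) @^-1` A (lift ord0 i))).
    apply: fin_bigcap_measurable => // i _.
    by rewrite -[X in measurable X]setTI; exact: measurable_coord_rV.
  by apply/seteqP; split => x /= Bx i => [_|]; exact: Bx.
rewrite -product_measure2E//; congr (_ _).
apply/seteqP; split => -[r x]/=.
  move=> Ax; split => [|i]; first by have := Ax ord0; rewrite cons_rV0.
  by have := Ax (lift ord0 i); rewrite cons_rVS.
move=> [Ar Bx] i; case: (unliftP ord0 i) => [j|] ->.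
  by rewrite cons_rVS; exact: Bx.
by rewrite cons_rV0.
Qed.

End lebesgue_rV.

Section function_spaces.
Context (R : realType).

(* [f] is C^k on the open set [A]: all directional derivatives of order at most
   [k] exist and are continuous on [A]. *)
Fixpoint Ck_on (V : normedModType R) (A : set V) (k : nat) (f : V -> R) : Prop :=
  (forall x, A x -> {for x, continuous f}) /\
  (if k is m.+1 then
     forall v, (forall x, A x -> derivable f x v) /\ Ck_on A m ('D_v f)
   else True).

Context (N : nat).
Implicit Types (f : 'rV[R]_N -> R) (x : 'rV[R]_N).

(* The norm carried by ['rV[R]_N] in the library is the sup norm. *)
Definition enorm x : R := Num.sqrt (\sum_(i < N) x ord0 i ^+ 2).

Definition partial (i : 'I_N) f : 'rV[R]_N -> R := 'D_(delta_mx ord0 i) f.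

Definition grad f x : 'rV[R]_N := \row_(i < N) partial i f x.

Definition divergence (F : 'rV[R]_N -> 'rV[R]_N) x : R :=
  \sum_(i < N) partial i (fun y => F y ord0 i) x.

Definition plaplacian (p : R) f : 'rV[R]_N -> R :=
  divergence (fun y => enorm (grad f y) `^ (p - 2) *: grad f y).

Definition test_function f : Prop :=
  (forall k, Ck_on [set: 'rV[R]_N] k f) /\ compact (closure [set x | f x != 0]).

Definition weak_partial (i : 'I_N) f g : Prop :=
  forall phi, test_function phi ->
    \int[lebesgue_rV R N]_x (f x * partial i phi x) =
    - \int[lebesgue_rV R N]_x (g x * phi x).

Definition in_L1 f : Prop := f \in Lfun (lebesgue_rV R N) 1%E.

Definition in_Loo f : Prop := f \in Lfun (lebesgue_rV R N) +oo%E.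

Definition in_W1oo f : Prop :=
  in_Loo f /\ forall i, exists2 g, in_Loo g & weak_partial i f g.

End function_spaces.

Section viscosity.
Context (R : realType) (N : nat).
Notation spacetime := (R * 'rV[R]_N)%type.
Implicit Types (p q r : R) (u psi : spacetime -> R) (z : spacetime).

Definition Qoo : set spacetime := [set z | 0 < z.1].

Definition dt psi z : R := derive1 (fun s => psi (s, z.2)) z.1.

Definition sgrad psi z : 'rV[R]_N := grad (fun y => psi (z.1, y)) z.2.

Definition splaplacian p psi z : R := plaplacian p (fun y => psi (z.1, y)) z.2.

(* [df] is the derivative of [f] on [0, oo), one-sided at 0. *)
Definition derivative_nneg (f df : R -> R) : Prop :=
  forall r, 0 <= r ->
    (f s - f r) / (s - r) @[s --> within [set s | 0 <= s] r^'] --> df r.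

Definition class_F p (f : R -> R) : Prop :=
  exists df d2f : R -> R,
    [/\ derivative_nneg f df,
        derivative_nneg df d2f &
        {within [set r | 0 <= r], continuous d2f}] /\
    [/\ f 0 = 0, df 0 = 0, d2f 0 = 0,
        forall r, 0 < r -> 0 < d2f r &
        `|df r| `^ (p - 2) * d2f r @[r --> 0^'+] --> (0 : R)].

Definition time_modulus (omega : R -> R) : Prop :=
  [/\ {within [set r | 0 <= r], continuous omega},
      forall r, 0 <= r -> 0 <= omega r &
      omega r / r @[r --> 0^'+] --> (0 : R)].

Definition class_A p psi : Prop :=
  Ck_on Qoo 2 psi /\
  forall z0, Qoo z0 -> sgrad psi z0 = 0 ->
    exists delta f omega,
      [/\ 0 < delta, class_F p f, time_modulus omega &
        forall z, Qoo z -> enorm (z.2 - z0.2) + `|z.1 - z0.1| < delta ->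
          `|psi z - psi z0 - dt psi z0 * (z.1 - z0.1)|
            <= f (enorm (z.2 - z0.2)) + omega `|z.1 - z0.1|].

Definition lsc_on (A : set spacetime) u : Prop :=
  lower_semicontinuous (EFin \o u : subspace A -> \bar R).

Definition usc_on (A : set spacetime) u : Prop := lsc_on A (\- u).

Definition viscosity_subsolution p q u : Prop :=
  usc_on Qoo u /\
  forall psi z0, class_A p psi -> Qoo z0 -> u z0 = psi z0 ->
    (forall z, Qoo z -> z != z0 -> u z < psi z) ->
    (sgrad psi z0 != 0 ->
       dt psi z0 <= splaplacian p psi z0 - enorm (sgrad psi z0) `^ q) /\
    (sgrad psi z0 = 0 -> dt psi z0 <= 0).

Definition viscosity_supersolution p q u : Prop :=
  lsc_on Qoo u /\
  forall psi z0, class_A p psi -> Qoo z0 -> u z0 = psi z0 ->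
    (forall z, Qoo z -> z != z0 -> psi z < u z) ->
    (sgrad psi z0 != 0 ->
       splaplacian p psi z0 - enorm (sgrad psi z0) `^ q <= dt psi z0) /\
    (sgrad psi z0 = 0 -> 0 <= dt psi z0).

Definition viscosity_solution p q u : Prop :=
  [/\ {within Qoo, continuous u},
      viscosity_subsolution p q u & viscosity_supersolution p q u].

(* Only the values of [u] at times [t >= 0] are relevant. *)
Definition nonneg_cauchy_solution p q (u0 : 'rV[R]_N -> R) u : Prop :=
  [/\ viscosity_solution p q u,
      {within [set z : spacetime | 0 <= z.1], continuous u},
      forall x, u (0, x) = u0 x &
      forall t x, 0 <= t -> 0 <= u (t, x)].

End viscosity.

Section statement.
Context (R : realType) (N : nat).

Definition p_c : R := 2 * N%:R / (N%:R + 1).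

Definition q_star (p : R) : R := p - N%:R / (N%:R + 1).

Definition q_1 (p : R) : R := Num.max (p - 1) (N%:R / (N%:R + 1)).

(* [x = 0] is excluded because [0 `^ (- a)] is 0, not +oo, for [a > 0]. *)
Definition decay_bound (u0 : 'rV[R]_N -> R) (C0 a : R) : Prop :=
  forall x, x != 0 -> u0 x <= C0 * enorm x `^ (- a).

Definition norm1 (u : R * 'rV[R]_N -> R) (t : R) : \bar R :=
  'N[lebesgue_rV R N]_1%E [EFin \o (fun x => u (t, x))].

Definition normoo (u : R * 'rV[R]_N -> R) (t : R) : \bar R :=
  'N[lebesgue_rV R N]_+oo%E [EFin \o (fun x => u (t, x))].

End statement.

(* Main.v *)
From HB Require Import structures.
Require Import Defs.
From mathcomp Require Import all_boot all_order all_algebra.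
From mathcomp Require Import all_classical all_reals all_analysis.
From mathcomp Require Import measurable_realfun ess_sup_inf.
From mathcomp Require Import zify ring lra.
Import Order.TTheory GRing.Theory Num.Theory.
Import numFieldNormedType.Exports.
Local Open Scope classical_set_scope.
Local Open Scope ring_scope.

Set Implicit Arguments.
Unset Strict Implicit.
Unset Printing Implicit Defensive.

(* For [p - 1 < Q < p] put [a = (p - Q) / (Q - p + 1)]. For [K] large, the function
   [W = K (|x| + g t)^(- a)] satisfies [Delta_p W <= |grad W|^Q / 2], hence it is a supersolution
   for [q = Q] wherever [2 g' <= (K a)^(Q - 1) (|x| + g)^((1 - Q) (a + 1))], and also for [q <= Q]
   wherever moreover [|grad W| <= 1]. The pointwise bound on [u0] is [u0 <= W] at [t = 0], and
   [u <= W] gives the three claims, with [g] of order [t^((q - p + 1) / (2 q - p))] in (i),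
   [g = expR (c t)] in (ii), and [g = (A - B t)^((Q - p + 1) / (2 Q - p))] in (iii), where the
   exponent is negative and [g] becomes infinite at [t = A / B].

   The comparison of [u] with [W] takes place on a bounded set, since [u] tends to 0 at infinity
   uniformly on bounded time intervals: as [p < 2], there are supersolutions of the equation without
   absorption that are infinite on the boundary of a ball, and they control [u] at the center
   by [u0] on the ball alone. At a first contact point the second-order expansion of [W] has to be
   turned into a test function of [class_A] that stays above [u] on the whole space: near a possible
   critical point of the test function one truncates it to a constant, through a function with a
   zero of high order there. *)

(** * Calculus *)

(** The exponent [a] balances diffusion and absorption: for [|x|^(- a)], both [Delta_p W] and
    [|grad W|^Q] scale as the same power of [|x|] exactly when [(a + 1) (Q - p + 1) = 1]. At [x = 0]
    the condition on [g'] reads [g' <= c g^e] with [e = (1 - Q) (a + 1) = 1 - (2 Q - p) / (Q - p +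
    1)]; its extremal solutions are powers, exponentials, or blow up in finite time according to the
    sign of [2 Q - p], whence the three claims. Away from 0 the condition is harmless if [e >= 0],
    but [e < 0] when [Q > 1]; for (i), a preliminary comparison with a stationary barrier therefore
    confines possible contacts to [|x| < g].

    [W] has a corner at [x = 0]. Since [W] decreases in [|x|], and [|x|] lies above its supporting
    linear functions, [W] lies below a function of a single linear coordinate that touches it at the
    contact point. This settles the corner and drops the contribution of the other directions to
    [Delta_p W], which is nonpositive. Test functions can then be built from a linear coordinate and
    a squared distance.

    Integrability of [W] requires [a > N], that is [q < q_star]. *)

Section Ck_on_calculus.
Context (R : realType) (V : normedModType R).
Implicit Types (f g : V -> R).

Lemma Ck_on_sub (A B : set V) k f : B `<=` A -> Ck_on A k f -> Ck_on B k f.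
Proof.
elim: k f => [|k IH] f BA /= [cf Df]; split => //.
- by move=> x /BA /cf.
- by move=> x /BA /cf.
- move=> v; have [d D] := Df v; split; last exact: IH.
  by move=> x /BA /d.
Qed.

Lemma Ck_onS (A : set V) k f : Ck_on A k.+1 f -> Ck_on A k f.
Proof.
elim: k f => [|k IH] f; first by move=> [cf _]; split.
move=> [cf Df]; split => // v; have [d D] := Df v; split => //.
exact: IH.
Qed.

Lemma Ck_on_continuous (A : set V) k f : Ck_on A k f -> forall x, A x -> {for x, continuous f}.
Proof. by case: k => [|k] [cf _]. Qed.

Lemma Ck_on_cst k (c : R) : Ck_on [set: V] k (fun=> c).
Proof.
elim: k c => [|k IH] c; split; rewrite ?/= //; try by move=> x _; exact: cvg_cst.
move=> v; split => [x _|]; first exact: derivable_cst.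
suff -> : 'D_v (fun=> c) = (fun=> 0 : R) by [].
by apply/funext => x; exact: derive_cst.
Qed.

Lemma Ck_onD k f g : Ck_on [set: V] k f -> Ck_on [set: V] k g -> Ck_on [set: V] k (fun x => f x + g x).
Proof.
elim: k f g => [|k IH] f g [cf Df] [cg Dg]; split => //.
- by move=> x _; apply: cvgD; [exact: cf|exact: cg].
- by move=> x _; apply: cvgD; [exact: cf|exact: cg].
move=> v; have [df Df'] := Df v; have [dg Dg'] := Dg v; split.
  by move=> x _; apply: derivableD; [exact: df|exact: dg].
rewrite (_ : 'D_v _ = (fun x => 'D_v f x + 'D_v g x)); first exact: IH.
by apply/funext => x; apply: deriveD; [exact: df|exact: dg].
Qed.

Lemma Ck_onM k f g : Ck_on [set: V] k f -> Ck_on [set: V] k g -> Ck_on [set: V] k (fun x => f x * g x).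
Proof.
elim: k f g => [|k IH] f g Hf Hg; have [cf Df] := Hf; have [cg Dg] := Hg; split => //.
- by move=> x _; apply: cvgM; [exact: cf|exact: cg].
- by move=> x _; apply: cvgM; [exact: cf|exact: cg].
move=> v; have [df Df'] := Df v; have [dg Dg'] := Dg v; split.
  by move=> x _; apply: derivableM; [exact: df|exact: dg].
rewrite (_ : 'D_v _ = (fun x => f x * 'D_v g x + g x * 'D_v f x)).
  by apply: Ck_onD; apply: IH => //; exact: Ck_onS.
by apply/funext => x; apply: deriveM; [exact: df|exact: dg].
Qed.

Lemma Ck_on_sum k n (F : 'I_n -> V -> R) : (forall i, Ck_on [set: V] k (F i)) ->
  Ck_on [set: V] k (fun x => \sum_(i < n) F i x).
Proof.
elim: n F => [|n IH] F HF.
  rewrite (_ : (fun x : V => \sum_(i < 0) F i x) = fun=> 0); first exact: Ck_on_cst.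
  by apply/funext => x; rewrite big_ord0.
rewrite (_ : (fun x : V => \sum_(i < n.+1) F i x) =
  fun x => \sum_(i < n) F (widen_ord (leqnSn n) i) x + F ord_max x).
  by apply: Ck_onD => //; exact: IH.
by apply/funext => x; rewrite big_ord_recr.
Qed.

(** Only a directional derivative of [f] is assumed, so the claim is moved to the real line: the
    derivative along [v] is that of [h |-> f (h *: v + x)] at 0. *)
Lemma is_derive_comp_real (phi : R -> R) f (x v : V) (d e : R) :
  is_derive x v f e -> is_derive (f x) 1 phi d -> is_derive x v (phi \o f) (d * e).
Proof.
move=> Hf Hphi.
have Hf1 : is_derive (0:R) 1 (fun h : R => f (h *: v + x)) e.
  case: Hf => Df <-; split; first by rewrite -derivable1P.
  rewrite /derive; set g1 := fun h => h^-1 *: _; set g2 := fun h => h^-1 *: _.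
  suff -> : g1 = g2 by [].
  by apply/funext => h; rewrite /g1 /g2 /= addr0 scale0r add0r [h *: 1]mulr1.
have Hphi1 : is_derive ((fun h : R => f (h *: v + x)) 0) 1 phi d by rewrite /= scale0r add0r.
have [D E] := is_derive1_comp (f := phi) (g := fun h : R => f (h *: v + x)).
split; first by rewrite derivable1P.
rewrite -E /derive; set g1 := fun h => h^-1 *: _; set g2 := fun h => h^-1 *: _.
suff -> : g1 = g2 by [].
by apply/funext => h; rewrite /g1 /g2 /= addr0 scale0r add0r [h *: 1]mulr1.
Qed.

(* [phi i] is the [i]-th derivative of [phi 0]. *)
Lemma Ck_on_comp k (phi : nat -> R -> R) f :
  (forall i, (i < k)%N -> forall x : R, is_derive x 1 (phi i) (phi i.+1 x)) ->
  continuous (phi k) -> Ck_on [set: V] k f -> Ck_on [set: V] k (fun x => phi 0%N (f x)).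
Proof.
elim: k phi f => [|k IH] phi f Hphi cphi Hf; split => //.
- move=> x _; apply: (@continuous_comp _ _ _ f (phi 0%N)); last exact: cphi.
  exact: (Ck_on_continuous Hf).
- move=> x _; apply: (@continuous_comp _ _ _ f (phi 0%N)); first exact: (Ck_on_continuous Hf).
  have [D _] := Hphi 0%N isT (f x).
  exact/differentiable_continuous/derivable1_diffP.
move=> v; have [_ /(_ v)[df Df]] := Hf.
have Hd x : is_derive x v (fun x => phi 0%N (f x)) (phi 1%N (f x) * 'D_v f x).
  by apply: is_derive_comp_real; [apply: derivableP; exact: df|exact: Hphi].
split; first by move=> x _; case: (Hd x).
rewrite (_ : 'D_v _ = fun x => phi 1%N (f x) * 'D_v f x); last first.
  by apply/funext => x; case: (Hd x).
apply: Ck_onM => //; apply: (IH (fun i => phi i.+1)) => //; last exact: Ck_onS.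
by move=> i ik; exact: Hphi.
Qed.

Lemma Ck_on_lin k f : continuous f -> (forall (h : R) v x, f (h *: v + x) = h * f v + f x) ->
  Ck_on [set: V] k f /\ forall x v, is_derive x v f (f v).
Proof.
move=> cf lf.
have Hd x v : is_derive x v f (f v).
  have H : h^-1 *: ((f \o shift x) (h *: v) - f x) @[h --> 0^'] --> f v.
    apply: cvg_near_cst; near=> h; rewrite /= lf addrK /GRing.scale/= mulKf//.
    by near: h; exact: nbhs_dnbhs_neq.
  apply: DeriveDef; first by apply/cvg_ex; exists (f v).
  exact: (cvg_lim _ H).
split => //; case: k => [|k]; first by split => // x _; exact: cf.
split; first by move=> x _; exact: cf.
move=> v; split; first by move=> x _; case: (Hd x v).
rewrite (_ : 'D_v f = fun=> f v); first exact: Ck_on_cst.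
by apply/funext => x; case: (Hd x v).
Unshelve. all: by end_near. Qed.

End Ck_on_calculus.

Lemma is_derive_fun_cst (R : numFieldType) (V W : normedModType R) (c : W) (x v : V) :
  is_derive x v (fun=> c) 0.
Proof. exact: (is_derive_cst c x v). Qed.

(** * Gluing, truncated powers, and two functions built from them *)

Section glue.
Context (R : realType).
Implicit Types (c : R) (f g : R -> R).

Definition glue c f g : R -> R := fun x => if x < c then f x else g x.

Lemma glue_cvg (c : R) f g (h : R -> R) (l : R) :
  (forall x, x < c -> h x = f x) -> (forall x, c < x -> h x = g x) ->
  f x @[x --> c^'] --> l -> g x @[x --> c^'] --> l -> h x @[x --> c^'] --> l.
Proof.
move=> hf hg /cvgrPdist_lt cf /cvgrPdist_lt cg; apply/cvgrPdist_lt => e e0.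
near=> x.
have [xc|cx|xc] := ltgtP x c.
- by rewrite hf//; near: x; exact: cf.
- by rewrite hg//; near: x; exact: cg.
- by exfalso; move/eqP: xc; apply/negP; near: x; exact: nbhs_dnbhs_neq.
Unshelve. all: by end_near. Qed.

Lemma is_derive_glue c f g (f1 g1 : R -> R) :
  (forall x, x <= c -> is_derive x 1 f (f1 x)) -> (forall x, c <= x -> is_derive x 1 g (g1 x)) ->
  f c = g c -> f1 c = g1 c -> forall x : R, is_derive x 1 (glue c f g) (glue c f1 g1 x).
Proof.
move=> df dg fg fg1 x; rewrite {2}/glue; have [xc|cx|->] := ltgtP x c.
- apply: near_eq_is_derive (df _ (ltW xc)); near=> y.
  by rewrite /glue; case: ltP => //; rewrite leNgt => /negP; case; near: y; exact: lt_nbhsl.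
- apply: near_eq_is_derive (dg _ (ltW cx)); near=> y.
  by rewrite /glue; case: ltP => // yc; exfalso; move: yc; apply/negP; rewrite -leNgt ltW//; near: y; exact: lt_nbhsr.
have [Df Ef] := df _ (lexx c); have [Dg Eg] := dg _ (lexx c).
have H : h^-1 *: ((glue c f g \o shift c) (h *: 1) - glue c f g c) @[h --> (0:R)^'] --> g1 c.
  apply: (@glue_cvg 0 (fun h => h^-1 *: ((f \o shift c) (h *: 1) - f c))
                      (fun h => h^-1 *: ((g \o shift c) (h *: 1) - g c))).
  - by move=> h h0; rewrite /glue ltxx fg /= [h *: 1]mulr1 gtrDr h0.
  - by move=> h h0; rewrite /glue ltxx /= [h *: 1]mulr1 gtrDr ltNge (ltW h0).
  - by rewrite -fg1 -Ef; exact: Df.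
  - by rewrite -Eg; exact: Dg.
apply: DeriveDef; first by apply/cvg_ex; exists (g1 c).
exact: (cvg_lim _ H).
Unshelve. all: by end_near. Qed.

Lemma continuous_glue c f g : continuous f -> continuous g -> f c = g c -> continuous (glue c f g).
Proof.
move=> cf cg fg x; have [xc|cx|->] := ltgtP x c.
- rewrite /continuous_at {2}/glue xc; apply: cvg_trans (cf x); apply: near_eq_cvg; near=> y.
  by rewrite /glue; case: ltP => //; rewrite leNgt => /negP; case; near: y; exact: lt_nbhsl.
- rewrite /continuous_at {2}/glue ltNge (ltW cx) /=; apply: cvg_trans (cg x); apply: near_eq_cvg; near=> y.
  by rewrite /glue; case: ltP => // yc; exfalso; move: yc; apply/negP; rewrite -leNgt ltW//; near: y; exact: lt_nbhsr.
rewrite /continuous_at {2}/glue ltxx; apply/cvgrPdist_lt => e e0.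
have /cvgrPdist_lt Hf := cf c; have /cvgrPdist_lt Hg := cg c.
near=> y; rewrite /glue; case: (ltP y c) => yc.
  by rewrite -fg; near: y; exact: Hf.
by near: y; exact: Hg.
Unshelve. all: by end_near. Qed.

End glue.

Section posp.
Context (R : realType).

(** The truncated power [x_+ ^ n]; for [n = 0] it is the indicator of [x >= 0], which explains the
    lower bounds on [n] below. *)
Definition posp n (x : R) : R := glue 0 (fun=> 0) (fun y => y ^+ n) x.

Lemma posp_ge0 n x : 0 <= posp n x.
Proof. by rewrite /posp /glue; case: ltP => // x0; exact: exprn_ge0. Qed.

Lemma posp_neg n x : (0 < n)%N -> x <= 0 -> posp n x = 0.
Proof.
move=> n0; rewrite /posp /glue le_eqVlt => /predU1P[->|->//].
by rewrite ltxx expr0n; case: n n0.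
Qed.

Lemma posp_pos n x : 0 <= x -> posp n x = x ^+ n.
Proof. by rewrite /posp /glue leNgt => /negbTE ->. Qed.

Lemma is_derive_expr n (y : R) : is_derive y 1 (fun y => y ^+ n) (n%:R * y ^+ n.-1).
Proof.
rewrite (_ : (fun y => y ^+ n) = id ^+ n); last by apply/funext => z; rewrite exprfctE.
apply: (is_derive_eq (@is_deriveX _ _ id n y 1 1 (is_derive_id y 1))).
by rewrite [_ *: _]mulr1.
Qed.

Lemma is_derive_posp n (x : R) : (2 <= n)%N -> is_derive x 1 (posp n) (n%:R * posp n.-1 x).
Proof.
move=> n2.
have -> : n%:R * posp n.-1 x = glue 0 (fun=> 0) (fun y => n%:R * y ^+ n.-1) x.
  by rewrite /posp /glue; case: ltP => // _; rewrite mulr0.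
apply: (is_derive_glue (fun y _ => is_derive_fun_cst (0:R) y 1) (fun y _ => is_derive_expr n y)).
- by rewrite /= expr0n gtn_eqF// ltnW.
- by rewrite /= expr0n gtn_eqF ?mulr0//; case: n n2 => [|[]].
Qed.

Lemma continuous_posp n : (0 < n)%N -> continuous (posp n).
Proof.
move=> n0; apply: continuous_glue => [x|x|]; first exact: cvg_cst.
  by apply: exprn_continuous.
by rewrite expr0n; case: n n0.
Qed.

End posp.

Section growth.
Context (R : realType) (a : nat -> R).
Hypothesis a_ge0 : forall n, 0 <= a n.

(* A C^2 convex function vanishing on ]-oo, 1] that grows as fast as wanted (for [d = 3]);
   [d] and [d.-1] are linked by differentiation. *)
Definition growth d (x : R) : R := \sum_(n < (Num.truncn x).+1) a n * posp d (x - n.+1%:R).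

(** Summands with [n >= M] vanish at [x]. A range that does not move with [x] is what allows
    differentiating term by term. *)
Lemma growth_sum d x M : (0 < d)%N -> x <= M%:R ->
  growth d x = \sum_(n < M) a n * posp d (x - n.+1%:R).
Proof.
move=> d0 xM.
have step m m' : (m <= m')%N -> x <= m%:R ->
    \sum_(n < m) a n * posp d (x - n.+1%:R) = \sum_(n < m') a n * posp d (x - n.+1%:R).
  move=> mm' xm; rewrite -(subnKC mm') big_split_ord /= [X in _ + X]big1 ?addr0//.
  move=> i _; rewrite posp_neg ?mulr0// subr_le0 (le_trans xm)// ler_nat.
  by rewrite -addnS leq_addr.
have xt : x <= (Num.truncn x).+1%:R by rewrite ltW// truncnS_gt.
have [le|/ltnW le] := leqP (Num.truncn x).+1 M; first exact: step.
by rewrite /growth -(step _ _ le).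
Qed.

Lemma near_growth d (x : R) : (0 < d)%N ->
  \forall y \near x, growth d y = \sum_(n < (Num.truncn x).+1) a n * posp d (y - n.+1%:R).
Proof.
move=> d0; near=> y; apply: growth_sum => //; apply: ltW.
by near: y; apply: lt_nbhsl; exact: truncnS_gt.
Unshelve. all: by end_near. Qed.

Lemma is_derive_growth d (x : R) : (2 <= d)%N -> is_derive x 1 (growth d) (d%:R * growth d.-1 x).
Proof.
move=> d2.
have H : is_derive x 1 (\sum_(n < (Num.truncn x).+1) (fun y => a n * posp d (y - n.+1%:R)))
    (\sum_(n < (Num.truncn x).+1) a n * (d%:R * posp d.-1 (x - n.+1%:R))).
  apply: is_derive_sum => n.
  have H1 : is_derive x 1 (posp d \o shift (- n.+1%:R)) (d%:R * posp d.-1 (x - n.+1%:R) * 1).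
    by apply: is_derive1_comp; [exact: is_derive_posp|exact: is_derive_shift].
  have /is_derive_eq := @is_deriveZ _ _ _ _ (a n) x 1 _ H1; apply.
  by rewrite mulr1.
have -> : d%:R * growth d.-1 x =
    \sum_(n < (Num.truncn x).+1) a n * (d%:R * posp d.-1 (x - n.+1%:R)).
  by rewrite mulr_sumr; apply: eq_bigr => n _; rewrite mulrCA.
apply: near_eq_is_derive H; have := @near_growth d x (ltnW d2); apply: filterS => y ->.
by rewrite fct_sumE.
Qed.

Lemma continuous_growth d : (0 < d)%N -> continuous (growth d).
Proof.
move=> d0 x.
rewrite /continuous_at /growth.
have := @near_growth d x d0; rewrite /growth => H.
apply: cvg_trans; first by apply: near_eq_cvg; apply: filterS H => y ->.
pose M := (Num.truncn x).+1.
suff : Ck_on [set: R] 0 (fun y : R => \sum_(n < M) a n * posp d (y - n.+1%:R)).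
  by move=> /Ck_on_continuous/(_ x I).
apply: Ck_on_sum => n; split => // y _.
apply: cvgM; first exact: cvg_cst.
have := @continuous_comp R R R (fun t => t - n.+1%:R) (posp d) y; apply.
  by apply: cvgB; [exact: cvg_id|exact: cvg_cst].
exact: continuous_posp.
Qed.

Lemma growth_ge0 d x : 0 <= growth d x.
Proof. by apply: sumr_ge0 => n _; rewrite mulr_ge0// posp_ge0. Qed.

Lemma growth_eq0 d x : (0 < d)%N -> x <= 1 -> growth d x = 0.
Proof.
move=> d0 x1; rewrite /growth big1// => n _; rewrite posp_neg ?mulr0// subr_le0.
by rewrite (le_trans x1)// ler1n.
Qed.

(** The base of the [n]-th summand is at least 1 there, and the other summands are nonnegative. *)
Lemma growth_ge n x : n.+2%:R <= x -> a n <= growth 3 x.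
Proof.
move=> nx.
have nt : (n < (Num.truncn x).+1)%N.
  rewrite -(ltr_nat R); apply: le_lt_trans (truncnS_gt x); apply: le_trans nx.
  by rewrite ler_nat; lia.
rewrite /growth (bigD1 (Ordinal nt)) //= -[leLHS]addr0 lerD//.
  rewrite -[leLHS]mulr1 ler_wpM2l// posp_pos; last first.
    by rewrite subr_ge0; apply: le_trans nx; rewrite ler_nat.
  by apply: exprn_ege1; move: nx; rewrite -[n.+2%:R]natr1; lra.
by apply: sumr_ge0 => i _; rewrite mulr_ge0// posp_ge0.
Qed.

(** Convexity and the value 0 at 0: the right factor is the derivative, and the tangent at [x]
    passes below the origin. *)
Lemma growth_convex x : 0 <= x -> growth 3 x <= x * (3 * growth 2 x).
Proof.
move=> x0; rewrite /growth !mulr_sumr; apply: ler_sum => n _.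
rewrite [leRHS](_ : _ = a n * (3 * x * posp 2 (x - n.+1%:R))); last by ring.
apply: ler_wpM2l => //.
have [xn|nx] := leP (x - n.+1%:R) 0; first by rewrite !posp_neg// mulr0.
rewrite !(posp_pos _ (ltW nx)) exprS ler_wpM2r ?sqr_ge0//.
have : 0 <= n.+1%:R :> R by []. lra.
Qed.

End growth.

Section flatten.
Context (R : realType) (n : nat).
Hypothesis n3 : (3 <= n)%N.

(** The value forced by a C^2 junction with the identity at 1: the slope [n - h0 (n + 1)] must be 1,
    and then the second derivative [n (n - 1) - h0 (n + 1) n] vanishes too. *)
Let h0 : R := n.-1%:R / n.+1%:R.

(* A C^2 function equal to the identity on [1, +oo[, constant on ]-oo, 0], and
   with vanishing order [n] at 0. *)
Definition flatten : R -> R := glue 1 (fun t => h0 + posp n t - h0 * posp n.+1 t) id.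
Definition flatten1 : R -> R :=
  glue 1 (fun t => n%:R * posp n.-1 t - n.-1%:R * posp n t) (fun=> 1).
Definition flatten2 : R -> R :=
  glue 1 (fun t => n%:R * n.-1%:R * (posp n.-2 t - posp n.-1 t)) (fun=> 0).

Let h0E : h0 * n.+1%:R = n.-1%:R.
Proof. by rewrite /h0 divfK. Qed.

Let nE : n%:R = n.-1%:R + 1 :> R.
Proof. by rewrite natr1; case: n n3. Qed.

Lemma is_derive_flatten (x : R) : is_derive x 1 flatten (flatten1 x).
Proof.
have H (y : R) : is_derive y 1 (fun t => h0 + posp n t - h0 * posp n.+1 t)
    (n%:R * posp n.-1 y - n.-1%:R * posp n y).
  have H1 := @is_derive_posp R n y (ltnW n3).
  have H2 := @is_deriveZ _ _ _ _ h0 y 1 _ (@is_derive_posp R n.+1 y (ltnW (ltnW n3))).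
  have /is_derive_eq := is_deriveB (is_deriveD (is_derive_fun_cst h0 y 1) H1) H2; apply.
  by rewrite add0r /= /GRing.scale/= mulrA h0E.
apply: (is_derive_glue (fun y _ => H y) (fun y _ => is_derive_id y 1)).
- by rewrite !posp_pos// !expr1n mulr1 addrAC subrr add0r.
- by rewrite !posp_pos// !expr1n !mulr1 nE; ring.
Qed.

Lemma is_derive_flatten1 (x : R) : is_derive x 1 flatten1 (flatten2 x).
Proof.
have H (y : R) : is_derive y 1 (fun t => n%:R * posp n.-1 t - n.-1%:R * posp n t)
    (n%:R * n.-1%:R * (posp n.-2 y - posp n.-1 y)).
  have n2 : (2 <= n.-1)%N by case: n n3 => // -[//|[|]].
  have H1 := @is_deriveZ _ _ _ _ (n%:R) y 1 _ (@is_derive_posp R n.-1 y n2).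
  have H2 := @is_deriveZ _ _ _ _ (n.-1%:R) y 1 _ (@is_derive_posp R n y (ltnW n3)).
  have /is_derive_eq := is_deriveB H1 H2; apply.
  by rewrite /= /GRing.scale/=; ring.
apply: (is_derive_glue (fun y _ => H y) (fun y _ => is_derive_fun_cst (1:R) y 1)).
- by rewrite !posp_pos// !expr1n !mulr1 nE; ring.
- by rewrite !posp_pos// !expr1n subrr mulr0.
Qed.

Lemma continuous_flatten2 : continuous flatten2.
Proof.
apply: continuous_glue => [x|x|].
- apply: cvgM; first exact: cvg_cst.
  by apply: cvgB; apply: continuous_posp; case: n n3 => [|[|[|]]].
- exact: cvg_cst.
- by rewrite !posp_pos// !expr1n subrr mulr0.
Qed.

Lemma flatten_id x : 1 <= x -> flatten x = x.
Proof. by rewrite /flatten /glue leNgt => /negbTE ->. Qed.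

Lemma flatten1_id x : 1 <= x -> flatten1 x = 1.
Proof. by rewrite /flatten1 /glue leNgt => /negbTE ->. Qed.

Lemma flatten_neg x : x <= 0 -> flatten x = h0.
Proof.
move=> x0; rewrite /flatten /glue (le_lt_trans x0)// !posp_neg//; last by case: n n3.
by rewrite mulr0 subr0 addr0.
Qed.

Lemma flatten1_gt0 x : 0 < x -> 0 < flatten1 x.
Proof.
move=> x0; rewrite /flatten1 /glue; case: (ltP x 1) => // x1.
rewrite !(posp_pos _ (ltW x0)).
have -> : x ^+ n = x * x ^+ n.-1 by rewrite -exprS; case: n n3.
rewrite mulrA -mulrBl mulr_gt0 ?exprn_gt0// nE.
have : n.-1%:R * x <= n.-1%:R :> R by rewrite ler_piMr// ltW.
lra.
Qed.

Let flatten1_le1 x : 0 <= x <= 1 -> flatten1 x <= 1.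
Proof.
move=> /andP[x0 x1]; rewrite /flatten1 /glue; case: (ltP x 1) => // _.
rewrite !posp_pos//; case: n n3 => // m _ /=; elim: m => [|m IH].
  by rewrite expr0 mulr1 mul0r subr0.
(* With [n = m + 1] the slope is [(m + 1) x^m - m x^(m + 1)]; raising [m] by one lowers it by
   [(m + 1) x^m (1 - x)^2]. *)
apply: le_trans IH; rewrite -subr_ge0.
rewrite (_ : _ - _ = m.+1%:R * x ^+ m * (1 - x) ^+ 2); last first.
  by rewrite !exprS -!natr1; ring.
by rewrite mulr_ge0 ?sqr_ge0// mulr_ge0// exprn_ge0.
Qed.

(** Slope at most 1 on [[0, 1]] and value 1 at 1 keep the graph above the diagonal to the left of 1.
    So truncation can only raise a test function, which preserves a contact from above. *)
Lemma flatten_ge x : x <= flatten x.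
Proof.
have [x1|x1] := leP 1 x; first by rewrite flatten_id.
have [x0|x0] := leP x 0.
  by rewrite flatten_neg// (le_trans x0)// /h0 divr_ge0.
have [||c] := @MVT_segment R flatten flatten1 x 1 (ltW x1).
- by move=> y _; exact: is_derive_flatten.
- apply: derivable_within_continuous => y _.
  by have [] := is_derive_flatten y.
rewrite in_itv/= => /andP[xc c1]; rewrite flatten_id// => E.
have : flatten1 c * (1 - x) <= 1 - x.
  by rewrite ler_piMl ?subr_ge0 ?(ltW x1)// flatten1_le1// c1 (le_trans (ltW x0)).
lra.
Qed.

Lemma flatten_flat x : x <= 1 -> `|flatten x - h0| <= posp n x.
Proof.
move=> x1; have [x0|x0] := leP x 0.
  by rewrite flatten_neg// subrr normr0 posp_ge0.
have -> : flatten x = h0 + posp n x - h0 * posp n.+1 x.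
  rewrite /flatten /glue; case: (ltP x 1) => // x1'.
  have -> : x = 1 by apply/le_anti; rewrite x1.
  by rewrite !posp_pos// !expr1n; ring.
rewrite !(posp_pos _ (ltW x0)).
have h0_ge0 : 0 <= h0 by rewrite divr_ge0.
have h0_le1 : h0 <= 1 by rewrite ler_pdivrMr// mul1r ler_nat; lia.
have xn : x ^+ n.+1 <= x ^+ n by rewrite exprS ler_piMl// exprn_ge0// ltW.
have xn0 : 0 <= x ^+ n.+1 by rewrite exprn_ge0// ltW.
have E : 0 <= h0 * x ^+ n.+1 by rewrite mulr_ge0.
have E' : h0 * x ^+ n.+1 <= x ^+ n by apply: le_trans xn; rewrite ler_piMl.
rewrite ger0_norm; lra.
Qed.

End flatten.

(** * Admissible moduli and pointwise Taylor estimates *)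

Section real_calculus.
Context (R : realType).
Implicit Types (f : R -> R) (x d : R).

Lemma is_derive_monomial (k : R) n x : is_derive x 1 (fun y => k * y ^+ n) (k * n%:R * x ^+ n.-1).
Proof.
have /is_derive_eq := @is_deriveZ _ _ _ _ k x 1 _ (is_derive_expr n x); apply.
by rewrite /GRing.scale /= mulrA.
Qed.

Lemma is_derive_slope f x d : is_derive x 1 f d ->
  (f s - f x) / (s - x) @[s --> x^'] --> d.
Proof.
move=> /is_derive1_caratheodory[g [fg cg gx]].
have : g s @[s --> x^'] --> d by rewrite -gx; exact: cvg_within_filter.
apply: cvg_trans; apply: near_eq_cvg; near=> s.
rewrite fg mulfK// subr_eq0; near: s; exact: nbhs_dnbhs_neq.
Unshelve. all: by end_near. Qed.

Lemma derivative_nneg_is_derive f df : (forall x, is_derive x 1 f (df x)) -> derivative_nneg f df.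
Proof. by move=> Hf r _; apply: cvg_within_filter; exact: is_derive_slope. Qed.

(** For [r ^+ n] the quantity [|f'|^(p - 2) f''] is of order [r^((n - 1) (p - 1) - 1)], so the
    hypothesis on [n] is the vanishing of this limit; [3 <= n] gives [f''(0) = 0]. *)
Lemma class_F_monomial p (k : R) n : 0 < k -> (3 <= n)%N -> 1 < n.-1%:R * (p - 1) ->
  class_F p (fun r => k * r ^+ n).
Proof.
move=> k0 n3 np.
exists (fun r => k * n%:R * r ^+ n.-1), (fun r => k * n%:R * n.-1%:R * r ^+ n.-2).
have n0 : (0 < n)%N by case: n n3 {np}.
have n10 : (0 < n.-1)%N by case: n n3 {np n0} => [|[]].
have n20 : (0 < n.-2)%N by case: n n3 {np n0 n10} => [|[|[]]].
have c0 : 0 < k * n%:R by rewrite mulr_gt0 ?ltr0n.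
split; split.
- by apply: derivative_nneg_is_derive => x; exact: is_derive_monomial.
- by apply: derivative_nneg_is_derive => x; exact: is_derive_monomial.
- apply: continuous_subspaceT => x; apply: cvgM; first exact: cvg_cst.
  exact: exprn_continuous.
- by rewrite expr0n gtn_eqF ?mulr0.
- by rewrite expr0n gtn_eqF ?mulr0.
- by rewrite expr0n gtn_eqF ?mulr0.
- by move=> r r0; rewrite !mulr_gt0 ?ltr0n// exprn_gt0.
pose e : R := n.-1%:R * (p - 1) - 1.
have e0 : 0 < e by rewrite subr_gt0.
have E : (k * n%:R) `^ (p - 2) * (k * n%:R * n.-1%:R) * r `^ e @[r --> 0^'+] --> (0 : R).
  rewrite -[X in _ --> X](mulr0 ((k * n%:R) `^ (p - 2) * (k * n%:R * n.-1%:R))).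
  by apply: cvgM; [exact: cvg_cst|exact: powR_cvg0].
apply: cvg_trans E; apply: near_eq_cvg; near=> r.
have r0 : 0 < r by near: r; exact: nbhs_right_gt.
rewrite /= ger0_norm; last by rewrite mulr_ge0 ?(ltW c0)// exprn_ge0// ltW.
rewrite (@powRM _ (k * n%:R) (r ^+ n.-1)) ?(ltW c0) ?exprn_ge0 ?(ltW r0)//.
rewrite -!(powR_mulrn _ (ltW r0)).
rewrite [RHS](_ : _ = (k * n%:R) `^ (p - 2) * (k * n%:R * n.-1%:R) *
  ((r `^ n.-1%:R) `^ (p - 2) * r `^ n.-2%:R)); last by ring.
congr (_ * _); rewrite -powRrM -powRD; last by rewrite (gt_eqF r0) implybT.
congr (_ `^ _).
have -> : n.-1%:R = n.-2%:R + 1 :> R by rewrite natr1; case: n n10 n20 {n3 np n0 c0 e e0} => [|[]].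
by rewrite /e -[n.-1](prednK n10) -natr1 /=; ring.
Unshelve. all: by end_near. Qed.

Lemma time_modulus_sqr (L : R) : 0 <= L -> time_modulus (fun r => L * r ^+ 2).
Proof.
move=> L0; split.
- apply: continuous_subspaceT => x; apply: cvgM; first exact: cvg_cst.
  exact: exprn_continuous.
- by move=> r _; rewrite mulr_ge0// sqr_ge0.
have E : L * r @[r --> 0^'+] --> (0 : R).
  rewrite -[X in _ --> X](mulr0 L); apply: cvgM; first exact: cvg_cst.
  exact: cvg_at_right_filter cvg_id.
apply: cvg_trans E; apply: near_eq_cvg; near=> r.
have r0 : 0 < r by near: r; exact: nbhs_right_gt.
by rewrite expr2 mulrA mulfK// gt_eqF.
Unshelve. all: by end_near. Qed.

Lemma nbhs_dist x (P : R -> Prop) : (\forall y \near x, P y) ->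
  exists2 d, 0 < d & forall y, `|y - x| < d -> P y.
Proof.
move=> /nbhs_ballP[d d0 H]; exists d => // y yx; apply: H.
by rewrite /ball/= distrC.
Qed.

Lemma is_derive_lipschitz f x d : is_derive x 1 f d ->
  exists e L, [/\ 0 < e, 0 < L & forall y, `|y - x| < e -> `|f y - f x| <= L * `|y - x|].
Proof.
move=> /is_derive1_caratheodory[g [fg cg gx]].
have /nbhs_dist[e e0 H] : \forall y \near x, `|g y| < `|d| + 1.
  have /cvgrPdist_lt/(_ _ ltr01) := cg; apply: filterS => y; rewrite gx => H.
  have := ler_normD d (g y - d); rewrite subrKC [`|g y - d|]distrC; lra.
exists e, (`|d| + 1); split => //.
by move=> y /H yx; rewrite fg normrM ler_wpM2r// ltW.
Qed.

(** A mean value theorem for either order of [x] and [y]. The sign condition locates [c] on the same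
    side of [x] as [y], so that one-sided bounds on [f1] can be used. *)
Lemma MVT_dist f f1 x y : (forall z, `|z - x| <= `|y - x| -> is_derive z 1 f (f1 z)) ->
  exists c, [/\ `|c - x| <= `|y - x|, 0 <= (c - x) * (y - x) & f y - f x = f1 c * (y - x)].
Proof.
move=> df; have [yx|xy] := leP y x.
  have [||c] := @MVT_segment R f f1 y x yx.
  - by move=> z; rewrite in_itv/= => /andP[yz zx]; apply: df; rewrite !ler0_norm; lra.
  - apply: derivable_within_continuous => z; rewrite in_itv/= => /andP[yz zx].
    by have [] := df z _; first by rewrite !ler0_norm; lra.
  rewrite in_itv/= => /andP[yc cx] E; exists c; split; first by rewrite !ler0_norm; lra.
    by rewrite mulr_le0//; lra.
  by rewrite -opprB E -mulrN opprB.
have [||c] := @MVT_segment R f f1 x y (ltW xy).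
- by move=> z; rewrite in_itv/= => /andP[yz zx]; apply: df; rewrite !ger0_norm; lra.
- apply: derivable_within_continuous => z; rewrite in_itv/= => /andP[yz zx].
  by have [] := df z _; first by rewrite !ger0_norm; lra.
rewrite in_itv/= => /andP[yc cx] E; exists c; split => //; first by rewrite !ger0_norm; lra.
by rewrite mulr_ge0//; lra.
Qed.

Lemma taylor1_bound f f1 x d (r : R) : 0 < r -> (forall z, `|z - x| < r -> is_derive z 1 f (f1 z)) ->
  is_derive x 1 f1 d -> exists e L, [/\ 0 < e, 0 < L &
    forall y, `|y - x| < e -> `|f y - f x - f1 x * (y - x)| <= L * `|y - x| ^+ 2].
Proof.
move=> r0 df /is_derive_lipschitz[e [L [e0 L0 H]]].
exists (Num.min e r), L; split => //; first by rewrite lt_min e0.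
move=> y; rewrite lt_min => /andP[ye yr].
have [z zx|c [cx _ E]] := @MVT_dist f f1 x y; first by apply: df; exact: le_lt_trans yr.
rewrite E -mulrBl normrM expr2 mulrA ler_wpM2r//.
by apply: le_trans (H _ (le_lt_trans cx ye)) _; rewrite ler_pM2l.
Qed.

(** A one-sided Peano remainder: the second derivative is assumed at [x] alone, and the slope of
    [f1] from [x] stays below [d + e] near [x]. *)
Lemma taylor2_le f f1 x d (r e : R) : 0 < r -> (forall z, `|z - x| < r -> is_derive z 1 f (f1 z)) ->
  is_derive x 1 f1 d -> 0 < e -> exists2 s, 0 < s & forall y, `|y - x| < s ->
    f y <= f x + f1 x * (y - x) + (d + e) / 2 * (y - x) ^+ 2.
Proof.
move=> r0 df /is_derive1_caratheodory[g [fg cg gx]] e0.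
have /nbhs_dist[s s0 H] : \forall y \near x, g y < d + e.
  have /cvgrPdist_lt/(_ _ e0) := cg; apply: filterS => y; rewrite gx ltr_norml => /andP[]; lra.
exists (Num.min s r); first by rewrite lt_min s0.
move=> y; rewrite lt_min => /andP[ys yr].
(* The derivative of [D] is [(g z - (d + e)) * (z - x)], of sign opposite to [z - x], so [D] is
   largest at [x]. *)
pose D z := f z - f1 x * (z - x) - (d + e) / 2 * (z - x) ^+ 2.
have dD z : `|z - x| <= `|y - x| -> is_derive z 1 D (f1 z - f1 x - (d + e) * (z - x)).
  move=> zx; have Hz := df z (le_lt_trans zx yr).
  have S : is_derive z 1 (shift (- x)) 1 := is_derive_shift _ _ _.
  have L1 := is_deriveZ (f1 x) S.
  have L2 := is_deriveZ ((d + e) / 2) (is_deriveX 2 S).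
  apply: (is_derive_eq (is_deriveB (is_deriveB Hz L1) L2)).
  by rewrite /GRing.scale /= expr1; field.
have [c [cx c0]] := MVT_dist dD.
have Dx : D x = f x by rewrite /D !subrr expr2 !mulr0 !subr0.
rewrite Dx fg -mulrBl => E.
have G : (g c - (d + e)) * (c - x) * (y - x) <= 0.
  by rewrite -mulrA mulr_le0_ge0// subr_le0 ltW// H// (le_lt_trans cx).
have Dy : D y = f y - f1 x * (y - x) - (d + e) / 2 * (y - x) ^+ 2 by [].
rewrite -subr_ge0; move: G; rewrite -E Dy; lra.
Qed.

End real_calculus.

Lemma is_derive_sum_fun (R : numFieldType) (V : normedModType R) n (F : 'I_n -> V -> R) (dF : 'I_n -> R) (x v : V) :
  (forall i, is_derive x v (F i) (dF i)) ->
  is_derive x v (fun x => \sum_(i < n) F i x) (\sum_(i < n) dF i).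
Proof. by move=> /is_derive_sum; rewrite fct_sumE. Qed.

(** * Euclidean geometry of space-time *)

Section projections.
Context (R : realType) (V W : normedModType R).

Lemma is_derive_fst (f : V -> R) (z v : V * W) d :
  is_derive z.1 v.1 f d -> is_derive z v (fun z => f z.1) d.
Proof. by move=> [Df Ef]; exact: DeriveDef. Qed.

Lemma is_derive_snd (f : W -> R) (z v : V * W) d :
  is_derive z.2 v.2 f d -> is_derive z v (fun z => f z.2) d.
Proof. by move=> [Df Ef]; exact: DeriveDef. Qed.

Lemma Ck_on_fst k (f : V -> R) : Ck_on [set: V] k f -> Ck_on [set: V * W] k (fun z => f z.1).
Proof.
elim: k f => [|k IH] f [cf Df]; split => //.
- by move=> z _; apply: (@continuous_comp _ _ _ (@fst V W) f z); [exact: cvg_fst|exact: cf].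
- by move=> z _; apply: (@continuous_comp _ _ _ (@fst V W) f z); [exact: cvg_fst|exact: cf].
move=> v; have [d D] := Df v.1.
have H z : is_derive z v (fun z : V * W => f z.1) ('D_(v.1) f z.1).
  by apply: is_derive_fst; apply: derivableP; exact: d.
split; first by move=> z _; case: (H z).
rewrite (_ : 'D_v _ = fun z => 'D_(v.1) f z.1); first exact: (IH ('D_(v.1) f) D).
by apply/funext => z; case: (H z).
Qed.

Lemma Ck_on_snd k (f : W -> R) : Ck_on [set: W] k f -> Ck_on [set: V * W] k (fun z => f z.2).
Proof.
elim: k f => [|k IH] f [cf Df]; split => //.
- by move=> z _; apply: (@continuous_comp _ _ _ (@snd V W) f z); [exact: cvg_snd|exact: cf].
- by move=> z _; apply: (@continuous_comp _ _ _ (@snd V W) f z); [exact: cvg_snd|exact: cf].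
move=> v; have [d D] := Df v.2.
have H z : is_derive z v (fun z : V * W => f z.2) ('D_(v.2) f z.2).
  by apply: is_derive_snd; apply: derivableP; exact: d.
split; first by move=> z _; case: (H z).
rewrite (_ : 'D_v _ = fun z => 'D_(v.2) f z.2); first exact: (IH ('D_(v.2) f) D).
by apply/funext => z; case: (H z).
Qed.

End projections.

Section euclidean.
Context (R : realType) (N : nat).
Implicit Types (x y v e : 'rV[R]_N).

(** The squared distance is preferred to [enorm] because it is a polynomial, smooth also at [x0]. *)
Definition sqd x0 x : R := \sum_(i < N) (x ord0 i - x0 ord0 i) ^+ 2.
Definition dot e x0 x : R := \sum_(i < N) e ord0 i * (x ord0 i - x0 ord0 i).

Lemma sqd_ge0 x0 x : 0 <= sqd x0 x.
Proof. by apply: sumr_ge0 => i _; exact: sqr_ge0. Qed.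

Lemma sqdxx x : sqd x x = 0.
Proof. by rewrite /sqd big1// => i _; rewrite subrr expr0n. Qed.

Lemma dotxx e x : dot e x x = 0.
Proof. by rewrite /dot big1// => i _; rewrite subrr mulr0. Qed.

Lemma sqd_eq0 x0 x : sqd x0 x = 0 -> x = x0.
Proof.
move=> /eqP; rewrite psumr_eq0; last by move=> i _; exact: sqr_ge0.
move=> /allP H; apply/rowP => i; apply/eqP; rewrite -subr_eq0 -sqrf_eq0.
by apply: H; rewrite mem_index_enum.
Qed.

Lemma enorm_sub x0 x : enorm (x - x0) = Num.sqrt (sqd x0 x).
Proof. by congr Num.sqrt; apply: eq_bigr => i _; rewrite !mxE. Qed.

Lemma enorm_ge0 x : 0 <= enorm x.
Proof. exact: sqrtr_ge0. Qed.

Lemma enorm_sub_sqr x0 x : enorm (x - x0) ^+ 2 = sqd x0 x.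
Proof. by rewrite enorm_sub sqr_sqrtr// sqd_ge0. Qed.

Lemma coord_le_enorm x i : `|x ord0 i| <= enorm x.
Proof.
rewrite -sqrtr_sqr /enorm ler_wsqrtr// (bigD1 i)//= lerDl.
by apply: sumr_ge0 => j _; exact: sqr_ge0.
Qed.

(** Cauchy-Schwarz for a unit vector, from the squared length of [x - x0 - s e] being
    nonnegative. *)
Lemma dot_sqr_le e x0 x : \sum_(i < N) e ord0 i ^+ 2 = 1 -> dot e x0 x ^+ 2 <= sqd x0 x.
Proof.
move=> e1; set s := dot e x0 x.
have : 0 <= \sum_(i < N) (x ord0 i - x0 ord0 i - s * e ord0 i) ^+ 2.
  by apply: sumr_ge0 => i _; exact: sqr_ge0.
rewrite (eq_bigr (fun i => (x ord0 i - x0 ord0 i) ^+ 2 +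
  (- 2 * s) * (e ord0 i * (x ord0 i - x0 ord0 i)) + s ^+ 2 * e ord0 i ^+ 2)); last by move=> i _; ring.
rewrite !big_split -!mulr_sumr e1 /= -/(dot e x0 x) -/s -/(sqd x0 x); lra.
Qed.

Lemma coord_lin (i : 'I_N) : continuous (fun x : 'rV[R]_N => x ord0 i) /\
  forall (h : R) v x, (h *: v + x) ord0 i = h * v ord0 i + x ord0 i.
Proof. by split; [exact: coord_continuous|move=> h v x; rewrite !mxE]. Qed.

Lemma is_derive_coord i x v : is_derive x v (fun x : 'rV[R]_N => x ord0 i) (v ord0 i).
Proof. by have [cf lf] := coord_lin i; have [_] := Ck_on_lin 0 cf lf; exact. Qed.

Lemma Ck_on_coord k i : Ck_on [set: 'rV[R]_N] k (fun x => x ord0 i).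
Proof. by have [cf lf] := coord_lin i; have [] := Ck_on_lin k cf lf. Qed.

Lemma Ck_on_dot k e x0 : Ck_on [set: 'rV[R]_N] k (dot e x0).
Proof.
apply: Ck_on_sum => i; apply: Ck_onM; first exact: Ck_on_cst.
by apply: Ck_onD; [exact: Ck_on_coord|exact: Ck_on_cst].
Qed.

Lemma Ck_on_sqd k x0 : Ck_on [set: 'rV[R]_N] k (sqd x0).
Proof.
apply: Ck_on_sum => i; under eq_fun do rewrite expr2.
by apply: Ck_onM; (apply: Ck_onD; [exact: Ck_on_coord|exact: Ck_on_cst]).
Qed.

Lemma is_derive_coordB i x0 x v :
  is_derive x v (fun x : 'rV[R]_N => x ord0 i - x0 ord0 i) (v ord0 i).
Proof.
apply: (is_derive_eq (is_deriveB (is_derive_coord i x v) (is_derive_fun_cst (x0 ord0 i) x v))).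
by rewrite subr0.
Qed.

Lemma is_derive_dot e x0 x v : is_derive x v (dot e x0) (\sum_(i < N) e ord0 i * v ord0 i).
Proof.
apply: is_derive_sum_fun => i.
exact: (is_deriveZ (e ord0 i) (is_derive_coordB i x0 x v)).
Qed.

Lemma is_derive_sqd x0 x v :
  is_derive x v (sqd x0) (\sum_(i < N) 2 * (x ord0 i - x0 ord0 i) * v ord0 i).
Proof.
apply: is_derive_sum_fun => i.
apply: (is_derive_eq (is_derive_comp_real (is_derive_coordB i x0 x v)
  (is_derive_expr 2 (x ord0 i - x0 ord0 i)))).
by rewrite expr1.
Qed.

Lemma sum_delta (F : 'I_N -> R) i : \sum_(j < N) F j * (delta_mx ord0 i : 'rV[R]_N) ord0 j = F i.
Proof.
rewrite (bigD1 i)//= !mxE !eqxx mulr1 big1 ?addr0// => j ji.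
by rewrite mxE (negbTE ji) andbF mulr0.
Qed.

Lemma is_derive_dot_delta e x0 x i : is_derive x (delta_mx ord0 i) (dot e x0) (e ord0 i).
Proof. by apply: (is_derive_eq (is_derive_dot e x0 x _)); rewrite sum_delta. Qed.

Lemma is_derive_sqd_delta x0 x i :
  is_derive x (delta_mx ord0 i) (sqd x0) (2 * (x ord0 i - x0 ord0 i)).
Proof. by apply: (is_derive_eq (is_derive_sqd x0 x _)); rewrite sum_delta. Qed.

End euclidean.

Section lip_at.
Context (R : realType) (N : nat) (a : 'rV[R]_N).
Implicit Types (f g : 'rV[R]_N -> R).

(** Comparison with the value at the single point [a]. This is stable under arithmetic and
    composition, and suffices to turn an order of vanishing in a real argument into one in the
    distance to [a]. *)
Definition lip_at f := exists e L : R, [/\ 0 < e, 0 < L &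
  forall x, enorm (x - a) < e -> `|f x - f a| <= L * enorm (x - a)].

Lemma lip_at_cst (c : R) : lip_at (fun=> c).
Proof. by exists 1, 1; split => // x _; rewrite subrr normr0 mul1r enorm_ge0. Qed.

Lemma lip_at_coord i : lip_at (fun x => x ord0 i).
Proof.
exists 1, 1; split => // x _; rewrite mul1r.
by apply: le_trans (coord_le_enorm _ i); rewrite !mxE.
Qed.

Lemma lip_atD f g : lip_at f -> lip_at g -> lip_at (fun x => f x + g x).
Proof.
move=> [e [L [e0 L0 Hf]]] [e' [L' [e'0 L'0 Hg]]].
exists (Num.min e e'), (L + L'); split; rewrite ?lt_min ?e0 ?addr_gt0//.
move=> x; rewrite lt_min => /andP[/Hf Hfx /Hg Hgx].
rewrite opprD addrACA mulrDl; apply: le_trans (ler_normD _ _) _.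
exact: lerD.
Qed.

Lemma lip_atM f g : lip_at f -> lip_at g -> lip_at (fun x => f x * g x).
Proof.
move=> [e [L [e0 L0 Hf]]] [e' [L' [e'0 L'0 Hg]]].
exists (Num.min 1 (Num.min e e')), (L * (`|g a| + L') + `|f a| * L').
have K0 : 0 < L * (`|g a| + L') + `|f a| * L'.
  by rewrite ltr_pwDl// ?mulr_gt0// ?ltr_wpDl// mulr_ge0// ltW.
split; rewrite ?lt_min ?ltr01 ?e0//.
move=> x; rewrite !lt_min => /and3P[x1 /Hf Hfx /Hg Hgx].
have -> : f x * g x - f a * g a = (f x - f a) * g x + f a * (g x - g a) by ring.
have Gx : `|g x| <= `|g a| + L'.
  have -> : g x = g a + (g x - g a) by ring.
  apply: le_trans (ler_normD _ _) _; rewrite lerD2l (le_trans Hgx)//.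
  by rewrite ler_piMr ?ltW.
apply: le_trans (ler_normD _ _) _; rewrite !normrM mulrDl; apply: lerD.
  by rewrite mulrAC; apply: ler_pM.
by rewrite -mulrA ler_wpM2l.
Qed.

Lemma lip_at_sum n (F : 'I_n -> 'rV[R]_N -> R) : (forall i, lip_at (F i)) ->
  lip_at (fun x => \sum_(i < n) F i x).
Proof.
elim: n F => [|n IH] F HF.
  by under eq_fun do rewrite big_ord0; exact: lip_at_cst.
by under eq_fun do rewrite big_ord_recr; apply: lip_atD => //; exact: IH.
Qed.

Lemma lip_at_comp (phi : R -> R) f d : is_derive (f a) 1 phi d -> lip_at f -> lip_at (phi \o f).
Proof.
move=> /is_derive_lipschitz[e [L [e0 L0 H]]] [e' [L' [e'0 L'0 Hf]]].
exists (Num.min e' (e / L')), (L * L'); split; rewrite ?lt_min ?e'0 ?divr_gt0 ?mulr_gt0//.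
move=> x; rewrite lt_min => /andP[/Hf Hfx]; rewrite ltr_pdivlMr// mulrC => xe.
rewrite -mulrA; apply: le_trans (H _ (le_lt_trans Hfx xe)) _.
by rewrite ler_pM2l.
Qed.

Lemma lip_at_coordB i (c : R) : lip_at (fun x => x ord0 i - c).
Proof. by apply: lip_atD; [exact: lip_at_coord|exact: lip_at_cst]. Qed.

Lemma lip_at_dot e x0 : lip_at (dot e x0).
Proof.
by apply: lip_at_sum => i; apply: lip_atM; [exact: lip_at_cst|exact: lip_at_coordB].
Qed.

Lemma lip_at_sqd x0 : lip_at (sqd x0).
Proof.
apply: lip_at_sum => i; under eq_fun do rewrite expr2.
by apply: lip_atM; exact: lip_at_coordB.
Qed.

End lip_at.

(** * Test functions with separated variables *)

Section separated.
Context (R : realType) (N : nat) (p : R) (B B1 B2 : R -> R) (H : 'rV[R]_N -> R).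
Hypothesis dB : forall t : R, is_derive t 1 B (B1 t).
Hypothesis dB1 : forall t : R, is_derive t 1 B1 (B2 t).
Hypothesis cB2 : continuous B2.
Hypothesis cH : Ck_on [set: 'rV[R]_N] 2 H.

Let psi (z : R * 'rV[R]_N) : R := B z.1 + H z.2.

Lemma dt_separated z : dt psi z = B1 z.1.
Proof.
rewrite /dt derive1E.
have [_ ->] := is_deriveD (dB z.1) (is_derive_fun_cst (H z.2) z.1 1).
by rewrite addr0.
Qed.

Let partialE t i : partial i (fun y => B t + H y) = partial i H.
Proof.
apply/funext => x; rewrite /partial.
have [_ DH] := cH; have [d _] := DH (delta_mx ord0 i).
have Hx : is_derive x (delta_mx ord0 i) H ('D_(delta_mx ord0 i) H x).
  by apply: derivableP; exact: d.
have [_] := is_deriveD (is_derive_fun_cst (B t) x (delta_mx ord0 i)) Hx.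
by rewrite add0r.
Qed.

Lemma grad_separated t : grad (fun y => B t + H y) = grad H.
Proof. by apply/funext => x; apply/rowP => i; rewrite !mxE partialE. Qed.

Lemma sgrad_separated z : sgrad psi z = grad H z.2.
Proof. by rewrite /sgrad /psi /= grad_separated. Qed.

Lemma splaplacian_separated z : splaplacian p psi z = plaplacian p H z.2.
Proof. by rewrite /splaplacian /plaplacian /psi /= grad_separated. Qed.

(** The expansion required at a critical point splits: the Taylor remainder in time is quadratic,
    hence a [time_modulus], and the increment of [H] is bounded by a monomial in [class_F]. The
    flatness of [H] is needed at all its critical points, not only at the contact point. *)
Lemma class_A_separated n : (3 <= n)%N -> 1 < n.-1%:R * (p - 1) ->
  (forall x, grad H x = 0 -> exists e L : R, [/\ 0 < e, 0 < L &
     forall y, enorm (y - x) < e -> `|H y - H x| <= L * enorm (y - x) ^+ n]) ->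
  class_A p psi.
Proof.
move=> n3 np crit; split.
  apply: (@Ck_on_sub _ _ setT) => //; apply: Ck_onD; last exact: Ck_on_snd.
  apply: Ck_on_fst.
  apply: (@Ck_on_comp _ _ 2 (fun i => if i is 0%N then B else if i is 1%N then B1 else B2) id).
  - by move=> [|[|//]] _ x.
  - exact: cB2.
  - by have [] := @Ck_on_lin R R 2 id (fun x => cvg_id) (fun _ _ _ => erefl _).
move=> z z0; rewrite sgrad_separated => /crit[e [L [e0 L0 HL]]].
have [e' [L' [e'0 L'0 HL']]] := @taylor1_bound R B B1 z.1 (B2 z.1) 1 ltr01 (fun t _ => dB t) (dB1 z.1).
exists (Num.min e e'), (fun r => L * r ^+ n), (fun r => L' * r ^+ 2); split.
- by rewrite lt_min e0.
- exact: class_F_monomial.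
- by apply: time_modulus_sqr; exact: ltW.
move=> y y0; rewrite lt_min => /andP[ye ye']; rewrite dt_separated.
have -> : psi y - psi z - B1 z.1 * (y.1 - z.1) =
  (H y.2 - H z.2) + (B y.1 - B z.1 - B1 z.1 * (y.1 - z.1)) by rewrite /psi; ring.
apply: le_trans (ler_normD _ _) _; apply: lerD.
  by apply: HL; apply: le_lt_trans ye; rewrite lerDl.
by apply: HL'; apply: le_lt_trans ye'; rewrite lerDr enorm_ge0.
Qed.

End separated.

(** * Test functions *)

Section cylinder.
Context (R : realType) (N : nat).

Definition cylinder (s t : R) (x0 : 'rV[R]_N) (D : R) : set (R * 'rV[R]_N) :=
  [set z | s <= z.1 <= t /\ sqd x0 z.2 <= D].

Lemma continuous_sqd (x0 : 'rV[R]_N) : continuous (sqd x0).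
Proof. by move=> x; exact: (Ck_on_continuous (Ck_on_sqd 0 x0)). Qed.

Lemma compact_cylinder s t x0 D : compact (cylinder s t x0 D).
Proof.
(* The half-width [D + 1] works because [r ^+ 2 <= D] implies [|r| <= D + 1], without a square
   root. *)
pose box := `[s, t]%classic `*`
  [set x : 'rV[R]_N | forall i, [set r | x0 ord0 i - (D + 1) <= r <= x0 ord0 i + (D + 1)] (x ord0 i)].
have cbox : compact box.
  apply: compact_setX; first exact: segment_compact.
  apply: (@rV_compact R N (fun i => [set r | x0 ord0 i - (D + 1) <= r <= x0 ord0 i + (D + 1)])) => i.
  rewrite (_ : [set r | _] = `[x0 ord0 i - (D + 1), x0 ord0 i + (D + 1)]%classic).
    exact: segment_compact.
  by apply/seteqP; split => r /=; rewrite in_itv.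
have cl : closed [set z : R * 'rV[R]_N | sqd x0 z.2 <= D].
  apply: (@closed_comp _ _ (fun z : R * 'rV[R]_N => sqd x0 z.2) [set r | r <= D]).
    move=> z _; apply: (@continuous_comp _ _ _ (@snd R 'rV[R]_N) (sqd x0)); first exact: cvg_snd.
    exact: continuous_sqd.
  exact: closed_le.
rewrite (_ : cylinder s t x0 D = box `&` [set z | sqd x0 z.2 <= D]).
  exact: compact_closedI.
apply/seteqP; split => -[r x] /=; last by move=> [[rst _] xD]; split => //; move: rst; rewrite in_itv.
move=> [rst xD]; split => //; split; first by rewrite /= in_itv.
move=> i /=.
have : (x ord0 i - x0 ord0 i) ^+ 2 <= D.
  apply: le_trans xD; rewrite /sqd (bigD1 i)//= lerDl.
  by apply: sumr_ge0 => j _; exact: sqr_ge0.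
have := sqr_ge0 (x ord0 i - x0 ord0 i); nra.
Qed.

Lemma cylinder_max (u : R * 'rV[R]_N -> R) s t x0 D : cylinder s t x0 D !=set0 ->
  {within cylinder s t x0 D, continuous u} ->
  exists2 z, cylinder s t x0 D z & forall y, cylinder s t x0 D y -> u y <= u z.
Proof.
move=> ne cu; have [z] := compact_EVT_max ne (@compact_cylinder s t x0 D) cu.
rewrite inE => zC H; exists z => // y yC; apply: H; by rewrite inE.
Qed.

Lemma cylinder_bounded (u : R * 'rV[R]_N -> R) t x0 D :
  {within [set z : R * 'rV[R]_N | 0 <= z.1], continuous u} ->
  exists K, forall z, cylinder 0 t x0 D z -> u z <= K.
Proof.
move=> cu; have [ne|e] := pselect (cylinder 0 t x0 D !=set0); last first.
  by exists 0 => z zC; exfalso; apply: e; exists z.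
have [|z _ H] := @cylinder_max u 0 t x0 D ne; last by exists (u z).
by apply: continuous_subspaceW cu => z [/andP[z0 _] _].
Qed.

End cylinder.

Section profile.
Context (R : realType) (Y M : R) (d : nat) (a : nat -> R).
Hypotheses (Y0 : 0 <= Y) (M0 : 0 < M) (d2 : (2 <= d)%N) (a0 : forall n, 0 <= a n).

(** Meant for [r] a squared distance: the first term is the second-order part, [M * r ^+ d] with
    [d >= 2] makes the contact strict without altering the second-order jet, and [growth] dominates
    far away. *)
Definition profile (r : R) : R := Y / 2 * r + M * r ^+ d + growth a 3 r.
Definition profile1 (r : R) : R := Y / 2 + M * d%:R * r ^+ d.-1 + 3 * growth a 2 r.
Definition profile2 (r : R) : R := M * d%:R * d.-1%:R * r ^+ d.-2 + 3 * (2 * growth a 1 r).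

Lemma is_derive_profile (r : R) : is_derive r 1 profile (profile1 r).
Proof.
have L := @is_deriveZ _ _ _ _ (Y / 2) r 1 _ (is_derive_id r 1).
apply: (is_derive_eq (is_deriveD (is_deriveD L (is_derive_monomial M d r)) (@is_derive_growth _ a 3 r isT))).
by rewrite /GRing.scale/= mulr1.
Qed.

Lemma is_derive_profile1 (r : R) : is_derive r 1 profile1 (profile2 r).
Proof.
have L := @is_deriveZ _ _ _ _ (3 : R) r 1 _ (@is_derive_growth _ a 2 r isT).
apply: (is_derive_eq (is_deriveD (is_deriveD (is_derive_fun_cst (Y / 2) r 1)
  (is_derive_monomial (M * d%:R) d.-1 r)) L)).
by rewrite add0r.
Qed.

Lemma continuous_profile2 : continuous profile2.
Proof.
move=> r; apply: cvgD; apply: cvgM; try exact: cvg_cst; first exact: exprn_continuous.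
by apply: cvgM; [exact: cvg_cst|exact: continuous_growth].
Qed.

Lemma Ck_on_profile (V : normedModType R) (f : V -> R) :
  Ck_on [set: V] 2 f -> Ck_on [set: V] 2 (fun x => profile (f x)).
Proof.
apply: (@Ck_on_comp _ _ 2 (fun i => if i is 0%N then profile else if i is 1%N then profile1 else profile2)).
  by move=> [|[|//]] _ x; [exact: is_derive_profile|exact: is_derive_profile1].
exact: continuous_profile2.
Qed.

Lemma profile0 : profile 0 = 0.
Proof. by rewrite /profile mulr0 expr0n gtn_eqF 1?ltnW// mulr0 growth_eq0// !addr0. Qed.

Lemma profile10 : profile1 0 = Y / 2.
Proof.
rewrite /profile1 expr0n growth_eq0// mulr0 addr0 (_ : (d.-1 == 0%N) = false) ?mulr0 ?addr0//.
by case: d d2 => [|[]].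
Qed.

Lemma profile1_le r : 0 <= r <= 1 -> profile1 r <= Y / 2 + M * d%:R.
Proof.
move=> /andP[r0 r1]; rewrite /profile1 growth_eq0// mulr0 addr0 lerD2l.
by rewrite ler_piMr ?exprn_ile1// mulr_ge0// (ltW M0).
Qed.

Lemma profile1_ge0 r : 0 <= r -> 0 <= profile1 r.
Proof.
move=> r0; rewrite /profile1 addr_ge0// ?mulr_ge0 ?growth_ge0// addr_ge0//.
  by rewrite divr_ge0.
  by apply: mulr_ge0; [apply: mulr_ge0 => //; exact: ltW|exact: exprn_ge0].
Qed.

Lemma profile1_gt0 r : 0 < r -> 0 < profile1 r.
Proof.
move=> r0; rewrite /profile1 ltr_pwDl// ?mulr_ge0 ?growth_ge0// ltr_wpDl//.
  by rewrite divr_ge0.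
by apply: mulr_gt0; [apply: mulr_gt0 => //; rewrite ltr0n ltnW|exact: exprn_gt0].
Qed.

(** Each summand is convex and vanishes at 0. The inequality serves to bound [slant] from above at
    its critical points. *)
Lemma profile_convex r : 0 <= r -> profile r <= r * profile1 r.
Proof.
move=> r0; rewrite /profile /profile1 !mulrDr; apply: lerD; last exact: growth_convex.
apply: lerD; first by rewrite mulrC.
have -> : r * (M * d%:R * r ^+ d.-1) = d%:R * (M * r ^+ d).
  have -> : r ^+ d = r * r ^+ d.-1 by rewrite -exprS (prednK (ltnW d2)).
  by ring.
by rewrite ler_peMl ?ler1n ?(ltnW d2)// mulr_ge0 ?exprn_ge0 ?(ltW M0)//.
Qed.

End profile.

Section majorant.
Context (R : realType) (N : nat) (t0 : R) (x0 : 'rV[R]_N).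

(** A locally bounded [w] is dominated in terms of the larger of the two squared distances, and a
    nonnegative function of the maximum is at most the sum of its two values; hence a majorant with
    separated variables. *)
Lemma majorant (w : R -> 'rV[R]_N -> R) (delta : R) (d : nat) : 0 < delta ->
  (forall n : nat, exists K, forall t x, 0 <= t -> (t - t0) ^+ 2 <= n%:R -> sqd x0 x <= n%:R -> w t x <= K) ->
  exists a M, [/\ forall n, 0 <= a n, 0 < M &
    forall t x, 0 <= t -> delta <= Num.max ((t - t0) ^+ 2) (sqd x0 x) ->
      w t x < M * ((t - t0) ^+ 2) ^+ d + growth a 3 ((t - t0) ^+ 2) +
              (M * sqd x0 x ^+ d + growth a 3 (sqd x0 x))].
Proof.
move=> delta0 /choice[K HK].
(* When the maximum [m] lies in [[n + 2, n + 3[], the bound [K n.+3] applies and [growth_ge] gives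
   [a n]; the remaining range [delta <= m <= 2] is left to the term [M * m ^+ d]. *)
pose a n := `|K n.+3| + 1; exists a, ((`|K 2%N| + 1) / delta ^+ d).
have a0 n : 0 <= a n by rewrite /a addr_ge0.
have M0 : 0 < (`|K 2%N| + 1) / delta ^+ d by rewrite divr_gt0 ?exprn_gt0// ltr_wpDl.
split => // t x tge0; set th := (t - t0) ^+ 2; set rho := sqd x0 x; set M := _ / _ in M0 *.
have th0 : 0 <= th by exact: sqr_ge0.
have rho0 : 0 <= rho by exact: sqd_ge0.
set m := Num.max th rho => dm.
have thm : th <= m by rewrite le_max lexx.
have rhom : rho <= m by rewrite le_max lexx orbT.
have gm : growth a 3 m <= growth a 3 th + growth a 3 rho.
  rewrite /m; case: (leP th rho) => _; first by rewrite lerDr growth_ge0.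
  by rewrite lerDl growth_ge0.
have Mm : M * m ^+ d <= M * th ^+ d + M * rho ^+ d.
  have Pth : 0 <= M * th ^+ d by apply: mulr_ge0; [exact: ltW|exact: exprn_ge0].
  have Prho : 0 <= M * rho ^+ d by apply: mulr_ge0; [exact: ltW|exact: exprn_ge0].
  by rewrite /m; case: (leP th rho) => _; [rewrite lerDr|rewrite lerDl].
suff : w t x < M * m ^+ d + growth a 3 m by move: gm Mm; lra.
have m0 : 0 <= m := le_trans th0 thm.
have Mm0 : 0 <= M * m ^+ d by apply: mulr_ge0; [exact: ltW|exact: exprn_ge0].
have [m2|m2] := leP m 2.
  have w2 : w t x <= K 2%N by apply: HK => //; [exact: le_trans thm m2|exact: le_trans rhom m2].
  have : `|K 2%N| + 1 <= M * m ^+ d.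
    rewrite /M mulrAC ler_pdivlMr ?exprn_gt0// ler_pM2l ?ltr_wpDl//.
    by rewrite lerXn2r ?nnegrE// ltW.
  have := ler_norm (K 2%N); have := growth_ge0 a0 3 m; move: w2; lra.
have [n nm] : exists n, n.+2%:R <= m < n.+3%:R.
  have := truncn_itv m0; have : (2 <= Num.truncn m)%N by rewrite truncn_ge_nat// ltW.
  by case: (Num.truncn m) => [|[|n]]// _ H; exists n.
case/andP: nm => nm mn.
have wn : w t x <= K n.+3.
  by apply: HK => //; [exact: le_trans thm (ltW mn)|exact: le_trans rhom (ltW mn)].
have := growth_ge a0 nm; rewrite /a; have := ler_norm (K n.+3); move: wn Mm0; lra.
Qed.

End majorant.

Section is_derive_fun.
Context (R : realType) (V : normedModType R).
Implicit Types (f g : V -> R) (x v : V).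

Lemma is_derive_addf f g x v df dg : is_derive x v f df -> is_derive x v g dg ->
  is_derive x v (fun y => f y + g y) (df + dg).
Proof. by move=> Hf Hg; exact: is_deriveD. Qed.

Lemma is_derive_mulf f g x v df dg : is_derive x v f df -> is_derive x v g dg ->
  is_derive x v (fun y => f y * g y) (f x * dg + g x * df).
Proof. by move=> Hf Hg; exact: (is_deriveM Hf Hg). Qed.

Lemma is_derive_cmulf (k : R) f x v df : is_derive x v f df ->
  is_derive x v (fun y => k * f y) (k * df).
Proof. by move=> Hf; exact: (is_deriveZ k Hf). Qed.

End is_derive_fun.

Lemma exists_order (R : realType) (p : R) : 1 < p -> exists2 n, (3 <= n)%N & 1 < n.-1%:R * (p - 1).
Proof.
move=> p1; exists (Num.truncn (p - 1)^-1).+4 => //=.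
have p10 : 0 < p - 1 by rewrite subr_gt0.
rewrite -ltr_pdivrMr// div1r; apply: lt_le_trans (truncnS_gt _) _.
by rewrite ler_nat; exact: (leq_trans (leqnSn _) (leqnSn _)).
Qed.

Section test_functions.
Context (R : realType) (N : nat) (p q : R) (u : R * 'rV[R]_N -> R).
Hypotheses (usub : viscosity_subsolution p q u)
  (cu : {within [set z : R * 'rV[R]_N | 0 <= z.1], continuous u}).
Variables (t0 : R) (x0 : 'rV[R]_N).
Hypothesis t0_gt0 : 0 < t0.

Section touching.
Variables (d : nat) (A C delta : R) (h : 'rV[R]_N -> R).
Hypotheses (d2 : (2 <= d)%N) (delta0 : 0 < delta) (C0 : 0 <= C).

(** The part of the test function depending on time; since [profile] halves its first parameter,
    [2 * C] yields [C * (t - t0) ^+ 2]. *)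
Let B M a t := u (t0, x0) + A * (t - t0) + profile (2 * C) M d a ((t - t0) ^+ 2).
Let B1 M a t := A + profile1 (2 * C) M d a ((t - t0) ^+ 2) * (2 * (t - t0)).
Let B2 M a t := 2 * profile1 (2 * C) M d a ((t - t0) ^+ 2)
  + 2 * (t - t0) * (profile2 M d a ((t - t0) ^+ 2) * (2 * (t - t0))).

Let is_derive_shiftr (t : R) : is_derive t 1 (fun t => t - t0) 1.
Proof. exact: (is_derive_shift t 1 (- t0)). Qed.

Let is_derive_sqr (t : R) : is_derive t 1 (fun t => (t - t0) ^+ 2) (2 * (t - t0)).
Proof.
have := is_derive1_comp (f := fun y : R => y ^+ 2) (g := fun t => t - t0)
  (is_derive_expr 2 (t - t0)) (is_derive_shiftr t).
by rewrite mulr1 expr1.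
Qed.

Let dB M a (t : R) : is_derive t 1 (B M a) (B1 M a t).
Proof.
have L := is_derive_addf (is_derive_fun_cst (u (t0, x0)) t 1) (is_derive_cmulf A (is_derive_shiftr t)).
have K : is_derive t 1 (B M a) _ := is_derive_addf L (is_derive_comp_real (is_derive_sqr t)
  (is_derive_profile (2 * C) M d a ((t - t0) ^+ 2))).
apply: (is_derive_eq K).
by rewrite /B1 mulr1 add0r.
Qed.

Let dB1 M a (t : R) : is_derive t 1 (B1 M a) (B2 M a t).
Proof.
have L := is_derive_comp_real (is_derive_sqr t) (is_derive_profile1 (2 * C) M d a ((t - t0) ^+ 2)).
have K : is_derive t 1 (B1 M a) _ := is_derive_addf (is_derive_fun_cst A t 1)
  (is_derive_mulf L (is_derive_cmulf 2 (is_derive_shiftr t))).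
apply: (is_derive_eq K).
by rewrite /B2 add0r mulr1 /= [X in X + _]mulrC.
Qed.

Let cB2 M a : continuous (B2 M a).
Proof.
move=> t.
have cf (f : R -> R) (f' : R) (g g' : R -> R) (y : R) : (is_derive (g y) 1 f f') -> is_derive y 1 g (g' y) ->
    {for y, continuous (fun t => f (g t))}.
  move=> H1 H2; have [D _] := is_derive1_comp H1 H2.
  exact/differentiable_continuous/derivable1_diffP.
have c1 := cf _ _ _ (fun t => 2 * (t - t0)) t (is_derive_profile1 (2 * C) M d a ((t - t0) ^+ 2)) (is_derive_sqr t).
have cl : {for t, continuous (fun t => 2 * (t - t0))}.
  by apply: cvgM; [exact: cvg_cst|apply: cvgB; [exact: cvg_id|exact: cvg_cst]].
have c2 : {for t, continuous (fun t => profile2 M d a ((t - t0) ^+ 2))}.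
  have := @continuous_comp R R R (fun t => (t - t0) ^+ 2) (profile2 M d a) t; apply.
    have [D _] := is_derive_sqr t.
    exact/differentiable_continuous/derivable1_diffP.
  exact: continuous_profile2.
by apply: cvgD; [apply: cvgM; [exact: cvg_cst|exact: c1]|apply: cvgM => //; exact: cvgM].
Qed.

(* The growth of [a] and [M] is dictated by [u], which is not known to be bounded. *)
Lemma touching (beta : R) : 0 <= beta ->
  (forall x, - (beta * (1 + sqd x0 x)) <= h x) ->
  (forall t x, 0 < t -> (t - t0) ^+ 2 < delta -> sqd x0 x < delta ->
    u (t, x) <= u (t0, x0) + A * (t - t0) + C * (t - t0) ^+ 2 + h x) ->
  exists a M, [/\ forall n, 0 <= a n, 0 < M &
    forall H : 'rV[R]_N -> R, Ck_on [set: 'rV[R]_N] 2 H -> H x0 = 0 ->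
     (forall x, h x + (M * sqd x0 x ^+ d + growth a 3 (sqd x0 x)) <= H x) ->
     (exists n, [/\ (3 <= n)%N, 1 < n.-1%:R * (p - 1) & forall x, grad H x = 0 ->
       exists e L : R, [/\ 0 < e, 0 < L &
       forall y, enorm (y - x) < e -> `|H y - H x| <= L * enorm (y - x) ^+ n]]) ->
     (grad H x0 != 0 -> A <= plaplacian p H x0 - enorm (grad H x0) `^ q) /\
     (grad H x0 = 0 -> A <= 0)].
Proof.
move=> beta0 hbeta loc.
(* The last two terms compensate the possibly negative [A * (t - t0)] and [h x], so that dominating
   [w] is enough far from the contact point. *)
pose w t x := u (t, x) - u (t0, x0) + `|A| * (1 + (t - t0) ^+ 2) + beta * (1 + sqd x0 x).
have wK n : exists K, forall t x, 0 <= t -> (t - t0) ^+ 2 <= n%:R -> sqd x0 x <= n%:R -> w t x <= K.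
  have [K HK] := cylinder_bounded (t0 + n%:R + 1) x0 n%:R cu.
  exists (K - u (t0, x0) + `|A| * (1 + n%:R) + beta * (1 + n%:R)) => t x t0' tn xn.
  have ut : u (t, x) <= K.
    apply: HK; split => //=; rewrite t0' /=.
    have : 0 <= n%:R :> R by []. nra.
  have A1 : `|A| * (1 + (t - t0) ^+ 2) <= `|A| * (1 + n%:R) by rewrite ler_wpM2l// lerD2l.
  have A2 : beta * (1 + sqd x0 x) <= beta * (1 + n%:R) by rewrite ler_wpM2l// lerD2l.
  by rewrite /w; lra.
have [a [M [a0 M0 maj]]] := majorant d delta0 wK.
exists a, M; split => // H cH H0 Hh crit.
pose psi (z : R * 'rV[R]_N) := B M a z.1 + H z.2.
have psi0 : u (t0, x0) = psi (t0, x0).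
  by rewrite /psi /B /= subrr expr0n profile0// H0 mulr0 !addr0.
have B10 : B1 M a t0 = A by rewrite /B1 subrr !mulr0 addr0.
have lt_psi z : Qoo z -> z != (t0, x0) -> u z < psi z.
  case: z => t x; rewrite /Qoo /= => tgt zn; rewrite /psi /B /=.
  set th := (t - t0) ^+ 2; set rho := sqd x0 x.
  have th0 : 0 <= th by exact: sqr_ge0.
  have rho0 : 0 <= rho by exact: sqd_ge0.
  have g1 : 0 <= growth a 3 th by exact: growth_ge0.
  have g2 : 0 <= growth a 3 rho by exact: growth_ge0.
  have := Hh x; rewrite -/rho => Hx; rewrite /profile.
  have m1 : 0 <= M * th ^+ d by apply: mulr_ge0; [exact: ltW|exact: exprn_ge0].
  have m2 : 0 <= M * rho ^+ d by apply: mulr_ge0; [exact: ltW|exact: exprn_ge0].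
  (* Away from the contact point the majorant of [w] decides; near it [loc] holds, and the terms in
     [M] supply strictness. *)
  have [dm|] := leP delta (Num.max th rho).
    have := maj t x (ltW tgt) dm; rewrite /w -/th -/rho.
    have := hbeta x; rewrite -/rho.
    have : - (`|A| * (1 + th)) <= A * (t - t0).
      have : `|A * (t - t0)| <= `|A| * (1 + th).
        by rewrite normrM ler_wpM2l// /th; have := normr_ge0 (t - t0); rewrite -[X in _ -> _ <= 1 + X]real_normK ?num_real//; nra.
      by rewrite ler_norml => /andP[].
    have : 0 <= C * th by rewrite mulr_ge0.
    by move: Hx; lra.
  rewrite gt_max => /andP[thd rhod].
  have := loc t x tgt thd rhod; rewrite -/th.
  have : 0 < M * th ^+ d + M * rho ^+ d.
    have [th00|th00] := eqVneq th 0; last first.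
      by rewrite ltr_pwDl// mulr_gt0// exprn_gt0// lt0r th00.
    have [rho00|rho00] := eqVneq rho 0; last first.
      by rewrite ltr_wpDl// mulr_gt0// exprn_gt0// lt0r rho00.
    exfalso; move: zn; rewrite (sqd_eq0 rho00).
    by move/eqP: th00; rewrite sqrf_eq0 subr_eq0 => /eqP ->; rewrite eqxx.
  by move: Hx; lra.
have Apsi : class_A p psi.
  have [n [n3 np Hn]] := crit.
  exact: (@class_A_separated R N p _ _ _ H (dB M a) (dB1 M a) (@cB2 M a) cH n n3 np Hn).
have [Hnz Hz] := usub.2 psi (t0, x0) Apsi t0_gt0 psi0 lt_psi.
move: Hnz Hz; rewrite (dt_separated _ (dB M a)) /= B10.
by rewrite (sgrad_separated (B M a) cH) (splaplacian_separated p (B M a) cH).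
Qed.

End touching.

End test_functions.

Section noncritical_function.
Context (R : realType) (N : nat) (x0 e : 'rV[R]_N).
Variables (b X Y M c : R) (n d : nat) (a : nat -> R).
Hypotheses (e1 : \sum_(i < N) e ord0 i ^+ 2 = 1) (b0 : 0 < b) (X0 : 0 <= X) (Y0 : 0 <= Y)
  (M0 : 0 < M) (d2 : (2 <= d)%N) (a0 : forall n, 0 <= a n) (c0 : 0 < c) (n3 : (3 <= n)%N).

(** The model with gradient [b e] and Hessian [X e e^T + Y I] at [x0]; the other terms of [profile]
    have order at least 4 in the distance. *)
Definition slant (x : 'rV[R]_N) : R :=
  b * dot e x0 x + X / 2 * dot e x0 x ^+ 2 + profile Y M d a (sqd x0 x).

(** The coefficients of the gradient of [slant], which is [slope x] times [e] plus [radial x] times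
    [x - x0]. *)
Definition slope (x : 'rV[R]_N) : R := b + X * dot e x0 x.
Definition radial (x : 'rV[R]_N) : R := 2 * profile1 Y M d a (sqd x0 x).

(* Equal to [slant] where [slant >= - c], constant where [slant <= - 2 c]. *)
Definition flat_slant (x : 'rV[R]_N) : R := c * (flatten n (2 + c^-1 * slant x) - 2).

Lemma Ck_on_slant : Ck_on [set: 'rV[R]_N] 2 slant.
Proof.
apply: Ck_onD; last by apply: Ck_on_profile => //; exact: Ck_on_sqd.
apply: Ck_onD; first by apply: Ck_onM; [exact: Ck_on_cst|exact: Ck_on_dot].
apply: Ck_onM; first exact: Ck_on_cst.
under eq_fun do rewrite expr2.
by apply: Ck_onM; exact: Ck_on_dot.
Qed.

Lemma Ck_on_flat_slant : Ck_on [set: 'rV[R]_N] 2 flat_slant.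
Proof.
apply: Ck_onM; first exact: Ck_on_cst.
apply: Ck_onD; last exact: Ck_on_cst.
have K : Ck_on [set: 'rV[R]_N] 2 (fun x => 2 + c^-1 * slant x).
  apply: Ck_onD; first exact: Ck_on_cst.
  by apply: Ck_onM; [exact: Ck_on_cst|exact: Ck_on_slant].
apply: (@Ck_on_comp _ _ 2 (fun i => if i is 0%N then flatten n else
  if i is 1%N then flatten1 n else flatten2 n)) K.
  by move=> [|[|//]] _ x; [exact: is_derive_flatten|exact: is_derive_flatten1].
exact: continuous_flatten2.
Qed.

Let is_derive_slant x i : is_derive x (delta_mx ord0 i) slant
  (slope x * e ord0 i + radial x * (x ord0 i - x0 ord0 i)).
Proof.
have Ds := is_derive_dot_delta e x0 x i.
have D2 := is_derive_comp_real Ds (is_derive_expr 2 (dot e x0 x)).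
have Dr := is_derive_comp_real (is_derive_sqd_delta x0 x i) (is_derive_profile Y M d a (sqd x0 x)).
have K : is_derive x (delta_mx ord0 i) slant _ :=
  is_derive_addf (is_derive_addf (is_derive_cmulf b Ds) (is_derive_cmulf (X / 2) D2)) Dr.
by apply: (is_derive_eq K); rewrite /slope /radial expr1; field.
Qed.

Lemma grad_flat_slant x i : grad flat_slant x ord0 i =
  flatten1 n (2 + c^-1 * slant x) * (slope x * e ord0 i + radial x * (x ord0 i - x0 ord0 i)).
Proof.
have D1 := is_derive_addf (is_derive_fun_cst (2 : R) x (delta_mx ord0 i))
  (is_derive_cmulf c^-1 (is_derive_slant x i)).
have D2 := is_derive_comp_real D1 (is_derive_flatten n3 (2 + c^-1 * slant x)).
have K : is_derive x (delta_mx ord0 i) flat_slant _ :=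
  is_derive_cmulf c (is_derive_addf D2 (is_derive_fun_cst (- 2 : R) x (delta_mx ord0 i))).
rewrite mxE /partial; have [_ ->] := K.
rewrite addr0 add0r mulrCA; congr (_ * _).
by rewrite mulrA mulfV ?gt_eqF// mul1r.
Qed.

Lemma slantx0 : slant x0 = 0.
Proof. by rewrite /slant dotxx sqdxx profile0// expr0n !mulr0 !addr0. Qed.

Lemma flat_slantx0 : flat_slant x0 = 0.
Proof. by rewrite /flat_slant slantx0 mulr0 addr0 flatten_id ?subrr ?mulr0// ler1n. Qed.

Lemma flat_slant_ge x : slant x <= flat_slant x.
Proof.
rewrite /flat_slant; have := flatten_ge n3 (2 + c^-1 * slant x) => H.
rewrite [leLHS](_ : _ = c * (2 + c^-1 * slant x - 2)); last first.
  by rewrite addrAC subrr add0r mulrA mulfV ?gt_eqF// mul1r.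
by rewrite ler_pM2l// lerD2r.
Qed.

Let slope0 : slope x0 = b. Proof. by rewrite /slope dotxx mulr0 addr0. Qed.
Let radial0 : radial x0 = Y. Proof. by rewrite /radial sqdxx profile10//; field. Qed.

Lemma grad_flat_slantx0 : grad flat_slant x0 = b *: e.
Proof.
apply/rowP => i; rewrite grad_flat_slant slantx0 mulr0 addr0 flatten1_id ?ler1n// mul1r.
by rewrite slope0 subrr mulr0 addr0 mxE.
Qed.

(* At a critical point, [slant] equals at most [b s / 2] where [s = dot e x0 x < 0]. *)
Lemma slant_critical x : grad flat_slant x = 0 ->
  4 * c <= b * Num.min 1 (b / (Y + 2 * (M * d%:R) + X)) ->
  2 + c^-1 * slant x <= 0.
Proof.
move=> gx cb; rewrite leNgt; apply/negP => pos.
have f0 := flatten1_gt0 n3 pos.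
have G i : slope x * e ord0 i + radial x * (x ord0 i - x0 ord0 i) = 0.
  apply/eqP; have := grad_flat_slant x i; rewrite gx mxE => /esym/eqP.
  by rewrite mulf_eq0 gt_eqF.
set s := dot e x0 x; set r := sqd x0 x; set l := radial x.
(* Where the truncation has positive slope, the gradient of [slant] itself vanishes; it is paired
   here with [e], and next with [x - x0]. *)
have G1 : slope x + l * s = 0.
  have : \sum_(i < N) e ord0 i * (slope x * e ord0 i + l * (x ord0 i - x0 ord0 i)) = 0.
    by rewrite big1// => i _; rewrite /l G mulr0.
  rewrite (eq_bigr (fun i => slope x * e ord0 i ^+ 2 + l * (e ord0 i * (x ord0 i - x0 ord0 i)))).
    by rewrite big_split -!mulr_sumr e1 mulr1.
  by move=> i _; ring.
have G2 : slope x * s + l * r = 0.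
  have : \sum_(i < N) (x ord0 i - x0 ord0 i) * (slope x * e ord0 i + l * (x ord0 i - x0 ord0 i)) = 0.
    by rewrite big1// => i _; rewrite /l G mulr0.
  rewrite (eq_bigr (fun i => slope x * (e ord0 i * (x ord0 i - x0 ord0 i)) + l * (x ord0 i - x0 ord0 i) ^+ 2)).
    by rewrite big_split -!mulr_sumr.
  by move=> i _; ring.
have r0 : 0 <= r by exact: sqd_ge0.
have sr : s ^+ 2 <= r by exact: dot_sqr_le.
have l0 : 0 <= l by rewrite mulr_ge0// profile1_ge0.
have Esl : b + X * s + l * s = 0 by [].
have l0' : l != 0.
  apply/eqP => lE; have r00 : r = 0.
    apply/eqP; case: (ltrgtP r 0) => // [rn|rp]; first by move: r0; rewrite leNgt rn.
    have := @profile1_gt0 R Y M d a Y0 M0 d2 a0 r rp.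
    by move: lE; rewrite /l /radial -/r; lra.
  have s0 : s = 0 by apply/eqP; rewrite -sqrf_eq0 eq_le sqr_ge0 andbT -r00.
  by move: Esl; rewrite s0 !mulr0 !addr0 => bE; move: b0; rewrite bE ltxx.
(* Equality in Cauchy-Schwarz: a critical point lies on the line through [x0] directed by [e]. *)
have rE : r = s ^+ 2.
  apply: (mulfI l0'); have -> : l * r = - (slope x * s) by apply/eqP; rewrite -addr_eq0 addrC G2.
  have -> : slope x = - (l * s) by apply/eqP; rewrite -addr_eq0 G1.
  by ring.
have lX : 0 < l + X by rewrite ltr_pwDl// lt0r l0' l0.
have sE : (l + X) * (- s) = b by move: Esl; lra.
have s0 : s < 0.
  have : 0 < (l + X) * (- s) by rewrite sE.
  by rewrite pmulr_rgt0// oppr_gt0.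
have D0 : 0 < Y + 2 * (M * d%:R) + X.
  have : 0 < M * d%:R by rewrite mulr_gt0// ltr0n ltnW.
  by move: X0 Y0; lra.
(* Either [- s >= 1], or [r = s ^+ 2 <= 1]; then [profile1_le] bounds [l], and [(l + X) * (- s) = b]
   bounds [- s] from below. *)
have smin : Num.min 1 (b / (Y + 2 * (M * d%:R) + X)) <= - s.
  rewrite ge_min; have [//|s1] := leP 1 (- s).
  rewrite orFb ler_pdivrMr// -sE mulrC ler_pM2l ?oppr_gt0// lerD2r.
  have := @profile1_le R Y M d a M0 r; rewrite /l /radial -/r.
  have -> : 0 <= r <= 1 by rewrite r0 rE; nra.
  by move=> /(_ isT); lra.
(* By convexity [slant x <= b s + (X + l) s^2 / 2], and [(l + X) * s ^+ 2 = - (b * s)]. *)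
have slb : slant x <= b * s / 2.
  have := @profile_convex R Y M d a M0 d2 a0 r r0.
  have -> : r * profile1 Y M d a r = s ^+ 2 * l / 2 by rewrite rE /l /radial -/r -rE; field.
  rewrite /slant -/s -/r => H.
  have : s * ((l + X) * - s) = s * b by rewrite sE.
  by move: H; nra.
have slc : slant x <= - (2 * c).
  have : b * Num.min 1 (b / (Y + 2 * (M * d%:R) + X)) <= b * (- s) by rewrite ler_pM2l.
  by move: slb cb; lra.
move: pos; rewrite ltNge => /negP; apply.
have : c^-1 * slant x <= c^-1 * (- (2 * c)) by rewrite ler_pM2l ?invr_gt0.
have -> : c^-1 * (- (2 * c)) = - 2 by field; rewrite gt_eqF.
lra.
Qed.

(** At such points [flatten] is at its constant value, left only at order [n], while its argument
    moves at most linearly. The radius [L^-1] keeps that argument at most 1, where [flatten_flat]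
    applies. *)
Lemma flat_slant_flat x : 2 + c^-1 * slant x <= 0 -> exists r L : R, [/\ 0 < r, 0 < L &
  forall y, enorm (y - x) < r -> `|flat_slant y - flat_slant x| <= L * enorm (y - x) ^+ n].
Proof.
move=> sx.
have [r [L [r0 L0 HL]]] : lip_at x (fun x => 2 + c^-1 * slant x).
  apply: lip_atD; first exact: lip_at_cst.
  apply: lip_atM; first exact: lip_at_cst.
  apply: lip_atD.
    apply: lip_atD; first by apply: lip_atM; [exact: lip_at_cst|exact: lip_at_dot].
    apply: lip_atM; first exact: lip_at_cst.
    by under eq_fun do rewrite expr2; apply: lip_atM; exact: lip_at_dot.
  exact: (lip_at_comp (is_derive_profile Y M d a (sqd x0 x)) (lip_at_sqd x x0)).
exists (Num.min r L^-1), (c * L ^+ n); split.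
- by rewrite lt_min r0 invr_gt0.
- by rewrite mulr_gt0// exprn_gt0.
move=> y; rewrite lt_min => /andP[/HL Hy yL].
set t := 2 + _ in sx Hy *; set ty := 2 + c^-1 * slant y in Hy.
rewrite /flat_slant -/t -/ty -mulrBr opprB addrA subrK normrM (gtr0_norm c0) -mulrA ler_pM2l//.
rewrite (flatten_neg n3 sx).
have Ly : L * enorm (y - x) < 1 by rewrite -ltr_pdivlMl// mulr1.
have ty1 : ty <= L * enorm (y - x) by have := ler_norm (ty - t); move: Hy sx; lra.
apply: le_trans (flatten_flat n3 _) _; first by apply: le_trans ty1 (ltW Ly).
have [ty0|ty0] := leP ty 0.
  rewrite posp_neg//; last by case: n n3.
  by rewrite mulr_ge0 ?exprn_ge0 ?enorm_ge0// ltW.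
rewrite (posp_pos _ (ltW ty0)) -exprMn lerXn2r ?nnegrE ?(ltW ty0)//.
by rewrite (le_trans (ltW ty0)).
Qed.

(** With gradient [b e] and Hessian [H = X e e^T + Y I] this is [b^(p - 2)] times the trace of [H]
    plus [(p - 2)] times the entry of [H] along [e]. *)
Lemma plaplacian_flat_slant p :
  plaplacian p flat_slant x0 = b `^ (p - 2) * ((p - 1) * X + (N%:R + p - 2) * Y).
Proof.
(* The squared length of the gradient of [slant], a smooth expression to be raised to the power
   [(p - 2) / 2]. *)
pose P x := slope x ^+ 2 + 2 * (slope x * radial x * dot e x0 x) + radial x ^+ 2 * sqd x0 x.
have P0 : P x0 = b ^+ 2 by rewrite /P slope0 dotxx sqdxx !mulr0 !addr0.
have Dsl i : is_derive x0 (delta_mx ord0 i) slope (X * e ord0 i).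
  by apply: (is_derive_eq (is_derive_addf (is_derive_fun_cst b _ _) (is_derive_cmulf X (is_derive_dot_delta e x0 x0 i)))); rewrite add0r.
have Drd i : is_derive x0 (delta_mx ord0 i) radial 0.
  have K : is_derive x0 (delta_mx ord0 i) radial _ := is_derive_cmulf 2
    (is_derive_comp_real (is_derive_sqd_delta x0 x0 i) (is_derive_profile1 Y M d a (sqd x0 x0))).
  by apply: (is_derive_eq K); rewrite subrr !mulr0.
have DP i : is_derive x0 (delta_mx ord0 i) P (2 * b * (X + Y) * e ord0 i).
  have K : is_derive x0 (delta_mx ord0 i) P _ := is_derive_addf (is_derive_addf
    (is_derive_comp_real (Dsl i) (is_derive_expr 2 (slope x0)))
    (is_derive_cmulf 2 (is_derive_mulf (is_derive_mulf (Dsl i) (Drd i)) (is_derive_dot_delta e x0 x0 i))))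
    (is_derive_mulf (is_derive_comp_real (Drd i) (is_derive_expr 2 (radial x0))) (is_derive_sqd_delta x0 x0 i)).
  apply: (is_derive_eq K); rewrite slope0 radial0 dotxx sqdxx subrr expr1; ring.
have b20 : 0 < P x0 by rewrite P0 exprn_gt0.
(* The truncation is the identity near [x0], so it does not affect derivatives there. *)
have near1 : \forall x \near x0, 1 <= 2 + c^-1 * slant x.
  have cs : {for x0, continuous (fun x => 2 + c^-1 * slant x)}.
    apply: (Ck_on_continuous (k := 2) (A := setT)) => //; apply: Ck_onD; first exact: Ck_on_cst.
    by apply: Ck_onM; [exact: Ck_on_cst|exact: Ck_on_slant].
  have /cvgrPdist_lt/(_ _ ltr01) := cs; apply: filterS => x.
  by rewrite slantx0 mulr0 addr0 ltr_norml => /andP[]; lra.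
rewrite /plaplacian /divergence.
have E i : partial i (fun y => (enorm (grad flat_slant y) `^ (p - 2) *: grad flat_slant y) ord0 i) x0
   = b `^ (p - 2) * (X * e ord0 i ^+ 2 + Y + (p - 2) * (X + Y) * e ord0 i ^+ 2).
  pose F x := P x `^ ((p - 2) / 2) * (slope x * e ord0 i + radial x * (x ord0 i - x0 ord0 i)).
  have D1 := is_derive_comp_real (DP i) (is_derive1_powR ((p - 2) / 2) b20).
  have D2 := is_derive_addf
    (is_derive_mulf (Dsl i) (is_derive_fun_cst (e ord0 i) x0 (delta_mx ord0 i)))
    (is_derive_mulf (Drd i) (is_derive_coordB i x0 x0 (delta_mx ord0 i))).
  have DF : is_derive x0 (delta_mx ord0 i) F _ := is_derive_mulf D1 D2.
  rewrite /partial (@near_eq_derive _ _ _ _ F).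
    have [_ ->] := DF.
    have bE : P x0 `^ ((p - 2) / 2) = b `^ (p - 2).
      by rewrite P0 -powR_mulrn ?ltW// -powRrM; congr (_ `^ _); field.
    have bE' : P x0 `^ ((p - 2) / 2 - 1) = b `^ (p - 2) / b ^+ 2.
      rewrite powRB; last by rewrite (gt_eqF b20) implybT.
      by rewrite bE powRr1 ?P0// sqr_ge0.
    rewrite /= bE' bE slope0 radial0 subrr mxE !eqxx /=.
    by field; rewrite gt_eqF.
  have := near1; apply: filterS => x x1.
  rewrite mxE grad_flat_slant flatten1_id// mul1r; congr (_ * _).
  have PE : \sum_(j < N) grad flat_slant x ord0 j ^+ 2 = P x.
    rewrite (eq_bigr (fun j => slope x ^+ 2 * e ord0 j ^+ 2 +
      2 * slope x * radial x * (e ord0 j * (x ord0 j - x0 ord0 j)) +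
      radial x ^+ 2 * (x ord0 j - x0 ord0 j) ^+ 2)).
      by rewrite !big_split -!mulr_sumr e1 mulr1 /P !mulrA.
    by move=> j _; rewrite grad_flat_slant flatten1_id// mul1r; ring.
  rewrite /enorm PE -powR12_sqrt; last by rewrite -PE; apply: sumr_ge0 => j _; exact: sqr_ge0.
  by rewrite -powRrM mulrC.
rewrite (eq_bigr _ (fun i _ => E i)) -mulr_sumr; congr (_ * _).
rewrite !big_split -!mulr_sumr e1 /= sumr_const card_ord -mulr_natr; ring.
Unshelve. all: by end_near. Qed.

End noncritical_function.

Section local_tests.
Context (R : realType) (N : nat) (p q : R) (u : R * 'rV[R]_N -> R).
Hypotheses (p1 : 1 < p) (usub : viscosity_subsolution p q u)
  (cu : {within [set z : R * 'rV[R]_N | 0 <= z.1], continuous u}).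
Variables (t0 : R) (x0 : 'rV[R]_N) (A C delta : R).
Hypotheses (t0_gt0 : 0 < t0) (C0 : 0 <= C) (delta0 : 0 < delta).

(** The local quadratic bound is extended to an admissible global test function: [touching] provides
    [M] and [a], and [flat_slant] repairs the critical points that [slant] may have elsewhere. *)
Lemma test_noncritical (e : 'rV[R]_N) (b X Y : R) :
  \sum_(i < N) e ord0 i ^+ 2 = 1 -> 0 < b -> 0 <= X -> 0 <= Y ->
  (forall t x, 0 < t -> (t - t0) ^+ 2 < delta -> sqd x0 x < delta ->
    u (t, x) <= u (t0, x0) + A * (t - t0) + C * (t - t0) ^+ 2 +
      (b * dot e x0 x + X / 2 * dot e x0 x ^+ 2 + Y / 2 * sqd x0 x)) ->
  A <= b `^ (p - 2) * ((p - 1) * X + (N%:R + p - 2) * Y) - b `^ q.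
Proof.
move=> e1 b0 X0 Y0 loc.
have low x : - (b * (1 + sqd x0 x)) <= b * dot e x0 x + X / 2 * dot e x0 x ^+ 2 + Y / 2 * sqd x0 x.
  have s2 := dot_sqr_le x0 x e1; have r0 := sqd_ge0 x0 x.
  have X2 : 0 <= X / 2 * dot e x0 x ^+ 2 by rewrite mulr_ge0 ?sqr_ge0// divr_ge0.
  have Y2 : 0 <= Y / 2 * sqd x0 x by rewrite mulr_ge0// divr_ge0.
  have : - (1 + sqd x0 x) <= dot e x0 x by nra.
  by rewrite -(ler_pM2l b0) mulrN; move: X2 Y2; lra.
have [a [M [a0 M0 T]]] := touching usub cu t0_gt0 (leqnn 2) delta0 C0 (ltW b0) low loc.
have [n n3 np] := exists_order p1.
(* The largest truncation level allowed by [slant_critical], for [d = 2]. *)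
pose c := b * Num.min 1 (b / (Y + 2 * (M * 2%:R) + X)) / 4.
have D0 : 0 < Y + 2 * (M * 2%:R) + X by move: X0 Y0 M0; lra.
have c0 : 0 < c by rewrite divr_gt0// mulr_gt0// lt_min ltr01 divr_gt0.
pose H := flat_slant x0 e b X Y M c n 2 a.
have cb : 4 * c <= b * Num.min 1 (b / (Y + 2 * (M * 2%:R) + X)) by rewrite /c; lra.
have gx0 : grad H x0 = b *: e by exact: grad_flat_slantx0.
have [||||] := T H.
- exact: Ck_on_flat_slant.
- exact: flat_slantx0.
- move=> x; apply: le_trans (flat_slant_ge x0 e b X Y M 2 a c0 n3 x).
  by rewrite /slant /profile; lra.
- exists n; split => // x gx.
  by apply: flat_slant_flat => //; exact: (slant_critical e1 b0 X0 Y0 M0 _ a0 c0 n3 gx cb).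
have gn0 : grad H x0 != 0.
  rewrite gx0 scaler_eq0 gt_eqF//=; apply/eqP => e00.
  move: e1; rewrite e00 big1; last by move=> i _; rewrite mxE expr0n.
  by move/esym/eqP; rewrite oner_eq0.
move=> /(_ gn0) + _; rewrite gx0.
rewrite plaplacian_flat_slant//.
suff -> : enorm (b *: e) = b by [].
rewrite /enorm (eq_bigr (fun i => b ^+ 2 * e ord0 i ^+ 2)); last by move=> i _; rewrite mxE exprMn.
by rewrite -mulr_sumr e1 mulr1 sqrtr_sqr gtr0_norm.
Qed.

(** No truncation occurs here: the derivative of the radial profile is positive off 0, so [x0] is
    the only critical point, and flatness there has order [2 k]. *)
Lemma test_critical (k : nat) (kap : R) : (2 <= k)%N -> 1 < (k.*2.-1)%:R * (p - 1) -> 0 <= kap ->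
  (forall t x, 0 < t -> (t - t0) ^+ 2 < delta -> sqd x0 x < delta ->
    u (t, x) <= u (t0, x0) + A * (t - t0) + C * (t - t0) ^+ 2 + kap * sqd x0 x ^+ k) -> A <= 0.
Proof.
move=> k2 kp kap0 loc.
have low x : - (0 * (1 + sqd x0 x)) <= kap * sqd x0 x ^+ k.
  by rewrite mul0r oppr0 mulr_ge0// exprn_ge0// sqd_ge0.
have [a [M [a0 M0 T]]] := touching usub cu t0_gt0 k2 delta0 C0 (lexx 0) low loc.
have K0 : 0 < kap + M by rewrite ltr_wpDl.
pose H x := profile 0 (kap + M) k a (sqd x0 x).
have D x i : is_derive x (delta_mx ord0 i) H (profile1 0 (kap + M) k a (sqd x0 x) * (2 * (x ord0 i - x0 ord0 i))).
  exact: (is_derive_comp_real (is_derive_sqd_delta x0 x i) (is_derive_profile 0 (kap + M) k a (sqd x0 x))).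
have gE x i : grad H x ord0 i = profile1 0 (kap + M) k a (sqd x0 x) * (2 * (x ord0 i - x0 ord0 i)).
  by rewrite mxE /partial; have [_ ->] := D x i.
have H0 : H x0 = 0 by rewrite /H sqdxx profile0.
have [||||_] := T H.
- by apply: Ck_on_profile => //; exact: Ck_on_sqd.
- exact: H0.
- by move=> x; rewrite /H /profile mul0r; lra.
- exists k.*2; split => //; first by case: k k2 {kp low loc T H D gE H0} => [|[|]].
  move=> x gx; have -> : x = x0.
    apply: sqd_eq0; apply/eqP; case: ltrgtP (sqd_ge0 x0 x) => // r0 _.
    have P := profile1_gt0 (lexx 0) K0 k2 a0 r0.
    move: r0; rewrite (_ : sqd x0 x = 0) ?ltxx// /sqd big1// => i _.
    have := gE x i; rewrite gx mxE => /esym/eqP; rewrite mulf_eq0 gt_eqF//= mulf_eq0 pnatr_eq0 /= => /eqP ->.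
    by rewrite expr0n.
  exists 1, (kap + M); split => // y y1; rewrite H0 subr0 /H /profile mul0r mul0r add0r.
  rewrite growth_eq0 ?addr0//; last first.
    by rewrite -enorm_sub_sqr expr_le1// ?enorm_ge0// ltW.
  rewrite -enorm_sub_sqr -exprM mul2n ger0_norm//.
  by rewrite mulr_ge0 ?exprn_ge0 ?enorm_ge0// ltW.
apply; apply/rowP => i; rewrite gE subrr !mulr0 mxE //.
Qed.

End local_tests.

(** * Contact points and jets *)

Section first_contact.
Context (R : realType) (N : nat) (u W : R * 'rV[R]_N -> R).
Hypothesis cu : {within [set z : R * 'rV[R]_N | 0 <= z.1], continuous u}.
Variables (s T D' D : R) (xc : 'rV[R]_N).
Hypotheses (s0 : 0 <= s) (D'D : D' <= D).
Hypothesis cW : forall t, t < T -> {within cylinder s t xc D, continuous W}.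
Hypothesis W0 : forall t x, s <= t < T -> sqd xc x <= D -> 0 <= W (t, x).
Hypothesis init : forall x, sqd xc x <= D -> u (s, x) <= W (s, x).
Hypothesis lateral : forall t x, s <= t < T -> D' <= sqd xc x <= D -> u (t, x) <= W (t, x).

(* Adding [eta / (T - t)] makes the barrier strict and keeps the contact away from [t = T]. *)
Lemma first_contact t1 x1 : s <= t1 < T -> sqd xc x1 <= D -> W (t1, x1) < u (t1, x1) ->
  exists eta t0 x0 delta, [/\ 0 < eta, 0 < delta, s < t0 < T, sqd xc x0 < D' &
    W (t0, x0) < u (t0, x0) /\
    forall t x, (t - t0) ^+ 2 < delta -> sqd x0 x < delta ->
      [/\ s <= t, t < T, sqd xc x <= D &
      u (t, x) <= u (t0, x0) + (W (t, x) - W (t0, x0)) + (eta / (T - t) - eta / (T - t0))]].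
Proof.
move=> /andP[st1 t1T] x1D Wu1.
set G := u (t1, x1) - W (t1, x1); have G0 : 0 < G by rewrite subr_gt0.
have Tt1 : 0 < T - t1 by rewrite subr_gt0.
(* At time [t1] the penalty [eta / (T - t1)] uses up half of the gap [G]. *)
pose eta := G * (T - t1) / 2; have eta0 : 0 < eta by rewrite divr_gt0// mulr_gt0.
have [K HK] := cylinder_bounded T xc D cu.
(* From [T'] on the penalty exceeds the bound [K] of [u], so a maximum over times up to [T'] is a
   maximum over all times before [T]. *)
pose T' := Num.max t1 (T - eta / (`|K| + 1)).
have K1 : 0 < `|K| + 1 by rewrite ltr_wpDl.
have T'T : T' < T by rewrite gt_max t1T ltrBlDr ltrDl divr_gt0.
pose v z := u z - W z - eta / (T - z.1).
have late t x : T' <= t < T -> sqd xc x <= D -> v (t, x) <= 0.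
  move=> /andP[T't tT] xD; rewrite /v /=.
  have st : s <= t by apply: le_trans T't; rewrite le_max st1.
  have := HK (t, x); rewrite /cylinder /= (le_trans s0 st) (ltW tT) /= => /(_ (conj isT xD)) uK.
  have := W0 (introT andP (conj st tT)) xD.
  have : `|K| + 1 <= eta / (T - t).
    rewrite ler_pdivlMr ?subr_gt0// mulrC -ler_pdivlMr//.
    have : T - eta / (`|K| + 1) <= T' by rewrite le_max lexx orbT.
    by move: T't; lra.
  by have := ler_norm K; move: uK; lra.
have cv : {within cylinder s T' xc D, continuous v}.
  apply/subspace_continuousP => z zC.
  have cuz : u z' @[z' --> within (cylinder s T' xc D) (nbhs z)] --> u z.
    have /subspace_continuousP H : {within cylinder s T' xc D, continuous u}.
      by apply: continuous_subspaceW cu => y [/andP[sy _] _]; exact: le_trans sy.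
    exact: H.
  have cWz : W z' @[z' --> within (cylinder s T' xc D) (nbhs z)] --> W z.
    by have /subspace_continuousP H := cW T'T; exact: H.
  apply: cvgB; first exact: cvgB.
  apply: cvgM; first exact: cvg_cst.
  have zT : z.1 < T by case: zC => /andP[_ zT'] _; exact: le_lt_trans zT' T'T.
  apply: cvgV; first by rewrite subr_eq0 gt_eqF.
  apply: cvgB; first exact: cvg_cst.
  by apply: cvg_within_filter; exact: cvg_fst.
have v1 : 0 < v (t1, x1).
  rewrite /v /= -/G /eta; have -> : G * (T - t1) / 2 / (T - t1) = G / 2 by field; rewrite gt_eqF.
  by lra.
have z1C : cylinder s T' xc D (t1, x1) by split => //=; rewrite st1 le_max lexx.
have [[t0 x0] z0C z0max] := cylinder_max (ex_intro _ _ z1C) cv.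
have v0 : 0 < v (t0, x0) := lt_le_trans v1 (z0max _ z1C).
case: z0C => /= /andP[st0 t0T'] x0D.
have t0T : t0 < T := le_lt_trans t0T' T'T.
have et0 : 0 < eta / (T - t0) by rewrite divr_gt0// subr_gt0.
have Wu0 : W (t0, x0) < u (t0, x0) by move: v0; rewrite /v /=; lra.
have st0' : s < t0.
  rewrite lt_neqAle st0 andbT; apply/eqP => st.
  by move: Wu0; rewrite -st ltNge init.
have x0D' : sqd xc x0 < D'.
  rewrite ltNge; apply/negP => D'x; move: Wu0; rewrite ltNge lateral ?st0//.
  by rewrite D'x.
have [e [L [e0 L0 HL]]] := lip_at_sqd x0 xc.
pose d1 := Num.min (t0 - s) (T - t0).
pose d2 := Num.min e ((D' - sqd xc x0) / L).
have d10 : 0 < d1 by rewrite lt_min !subr_gt0 st0'.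
have d20 : 0 < d2 by rewrite lt_min e0 divr_gt0// subr_gt0.
exists eta, t0, x0, (Num.min (d1 ^+ 2) (d2 ^+ 2)); split => //.
- by rewrite lt_min !exprn_gt0.
- by rewrite st0' t0T.
split => // t x; rewrite !lt_min => /andP[td1 _] /andP[_ xd2].
have {}td1 : `|t - t0| < d1.
  by rewrite -(ltr_pXn2r (n := 2))// ?nnegrE ?(ltW d10)// real_normK ?num_real.
have {}xd2 : enorm (x - x0) < d2.
  by rewrite -(ltr_pXn2r (n := 2))// ?nnegrE ?(ltW d20) ?enorm_ge0// enorm_sub_sqr.
move: td1; rewrite lt_min !ltr_norml => /andP[/andP[ts _] /andP[_ tT]].
have {ts} st : s <= t by move: ts; lra.
have {}tT : t < T by move: tT; lra.
have xD : sqd xc x <= D.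
  apply: le_trans D'D; move: xd2; rewrite lt_min => /andP[/HL H].
  rewrite ltr_pdivlMr// mulrC => H'.
  have := ler_norm (sqd xc x - sqd xc x0); move: H H'; lra.
split => //; rewrite -lerBlDr -subr_ge0.
have [T't|tT'] := leP T' t.
  have := late t x; rewrite T't tT => /(_ isT xD); move: v0; rewrite /v /=; lra.
have := z0max (t, x); rewrite /cylinder /= st (ltW tT') => /(_ (conj isT xD)).
by rewrite /v /=; lra.
Qed.

End first_contact.

Section upper_jet.
Context (R : realType).
Implicit Types (V : R -> R -> R).

(** A one-sided second-order expansion in a scalar space increment [h]. [C] may depend on [e]: a
    mixed term in [(t - t0) * h] is split into a small multiple of [h ^+ 2] and a large one of
    [(t - t0) ^+ 2]. *)
Definition upper_jet V (t0 A b G : R) := forall e, 0 < e -> exists C d, [/\ 0 <= C, 0 < d &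
  forall t h, `|t - t0| < d -> `|h| < d ->
    V t h <= A * (t - t0) + C * (t - t0) ^+ 2 + b * h + (G + e) / 2 * h ^+ 2].

Lemma upper_jet_time V (f f1 : R -> R) (t0 f2 r A b G : R) : 0 < r ->
  (forall t, `|t - t0| < r -> is_derive t 1 f (f1 t)) -> is_derive t0 1 f1 f2 ->
  upper_jet V t0 A b G -> upper_jet (fun t h => V t h + (f t - f t0)) t0 (A + f1 t0) b G.
Proof.
move=> r0 df df1 HV e e0; have [C [d [C0 d0 HC]]] := HV e e0.
have [d' [L [d'0 L0 HL]]] := taylor1_bound r0 df df1.
exists (C + L), (Num.min d d'); split; rewrite ?addr_ge0 ?(ltW L0) ?lt_min ?d0//.
move=> t h; rewrite !lt_min => /andP[td /HL td'] /andP[/(HC _ _ td) hd _].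
have := ler_norm (f t - f t0 - f1 t0 * (t - t0)); rewrite real_normK ?num_real// in td'.
by move: td' hd; lra.
Qed.

End upper_jet.

Section test_upper_jet.
Context (R : realType) (N : nat) (p q : R) (u : R * 'rV[R]_N -> R).
Hypotheses (N1 : (1 <= N)%N) (p1 : 1 < p) (usub : viscosity_subsolution p q u)
  (cu : {within [set z : R * 'rV[R]_N | 0 <= z.1], continuous u}).

(** With [h = nu s + mu r], where [s] is linear and [r] quadratic in [x - x0], the square of [h] is
    [nu^2 s^2] up to small multiples of [s^2] and [r]. So [test_noncritical] applies with [X] near
    [G nu^2] and [Y] near [2 b mu], and the error [ep] is then sent to 0. *)
Lemma test_upper_jet (t0 delta A b G nu mu : R) (x0 e : 'rV[R]_N) (V : R -> R -> R) :
  0 < t0 -> 0 < delta -> \sum_(i < N) e ord0 i ^+ 2 = 1 -> 0 < b -> 0 <= G -> 0 < nu -> 0 <= mu ->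
  upper_jet V t0 A b G ->
  (forall t x, 0 < t -> (t - t0) ^+ 2 < delta -> sqd x0 x < delta ->
    u (t, x) <= u (t0, x0) + V t (nu * dot e x0 x + mu * sqd x0 x)) ->
  A <= (b * nu) `^ (p - 2) * ((p - 1) * (G * nu ^+ 2) + (N%:R + p - 2) * (2 * b * mu)) - (b * nu) `^ q.
Proof.
move=> t00 delta0 e1 b0 G0 nu0 mu0 jet loc; set B := (b * nu) `^ (p - 2).
have bn0 : 0 < b * nu by rewrite mulr_gt0.
have Np : 0 <= N%:R + p - 2 by have : 1 <= N%:R :> R by [rewrite ler1n]; move: p1; lra.
pose K := B * ((p - 1) * ((G + 2) * nu ^+ 2) + (N%:R + p - 2)).
have B0 : 0 < B by exact: powR_gt0.
have K0 : 0 <= K.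
  rewrite mulr_ge0 ?(ltW B0)// addr_ge0// mulr_ge0 ?subr_ge0 ?(ltW p1)//.
  by rewrite mulr_ge0 ?sqr_ge0// addr_ge0.
suff H ep : 0 < ep -> ep <= 1 -> A <= B * ((p - 1) * (G * nu ^+ 2) + (N%:R + p - 2) * (2 * b * mu))
    - (b * nu) `^ q + K * ep.
  rewrite leNgt; apply/negP => lt.
  set Z := B * _ - _ in lt H.
  have AZ : 0 < A - Z by rewrite subr_gt0.
  have K1 : 0 < 2 * (K + 1) by rewrite mulr_gt0// ltr_wpDl.
  have := H (Num.min 1 ((A - Z) / (2 * (K + 1)))).
  rewrite lt_min ltr01 divr_gt0// ge_min lexx => /(_ isT isT).
  have : K * Num.min 1 ((A - Z) / (2 * (K + 1))) <= K * ((A - Z) / (2 * (K + 1))).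
    by rewrite ler_wpM2l// ge_min lexx orbT.
  have : K * ((A - Z) / (2 * (K + 1))) <= (A - Z) / 2.
    have -> : K * ((A - Z) / (2 * (K + 1))) = (A - Z) / 2 * (K / (K + 1)).
      by field; rewrite gt_eqF// ltr_wpDl.
    by rewrite ler_piMr// ?divr_ge0 ?(ltW AZ)// ler_pdivrMr ?ltr_wpDl// mul1r lerDl.
  by lra.
move=> ep0 ep1.
have [C [d [C0 d0 HC]]] := jet ep ep0.
pose c := Num.min 1 (d / (nu + mu + 1)).
have nm : 0 < nu + mu + 1 by move: nu0 mu0; lra.
have c0 : 0 < c by rewrite lt_min ltr01 divr_gt0.
(* For [r < ep / J] the term in [r ^+ 2] left by the splitting of [h ^+ 2] is at most
   [ep / 2 * r]. *)
pose J := (1 + ep^-1) * mu ^+ 2 * (G + 1) + 1.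
have iep0 : 0 <= 1 + ep^-1 by rewrite addr_ge0// invr_ge0 ltW.
have J0 : 0 < J.
  by rewrite ltr_wpDl//; apply: mulr_ge0; [apply: mulr_ge0 => //; exact: sqr_ge0|exact: addr_ge0].
pose dl := Num.min delta (Num.min (c ^+ 2) (Num.min (d ^+ 2) (ep / J))).
have dl0 : 0 < dl by rewrite !lt_min delta0 !exprn_gt0//= divr_gt0.
pose X := (G + ep) * (1 + ep) * nu ^+ 2.
pose Y := 2 * b * mu + ep.
have X0 : 0 <= X.
  apply: mulr_ge0; last exact: sqr_ge0.
  by apply: mulr_ge0; apply: addr_ge0 => //; exact: ltW.
have Y0 : 0 <= Y.
  by apply: addr_ge0; [apply: mulr_ge0 => //; apply: mulr_ge0 => //; exact: ltW|exact: ltW].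
have locP t x : 0 < t -> (t - t0) ^+ 2 < dl -> sqd x0 x < dl ->
    u (t, x) <= u (t0, x0) + A * (t - t0) + C * (t - t0) ^+ 2 +
      (b * nu * dot e x0 x + X / 2 * dot e x0 x ^+ 2 + Y / 2 * sqd x0 x).
  move=> tgt; rewrite !lt_min => /and4P[td _ td2 _] /and4P[xd xc _ xJ].
  have {}td2 : `|t - t0| < d.
    by rewrite -(ltr_pXn2r (n := 2))// ?nnegrE ?(ltW d0)// real_normK ?num_real.
  apply: le_trans (loc t x tgt td xd) _.
  have s2 := dot_sqr_le x0 x e1; set s := dot e x0 x in s2 *.
  have r0 := sqd_ge0 x0 x; set r := sqd x0 x in s2 r0 xc xJ *.
  have sc : `|s| < c.
    rewrite -(ltr_pXn2r (n := 2))// ?nnegrE ?(ltW c0)// real_normK ?num_real//.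
    exact: le_lt_trans s2 xc.
  have c1 : c <= 1 by rewrite ge_min lexx.
  have rc : r < c by apply: lt_le_trans xc _; rewrite expr2 ler_piMr ?(ltW c0).
  have hd : `|nu * s + mu * r| < d.
    apply: le_lt_trans (ler_normD _ _) _; rewrite !normrM (gtr0_norm nu0) (ger0_norm mu0) (ger0_norm r0).
    have : c <= d / (nu + mu + 1) by rewrite ge_min lexx orbT.
    rewrite ler_pdivlMr// => cd.
    have : nu * `|s| < nu * c by rewrite ltr_pM2l.
    have : mu * r <= mu * c by rewrite ler_wpM2l// ltW.
    by move: cd c0; lra.
  have := HC t _ td2 hd.
  have h2 : (nu * s + mu * r) ^+ 2 <= (1 + ep) * (nu ^+ 2 * s ^+ 2) + (1 + ep^-1) * (mu ^+ 2 * r ^+ 2).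
    rewrite -subr_ge0.
    have -> : (1 + ep) * (nu ^+ 2 * s ^+ 2) + (1 + ep^-1) * (mu ^+ 2 * r ^+ 2) - (nu * s + mu * r) ^+ 2
       = ep * (nu * s - ep^-1 * (mu * r)) ^+ 2 by field; rewrite gt_eqF.
    by rewrite mulr_ge0 ?sqr_ge0 ?(ltW ep0).
  have Ge : 0 <= (G + ep) / 2 by rewrite divr_ge0// addr_ge0// ltW.
  have : (G + ep) / 2 * (nu * s + mu * r) ^+ 2 <= X / 2 * s ^+ 2 + ep / 2 * r.
    apply: le_trans (ler_wpM2l Ge h2) _.
    rewrite mulrDr; have -> : (G + ep) / 2 * ((1 + ep) * (nu ^+ 2 * s ^+ 2)) = X / 2 * s ^+ 2.
      by rewrite /X; field.
    rewrite lerD2l; have -> : (G + ep) / 2 * ((1 + ep^-1) * (mu ^+ 2 * r ^+ 2)) =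
      ((G + ep) * ((1 + ep^-1) * mu ^+ 2) * r) / 2 * r by field; rewrite gt_eqF.
    rewrite ler_wpM2r// ler_pM2r// ?invr_gt0//.
    move: xJ; rewrite ltr_pdivlMr// => /ltW; apply: le_trans.
    rewrite mulrC ler_wpM2l// /J.
    have P0 : 0 <= (1 + ep^-1) * mu ^+ 2.
      by rewrite mulr_ge0 ?sqr_ge0.
    have : (G + ep) * ((1 + ep^-1) * mu ^+ 2) <= (G + 1) * ((1 + ep^-1) * mu ^+ 2).
      by rewrite ler_wpM2r// lerD2l.
    by lra.
  by rewrite /Y; lra.
have := test_noncritical p1 usub cu t00 C0 dl0 e1 bn0 X0 Y0 locP.
rewrite -/B => H; apply: le_trans H _.
rewrite -subr_ge0 /K /X /Y.
have -> : B * ((p - 1) * (G * nu ^+ 2) + (N%:R + p - 2) * (2 * b * mu)) - (b * nu) `^ q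
   + B * ((p - 1) * ((G + 2) * nu ^+ 2) + (N%:R + p - 2)) * ep
   - (B * ((p - 1) * ((G + ep) * (1 + ep) * nu ^+ 2) + (N%:R + p - 2) * (2 * b * mu + ep)) - (b * nu) `^ q)
  = B * (p - 1) * nu ^+ 2 * (ep * (1 - ep)) by ring.
apply: mulr_ge0; last by apply: mulr_ge0; [exact: ltW|rewrite subr_ge0].
by apply: mulr_ge0; [apply: mulr_ge0; [exact: ltW|rewrite subr_ge0 ltW]|exact: sqr_ge0].
Qed.

End test_upper_jet.

(** * Decay at infinity *)

Section blowup_function.
Context (R : realType) (k : nat).
Implicit Types (x : R).

(** Evaluated at [x = |y|^2 / r^2], it is infinite on the sphere of radius [r]. The order [n] sets
    the rate of explosion; [k] makes it flat of order [2 k] at the center, its only critical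
    point. *)
Definition blowup n x : R := ((1 - x ^+ k) ^+ n)^-1.

Lemma blowup_arg_gt0 x : (0 < k)%N -> `|x| < 1 -> 0 < 1 - x ^+ k.
Proof.
move=> k0 x1; rewrite subr_gt0; apply: le_lt_trans (ler_norm _) _.
by rewrite normrX exprn_ilt1// -lt0n.
Qed.

Lemma is_derive_blowup n x : (0 < k)%N -> `|x| < 1 ->
  is_derive x 1 (blowup n) (n%:R * k%:R * x ^+ k.-1 * blowup n.+1 x).
Proof.
move=> k0 x1; have D0 := blowup_arg_gt0 k0 x1.
have d1 : is_derive x 1 (fun y => 1 - y ^+ k) (- (k%:R * x ^+ k.-1)).
  apply: (is_derive_eq (is_deriveB (is_derive_fun_cst (1 : R) x 1) (is_derive_expr k x))).
  by rewrite sub0r.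
have d2 := is_derive_comp_real d1 (is_derive_expr n (1 - x ^+ k)).
have ne : ((fun y => y ^+ n) \o (fun y => 1 - y ^+ k)) x != 0 by rewrite /= gt_eqF// exprn_gt0.
apply: (is_derive_eq (is_deriveV ne d2)).
rewrite /blowup /= /GRing.scale/= -exprVn; case: n {d2 ne} => [|n]; first by rewrite !mul0r mulr0.
rewrite /= !exprS; field.
by rewrite !gt_eqF// ?exprn_gt0.
Qed.

Lemma blowup_gt0 n x : (0 < k)%N -> `|x| < 1 -> 0 < blowup n x.
Proof. by move=> k0 x1; rewrite invr_gt0 exprn_gt0// blowup_arg_gt0. Qed.

Lemma blowup0 n : (0 < k)%N -> blowup n 0 = 1.
Proof. by move=> k0; rewrite /blowup expr0n gtn_eqF// subr0 expr1n invr1. Qed.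

End blowup_function.

Section upper_jet_examples.
Context (R : realType).

(** The mixed term [eps (t - t0) (f h - f 0)] is split by Young's inequality with weight [e], after
    bounding [f h - f 0] by [L |h|]. *)
Lemma upper_jet_affine_mul (eps t0 r : R) (f f1 : R -> R) (f2 : R) : 0 < r -> 0 < eps -> 0 <= t0 ->
  (forall h : R, `|h| < r -> is_derive h 1 f (f1 h)) -> is_derive (0 : R) 1 f1 f2 ->
  upper_jet (fun t h => eps * (1 + t) * f h - eps * (1 + t0) * f 0) t0
    (eps * f 0) (eps * (1 + t0) * f1 0) (eps * (1 + t0) * f2).
Proof.
move=> r0 eps0 t00 df df1 e e0.
have lam0 : 0 < eps * (1 + t0) by rewrite mulr_gt0// ltr_pwDl.
set lam := eps * (1 + t0) in lam0 *.
have df' (z : R) : `|z - 0| < r -> is_derive z 1 f (f1 z) by rewrite subr0; exact: df.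
have e2 : 0 < e / (2 * lam) by rewrite divr_gt0// mulr_gt0.
have [d d0 T] := taylor2_le r0 df' df1 e2.
have r00 : `|0 : R| < r by rewrite normr0.
have [d' [L [d'0 L0 HL]]] := is_derive_lipschitz (df 0 r00).
exists ((eps * L) ^+ 2 / e), (Num.min d d'); split.
- by rewrite divr_ge0 ?sqr_ge0// ltW.
- by rewrite lt_min d0.
move=> t h _; rewrite lt_min => /andP[hd hd'].
have := T h; rewrite subr0 => /(_ hd) Th.
have := HL h; rewrite subr0 => /(_ hd') Lh.
have E1 : lam * (f h - f 0) <= lam * f1 0 * h + (lam * f2 + e / 2) / 2 * h ^+ 2.
  have -> : lam * f1 0 * h + (lam * f2 + e / 2) / 2 * h ^+ 2 =
    lam * (f1 0 * h + (f2 + e / (2 * lam)) / 2 * h ^+ 2) by field; rewrite gt_eqF.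
  by rewrite ler_pM2l//; move: Th; lra.
have E2 : eps * (t - t0) * (f h - f 0) <= (eps * L) ^+ 2 / e * (t - t0) ^+ 2 + e / 4 * h ^+ 2.
  apply: le_trans (ler_norm _) _; rewrite !normrM (gtr0_norm eps0).
  have : eps * `|t - t0| * `|f h - f 0| <= eps * `|t - t0| * (L * `|h|).
    by rewrite ler_wpM2l// mulr_ge0// ltW.
  move=> H; apply: le_trans H _; rewrite -subr_ge0.
  rewrite -[(t - t0) ^+ 2]real_normK ?num_real// -[h ^+ 2]real_normK ?num_real//.
  set a := `|t - t0|; set b := `|h|.
  have -> : (eps * L) ^+ 2 / e * a ^+ 2 + e / 4 * b ^+ 2 - eps * a * (L * b) =
    e^-1 * (eps * L * a - e / 2 * b) ^+ 2 by field; rewrite gt_eqF.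
  by rewrite mulr_ge0 ?sqr_ge0// invr_ge0 ltW.
have -> : eps * (1 + t) * f h - lam * f 0 =
   eps * f 0 * (t - t0) + lam * (f h - f 0) + eps * (t - t0) * (f h - f 0) by rewrite /lam; ring.
by move: E1 E2; lra.
Qed.

Lemma is_derive_time_penalty (eta T t : R) (n : nat) : t < T ->
  is_derive t 1 (fun t => eta / (T - t) ^+ n) (eta * n%:R / (T - t) ^+ n.+1).
Proof.
move=> tT; have D0 : 0 < T - t by rewrite subr_gt0.
have d1 : is_derive t 1 (fun y => T - y) (-1).
  apply: (is_derive_eq (is_deriveB (is_derive_fun_cst T t 1) (is_derive_id t 1))).
  by rewrite sub0r.
have d2 := is_derive_comp_real d1 (is_derive_expr n (T - t)).
have ne : ((fun y => y ^+ n) \o (fun y => T - y)) t != 0 by rewrite /= gt_eqF// exprn_gt0.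
apply: (is_derive_eq (is_derive_cmulf eta (is_deriveV ne d2))).
rewrite /= /GRing.scale/= -exprVn; case: n {d2 ne} => [|n]; first by rewrite !mul0r !mulr0 mul0r.
rewrite /= !exprS; field.
by rewrite !gt_eqF// ?exprn_gt0.
Qed.

Lemma upper_jet_penalty (V : R -> R -> R) (eta T t0 A b G : R) : t0 < T ->
  upper_jet V t0 A b G ->
  upper_jet (fun t h => V t h + (eta / (T - t) - eta / (T - t0))) t0 (A + eta / (T - t0) ^+ 2) b G.
Proof.
move=> t0T HV; have r0 : 0 < T - t0 by rewrite subr_gt0.
have D0 (t : R) : `|t - t0| < T - t0 -> is_derive t 1 (fun t => eta / (T - t)) (eta / (T - t) ^+ 2).
  rewrite ltr_norml => /andP[_]; rewrite ltrD2r => tT.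
  by have := is_derive_time_penalty eta 1 tT; rewrite mulr1.
exact: (upper_jet_time r0 D0 (is_derive_time_penalty eta 2 t0T) HV).
Qed.

Lemma penalty_le (eta T t0 : R) : t0 < T -> 0 < eta -> exists d L, [/\ 0 < d, 0 < L &
  forall t, (t - t0) ^+ 2 < d ->
    eta / (T - t) - eta / (T - t0) <= eta / (T - t0) ^+ 2 * (t - t0) + L * (t - t0) ^+ 2].
Proof.
move=> t0T eta0; have r0 : 0 < T - t0 by rewrite subr_gt0.
have D0 (t : R) : `|t - t0| < T - t0 -> is_derive t 1 (fun t => eta / (T - t)) (eta / (T - t) ^+ 2).
  rewrite ltr_norml => /andP[_]; rewrite ltrD2r => tT.
  by have := is_derive_time_penalty eta 1 tT; rewrite mulr1.
have [d [L [d0 L0 HL]]] := taylor1_bound r0 D0 (is_derive_time_penalty eta 2 t0T).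
exists (d ^+ 2), L; split; rewrite ?exprn_gt0// => t td.
have := HL t; rewrite -(ltr_pXn2r (n := 2))// ?nnegrE ?(ltW d0)// real_normK ?num_real// => /(_ td).
by have := ler_norm (eta / (T - t) - eta / (T - t0) - eta / (T - t0) ^+ 2 * (t - t0)); lra.
Qed.

End upper_jet_examples.

(** The condition on [k] makes order [2 k] admissible at the center. The one on [n] makes the
    singular factor [|grad|^(p - 2)] absorb the two extra orders of explosion of the second
    derivatives, which is possible because [p < 2]. *)
Lemma blowup_orders (R : realType) (p : R) : 1 < p -> p < 2 -> exists k n : nat, [/\ (2 <= k)%N, 1 < (k.*2.-1)%:R * (p - 1), (0 < n)%N &
  2 <= n.+1%:R * (2 - p)].
Proof.
move=> p1 p2.
have [j j3 jp] := exists_order p1.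
exists j, (Num.truncn (2 / (2 - p))).+1; split => //.
- by rewrite ltnW.
- apply: lt_le_trans jp _; rewrite ler_wpM2r ?subr_ge0 ?(ltW p1)// ler_nat.
  by rewrite -addnn; move: j3; lia.
- rewrite -ler_pdivrMr ?subr_gt0//; apply: le_trans (ltW (truncnS_gt _)) _.
  by rewrite ler_nat.
Qed.

Section blowup_supersolution.
Context (R : realType) (N : nat) (p : R).
Hypotheses (N1 : (1 <= N)%N) (p1 : 1 < p).

Variables (k n : nat).
Hypotheses (k2 : (2 <= k)%N) (kp : 1 < (k.*2.-1)%:R * (p - 1)) (n0 : (0 < n)%N)
  (np : 2 <= n.+1%:R * (2 - p)).

Let k0 : (0 < k)%N := ltnW k2.

Definition blowup1 (y : R) : R := n%:R * k%:R * y ^+ k.-1 * blowup k n.+1 y.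
Definition blowup2 (y : R) : R := n%:R * k%:R *
  (k.-1%:R * y ^+ k.-2 * blowup k n.+1 y + y ^+ k.-1 * (n.+1%:R * k%:R * y ^+ k.-1 * blowup k n.+2 y)).

Lemma is_derive_blowup1 (y : R) : `|y| < 1 -> is_derive y 1 blowup1 (blowup2 y).
Proof.
move=> y1.
have K := is_derive_mulf (is_derive_cmulf (n%:R * k%:R) (is_derive_expr k.-1 y)) (is_derive_blowup n.+1 k0 y1).
apply: (is_derive_eq K); rewrite /blowup2; ring.
Qed.

Let C2 : R := (p - 1) * (4 * (n%:R * k%:R) * (k.-1%:R + n.+1%:R * k%:R)) +
  (N%:R + p - 2) * (2 * (n%:R * k%:R)).

Let Np : 0 <= N%:R + p - 2.
Proof. by have : 1 <= N%:R :> R by [rewrite ler1n]; move: p1; lra. Qed.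

(** All second-order terms are bounded by one common expression, exploding at order [n + 2] on the
    sphere and vanishing as [w^(2 k - 2)] at the center. *)
Let bracket_le (lam r w : R) : 0 < lam -> 0 < r -> 0 < w < 1 ->
  (p - 1) * (lam * (blowup2 (w ^+ 2) / r ^+ 4) * (2 * (w * r)) ^+ 2) +
  (N%:R + p - 2) * (2 * (lam * (blowup1 (w ^+ 2) / r ^+ 2)) * 1)
  <= C2 * (lam / r ^+ 2 * (w ^+ 2) ^+ k.-1 * blowup k n.+2 (w ^+ 2)).
Proof.
move=> lam0 r0 /andP[w0 w1]; set z := w ^+ 2.
have z0 : 0 < z by rewrite exprn_gt0.
have z1 : z < 1 by rewrite exprn_ilt1// ltW.
have z1' : `|z| < 1 by rewrite gtr0_norm.
have D0 := blowup_arg_gt0 k0 z1'.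
have D1 : 1 - z ^+ k <= 1 by rewrite gerBl exprn_ge0// ltW.
have G0 := blowup_gt0 n.+1 k0 z1'; have G20 := blowup_gt0 n.+2 k0 z1'.
have GG : blowup k n.+1 z <= blowup k n.+2 z.
  by rewrite lef_pV2 ?posrE ?exprn_gt0// [leLHS]exprS ler_piMl// exprn_ge0// ltW.
have zk : z ^+ k.-1 = z * z ^+ k.-2 by rewrite -exprS; case: k k2 => [|[]].
have zk0 : 0 < z ^+ k.-1 by rewrite exprn_gt0.
have zk1 : z ^+ k.-1 <= 1 by rewrite exprn_ile1// ltW.
rewrite (_ : _ + _ = lam / r ^+ 2 * ((p - 1) * (4 * (z * blowup2 z)) +
   (N%:R + p - 2) * (2 * blowup1 z))); last by rewrite /z; field; rewrite gt_eqF.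
rewrite [leRHS](_ : _ = lam / r ^+ 2 * (C2 * (z ^+ k.-1 * blowup k n.+2 z))); last by ring.
rewrite ler_pM2l ?divr_gt0 ?exprn_gt0//.
have nk : 0 <= n%:R * k%:R :> R by rewrite mulr_ge0.
have B1 : blowup1 z <= n%:R * k%:R * (z ^+ k.-1 * blowup k n.+2 z).
  by rewrite /blowup1 -mulrA ler_wpM2l// ler_pM2l.
have B2 : z * blowup2 z <= n%:R * k%:R * (k.-1%:R + n.+1%:R * k%:R) * (z ^+ k.-1 * blowup k n.+2 z).
  rewrite /blowup2 [leLHS](_ : _ = n%:R * k%:R * (k.-1%:R * ((z * z ^+ k.-2) * blowup k n.+1 z) +
    n.+1%:R * k%:R * ((z * z ^+ k.-1) * (z ^+ k.-1 * blowup k n.+2 z)))); last by ring.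
  rewrite -zk -[leRHS]mulrA ler_wpM2l// mulrDl; apply: lerD.
    by rewrite ler_wpM2l// ler_pM2l.
  rewrite ler_wpM2l ?mulr_ge0// ler_piMl ?mulr_ge0 ?(ltW zk0) ?(ltW G20)//.
  by rewrite -[1]mulr1 ler_pM ?(ltW z0) ?(ltW zk0) ?(ltW z1).
rewrite /C2 [leRHS]mulrDl; apply: lerD.
  by rewrite -[leRHS]mulrA ler_pM2l ?subr_gt0//; move: B2; lra.
by rewrite -[leRHS]mulrA ler_wpM2l//; move: B1; lra.
Qed.

Let power_le (lam r w : R) : 0 < lam -> 0 < r -> 0 < w < 1 ->
  (lam * (blowup1 (w ^+ 2) / r ^+ 2) * (2 * (w * r))) `^ (p - 2) *
    (lam / r ^+ 2 * (w ^+ 2) ^+ k.-1 * blowup k n.+2 (w ^+ 2))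
  <= (2 * (n%:R * k%:R)) `^ (p - 2) * (lam `^ (p - 1) * r `^ (- p)) * blowup k n (w ^+ 2).
Proof.
move=> lam0 r0 /andP[w0 w1]; set z := w ^+ 2.
have z0 : 0 < z by rewrite exprn_gt0.
have z1 : z < 1 by rewrite exprn_ilt1// ltW.
have z1' : `|z| < 1 by rewrite gtr0_norm.
have D0 := blowup_arg_gt0 k0 z1'.
have D1 : 1 - z ^+ k <= 1 by rewrite gerBl exprn_ge0// ltW.
have GE m : blowup k m z = (1 - z ^+ k) `^ (- m%:R) by rewrite powR_invn// ltW.
have c0 : 0 < 2 * (n%:R * k%:R) :> R by rewrite !mulr_gt0 ?ltr0n.
have kw : (2 * k.-1 + 1 = k.*2.-1)%N by rewrite -(prednK k0) doubleS mul2n addn1.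
have bE : lam * (blowup1 z / r ^+ 2) * (2 * (w * r)) =
    2 * (n%:R * k%:R) * (lam * (r^-1 * (w ^+ k.*2.-1 * blowup k n.+1 z))).
  rewrite /blowup1 -kw exprD exprM -/z expr1; field; by rewrite gt_eqF.
have G0 m := blowup_gt0 m k0 z1'.
have wk0 : 0 < w ^+ k.*2.-1 by rewrite exprn_gt0.
have ri0 : 0 < r^-1 by rewrite invr_gt0.
have H1 := mulr_gt0 wk0 (G0 n.+1); have H2 := mulr_gt0 ri0 H1; have H3 := mulr_gt0 lam0 H2.
have PM (x y : R) : 0 < x -> 0 < y -> (x * y) `^ (p - 2) = x `^ (p - 2) * y `^ (p - 2).
  by move=> x0 y0; rewrite powRM ?ltW.
rewrite bE (PM _ _ c0 H3) (PM _ _ lam0 H2) (PM _ _ ri0 H1) (PM _ _ wk0 (G0 _)).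
have lamE : lam `^ (p - 1) = lam `^ (p - 2) * lam.
  rewrite -[X in _ * X]powRr1 ?(ltW lam0)// -powRD; last by rewrite (gt_eqF lam0) implybT.
  by congr (_ `^ _); ring.
have rE : r `^ (- p) = r^-1 `^ (p - 2) / r ^+ 2.
  rewrite -powR_inv1 ?(ltW r0)// -powRrM -[(r ^+ 2)^-1]powR_invn ?(ltW r0)//.
  rewrite -powRD; last by rewrite (gt_eqF r0) implybT.
  by congr (_ `^ _); ring.
rewrite lamE rE.
set cc := _ `^ (p - 2); set ll := lam `^ _; set rr := _ `^ (p - 2).
rewrite [leLHS](_ : _ = cc * (ll * lam * (rr / r ^+ 2)) *
  (((w ^+ k.*2.-1) `^ (p - 2) * z ^+ k.-1) * ((blowup k n.+1 z) `^ (p - 2) * blowup k n.+2 z))); last first.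
  set W := (w ^+ k.*2.-1) `^ _; set Gp := (blowup k n.+1 z) `^ _.
  by set G2 := blowup _ _ _; set Z := z ^+ _; set ri := (r ^+ 2)^-1; ring.
have cc0 : 0 <= cc * (ll * lam * (rr / r ^+ 2)).
  apply: mulr_ge0; first exact: powR_ge0.
  apply: mulr_ge0; first by apply: mulr_ge0; [exact: powR_ge0|exact: ltW].
  by apply: mulr_ge0; [exact: powR_ge0|rewrite invr_ge0 exprn_ge0// ltW].
apply: ler_wpM2l => //.
(* The total power of [w] is [(2 k - 1) (p - 1) - 1], positive by the choice of [k]. *)
have Wle : (w ^+ k.*2.-1) `^ (p - 2) * z ^+ k.-1 <= 1.
  rewrite /z -exprM -!powR_mulrn ?(ltW w0)// -powRrM -powRD; last by rewrite (gt_eqF w0) implybT.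
  rewrite -[leRHS](powRr0 w); apply: ger_powR; first by rewrite w0 ltW.
  have -> : (2 * k.-1)%N%:R = k.*2.-1%:R - 1 :> R by rewrite -kw natrD; ring.
  by move: kp; lra.
(* The order of explosion drops from [n + 2] to at most [n] because [2 <= (n + 1) (2 - p)]. *)
have Gle : blowup k n.+1 z `^ (p - 2) * blowup k n.+2 z <= blowup k n z.
  rewrite !GE -powRrM -powRD; last by rewrite (gt_eqF D0) implybT.
  apply: ger_powR; first by rewrite D0.
  by move: np; rewrite -!natr1; lra.
rewrite -[leRHS]mul1r; apply: ler_pM => //.
  by apply: mulr_ge0; [exact: powR_ge0|rewrite exprn_ge0// ltW].
by apply: mulr_ge0; [exact: powR_ge0|exact: ltW].
Qed.

(** The left side is the p-Laplacian, in the form produced by [test_upper_jet], of [lam] times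
    [blowup] at relative radius [w] in a ball of radius [r]. It is controlled by the function
    itself, with the factor [lam^(p - 1) r^(- p)] dictated by homogeneity. *)
Lemma blowup_supersolution : exists2 C3 : R, 0 < C3 & forall lam r w : R, 0 < lam -> 0 < r -> 0 < w < 1 ->
  (lam * (blowup1 (w ^+ 2) / r ^+ 2) * (2 * (w * r))) `^ (p - 2) *
  ((p - 1) * (lam * (blowup2 (w ^+ 2) / r ^+ 4) * (2 * (w * r)) ^+ 2) +
  (N%:R + p - 2) * (2 * (lam * (blowup1 (w ^+ 2) / r ^+ 2)) * 1))
  <= C3 * (lam `^ (p - 1) * r `^ (- p)) * blowup k n (w ^+ 2).
Proof.
have nk : 0 < n%:R * k%:R :> R by rewrite mulr_gt0 ?ltr0n.
have C20 : 0 < C2.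
  rewrite ltr_pwDl// ?mulr_ge0 ?(ltW nk)//.
  by rewrite !mulr_gt0 ?subr_gt0 ?ltr0n// ltr_wpDl// mulr_gt0 ?ltr0n.
exists (C2 * (2 * (n%:R * k%:R)) `^ (p - 2)).
  by rewrite mulr_gt0// powR_gt0// mulr_gt0.
move=> lam r w lam0 r0 w01.
apply: le_trans (ler_wpM2l (powR_ge0 _ _) (bracket_le lam0 r0 w01)) _.
rewrite mulrCA -!mulrA ler_pM2l//.
by have := power_le lam0 r0 w01; rewrite -!mulrA.
Qed.

End blowup_supersolution.

Section interior_bound.
Context (R : realType) (N : nat) (p q : R).
Hypotheses (N1 : (1 <= N)%N) (p1 : 1 < p) (p2 : p < 2).

Lemma bernoulli_le (k : nat) (y : R) : 0 <= y <= 1 -> 1 - y ^+ k <= k%:R * (1 - y).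
Proof.
move=> /andP[y0 y1]; elim: k => [|k IH]; first by rewrite expr0 subrr mul0r.
have yk : y * (1 - y ^+ k) <= 1 - y ^+ k.
  by rewrite ler_piMl// subr_ge0 exprn_ile1.
rewrite exprS -natr1; have -> : 1 - y * y ^+ k = (1 - y) + y * (1 - y ^+ k) by ring.
by move: IH yk; lra.
Qed.

(** Recenters the squared distance in the form [nu * dot + mu * sqd] of [test_upper_jet]; with [r]
    the distance from [x0] to [x1], the direction is a unit vector. *)
Lemma sqd_shift (x1 x0 x : 'rV[R]_N) (r : R) : r != 0 ->
  sqd x1 x = sqd x1 x0 + (2 * r * dot (r^-1 *: (x0 - x1)) x0 x + 1 * sqd x0 x).
Proof.
move=> r0; rewrite /sqd /dot mul1r mulr_sumr -!big_split /=; apply: eq_bigr => i _.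
by rewrite !mxE; field.
Qed.

(* No growth condition is imposed on [u]: since [p < 2] there are supersolutions of the
   p-Laplace equation which blow up on the boundary of a ball. *)
Lemma interior_bound : exists2 C3 : R, 0 < C3 & forall u : R * 'rV[R]_N -> R,
  viscosity_subsolution p q u ->
  {within [set z : R * 'rV[R]_N | 0 <= z.1], continuous u} ->
  forall (x1 : 'rV[R]_N) (r eps m T : R), 0 < r -> 0 < eps -> 0 <= m -> 0 < T ->
  C3 * (eps * (1 + T)) `^ (p - 1) <= eps * r `^ p ->
  (forall x, sqd x1 x <= r ^+ 2 -> u (0, x) <= m) ->
  forall t, 0 <= t < T -> u (t, x1) <= m + eps * (1 + t).
Proof.
have [k [n [k2 kp n0 np]]] := blowup_orders p1 p2.
have k0 : (0 < k)%N := ltnW k2.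
have [C3 C30 HC3] := blowup_supersolution N1 p1 k2 kp n0 np.
exists C3 => // u usub cu x1 r eps m T r0 eps0 m0 T0 Cr init t /andP[tge0 tT].
have r20 : 0 < r ^+ 2 by rewrite exprn_gt0.
rewrite leNgt; apply/negP => ubad.
have [K HK] := cylinder_bounded T x1 (r ^+ 2) cu.
(* Relative thickness of a layer near the sphere in which, by Bernoulli's inequality, the barrier
   exceeds the bound [K] of [u]; the cylinder stops at half of it, where the barrier is still
   finite. *)
pose y := Num.min (2^-1) (eps / (k%:R * (`|K| + 1))).
have kK : 0 < k%:R * (`|K| + 1) :> R by rewrite mulr_gt0 ?ltr0n// ltr_wpDl.
have y0 : 0 < y by rewrite lt_min invr_gt0 ltr0n divr_gt0.
have y1 : y <= 2^-1 by rewrite ge_min lexx.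
pose D' := r ^+ 2 * (1 - y); pose D := r ^+ 2 * (1 - y / 2).
have D'D : D' <= D by rewrite ler_pM2l//; move: y0; lra.
have Dr : D < r ^+ 2 by rewrite /D gtr_pMr//; move: y0; lra.
(* The factor [1 + t] gives the time derivative [eps * blowup], which dominates the p-Laplacian
   thanks to the hypothesis relating [eps], [r] and [T]. *)
pose W (z : R * 'rV[R]_N) := m + eps * (1 + z.1) * blowup k n (sqd x1 z.2 / r ^+ 2).
have arg1 x : sqd x1 x <= D -> `|sqd x1 x / r ^+ 2| < 1.
  move=> xD; rewrite ger0_norm ?divr_ge0 ?sqd_ge0 ?(ltW r20)// ltr_pdivrMr// mul1r.
  exact: le_lt_trans Dr.
have W0 s x : 0 <= s < T -> sqd x1 x <= D -> 0 <= W (s, x).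
  move=> /andP[s0 _] xD; rewrite addr_ge0// mulr_ge0//; last by rewrite ltW// blowup_gt0// arg1.
  by rewrite mulr_ge0 ?(ltW eps0)// addr_ge0.
have cW s : s < T -> {within cylinder 0 s x1 D, continuous W}.
  move=> _; apply: continuous_in_subspaceT => z; rewrite inE => -[_ zD].
  have cb : {for z, continuous (fun z : R * 'rV[R]_N => blowup k n (sqd x1 z.2 / r ^+ 2))}.
    have := @continuous_comp _ _ _ (fun z : R * 'rV[R]_N => sqd x1 z.2 / r ^+ 2) (blowup k n) z; apply.
      apply: cvgM; last exact: cvg_cst.
      by apply: (@continuous_comp _ _ _ (@snd R 'rV[R]_N) (sqd x1)); [exact: cvg_snd|exact: continuous_sqd].
    have [Db _] := is_derive_blowup n k0 (arg1 _ zD).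
    exact/differentiable_continuous/derivable1_diffP.
  apply: cvgD; first exact: cvg_cst.
  apply: cvgM => //; apply: cvgM; first exact: cvg_cst.
  by apply: cvgD; [exact: cvg_cst|exact: cvg_fst].
have blow_ge1 x : sqd x1 x <= D -> 1 <= blowup k n (sqd x1 x / r ^+ 2).
  move=> xD; have A0 := blowup_arg_gt0 k0 (arg1 _ xD).
  rewrite /blowup -[leLHS]invr1 lef_pV2 ?posrE ?exprn_gt0// exprn_ile1 ?(ltW A0)//.
  by rewrite gerBl exprn_ge0// divr_ge0 ?sqd_ge0// ltW.
have initW x : sqd x1 x <= D -> u (0, x) <= W (0, x).
  move=> xD; apply: le_trans (init x (le_trans xD (ltW Dr))) _.
  rewrite /W /= addr0 mulr1 lerDl mulr_ge0 ?(ltW eps0)//.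
  by apply: le_trans (blow_ge1 x xD).
have lateral s x : 0 <= s < T -> D' <= sqd x1 x <= D -> u (s, x) <= W (s, x).
  move=> /andP[s0 sT] /andP[D'x xD].
  have uK : u (s, x) <= K.
    by apply: HK; split => /=; [rewrite s0 ltW|exact: le_trans (ltW Dr)].
  apply: le_trans uK _; apply: le_trans (ler_norm K) _.
  have := blow_ge1 x xD; have A0 := blowup_arg_gt0 k0 (arg1 _ xD).
  set z := sqd x1 x / r ^+ 2 in A0 * => _.
  have z0 : 0 <= z by rewrite divr_ge0 ?sqd_ge0// ltW.
  have z1 : z <= 1 by have := arg1 _ xD; rewrite -/z ger0_norm// => /ltW.
  have zy : 1 - z <= y.
    by have : 1 - y <= z; [rewrite ler_pdivlMr// mulrC|lra].
  have A1 : 1 - z ^+ k <= 1 by rewrite gerBl exprn_ge0.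
  have Ay : (1 - z ^+ k) ^+ n <= eps / (`|K| + 1).
    have : (1 - z ^+ k) ^+ n <= 1 - z ^+ k.
      by rewrite -(prednK n0) exprS ler_piMr ?(ltW A0)// exprn_ile1// ltW.
    move=> H; apply: le_trans H _; apply: le_trans (bernoulli_le k _) _; first by rewrite z0.
    have : k%:R * (1 - z) <= k%:R * (eps / (k%:R * (`|K| + 1))).
      by rewrite ler_wpM2l// (le_trans zy)// ge_min lexx orbT.
    move=> H; apply: le_trans H _; rewrite le_eqVlt; apply/orP; left; apply/eqP.
    by field; rewrite !gt_eqF ?ltr0n// ltr_wpDl.
  have K1 : 0 < `|K| + 1 by rewrite ltr_wpDl.
  have : `|K| + 1 <= eps * blowup k n z.
    rewrite /blowup ler_pdivlMr ?exprn_gt0// mulrC -ler_pdivlMr//.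
  have : eps * blowup k n z <= eps * (1 + s) * blowup k n z.
    rewrite ler_wpM2r ?ler_pMr//; first by rewrite invr_ge0 exprn_ge0// ltW.
    by rewrite lerDl.
  by rewrite /W /= -/z; move: m0; lra.
have x1D : sqd x1 x1 <= D.
  by rewrite sqdxx mulr_ge0 ?(ltW r20)//; move: y1; lra.
have Wu : W (t, x1) < u (t, x1) by rewrite /W /= sqdxx mul0r blowup0// mulr1.
have [eta [t0 [x0 [delta [eta0 delta0 /andP[t00 t0T] x0D' [_ touch]]]]]] :=
  first_contact cu (lexx 0) D'D cW W0 initW lateral (introT andP (conj tge0 tT)) x1D Wu.
have x0D : sqd x1 x0 <= D := le_trans (ltW x0D') D'D.
(* At the center the gradient vanishes, and the contradiction comes from [test_critical]: the time
   slope would be nonpositive, yet it is at least [eps]. *)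
have [x01|x01] := eqVneq (sqd x1 x0) 0.
  have xE := sqd_eq0 x01; subst x0.
  have n10 : `|0 : R| < 1 by rewrite normr0.
  (* Since [blowup k n z = blowup 1 n (z ^+ k)], a Lipschitz bound at 0 for exponent 1 gives an
     increment of order [z ^+ k]. *)
  have [d [L [d0 L0 HL]]] := is_derive_lipschitz (@is_derive_blowup R 1 n 0 isT n10).
  have [d' [L' [d'0 L'0 HL']]] := penalty_le t0T eta0.
  have dmin0 : 0 < Num.min d 1 * r ^+ 2 by rewrite mulr_gt0// lt_min d0 ltr01.
  pose del := Num.min delta (Num.min d' (Num.min 1 (Num.min d 1 * r ^+ 2))).
  have del0 : 0 < del by rewrite !lt_min delta0 d'0 ltr01.
  pose kap := eps * (2 + t0) * (L / (r ^+ 2) ^+ k).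
  have kap0 : 0 <= kap.
    apply: mulr_ge0; first by apply: mulr_ge0; [exact: ltW|rewrite addr_ge0// ltW].
    by rewrite divr_ge0 ?(ltW L0)// exprn_ge0// ltW.
  pose A := eps + eta / (T - t0) ^+ 2.
  have A0 : 0 < A by rewrite addr_gt0// divr_gt0// exprn_gt0// subr_gt0.
  have loc t' x : 0 < t' -> (t' - t0) ^+ 2 < del -> sqd x1 x < del ->
      u (t', x) <= u (t0, x1) + A * (t' - t0) + L' * (t' - t0) ^+ 2 + kap * sqd x1 x ^+ k.
    move=> t'0; rewrite !lt_min => /and4P[tdel td' td1 _] /and4P[xdel _ _].
    rewrite -ltr_pdivrMr// lt_min => /andP[xd xr1].
    have [_ _ xD] := touch t' x tdel xdel; rewrite /W /= sqdxx mul0r blowup0// mulr1 => Hu.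
    have := HL' t' td'; set z := sqd x1 x / r ^+ 2 in xd xr1 Hu *.
    have z0 : 0 <= z by rewrite divr_ge0 ?sqd_ge0// ltW.
    have zk0 : 0 <= z ^+ k by rewrite exprn_ge0.
    have zkz : z ^+ k <= z by rewrite -(prednK k0) exprS ler_piMr// exprn_ile1// ltW.
    have := HL (z ^+ k); rewrite subr0 ger0_norm// => /(_ (le_lt_trans zkz xd)).
    have -> : blowup 1 n (z ^+ k) = blowup k n z by rewrite /blowup expr1.
    rewrite blowup0// => /(le_trans (ler_norm _)) Lz HP.
    have t'1 : t' <= t0 + 1 by move: td1 => /ltW; nra.
    have E : eps * (1 + t') * (blowup k n z - 1) <= eps * (2 + t0) * (L * z ^+ k).
      apply: (@le_trans _ _ (eps * (1 + t') * (L * z ^+ k))).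
        by rewrite ler_wpM2l// mulr_ge0 ?(ltW eps0)// addr_ge0// ltW.
      rewrite ler_wpM2r//; first by rewrite mulr_ge0// ltW.
      by rewrite ler_pM2l//; move: t'1; lra.
    have -> : kap * sqd x1 x ^+ k = eps * (2 + t0) * (L * z ^+ k).
      by rewrite /kap /z expr_div_n; ring.
    by move: Hu E HP; rewrite /A; lra.
  have := test_critical usub cu t00 (ltW L'0) del0 k2 kp kap0 loc.
  by rewrite leNgt A0.
pose r0' := enorm (x0 - x1).
have r0sq : r0' ^+ 2 = sqd x1 x0 by exact: enorm_sub_sqr.
have r0'0 : 0 < r0'.
  rewrite lt0r enorm_ge0 andbT; apply: contraNneq x01 => E.
  by rewrite -r0sq E expr0n.
pose w := r0' / r.
have w0 : 0 < w by rewrite divr_gt0.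
have w2E : w ^+ 2 = sqd x1 x0 / r ^+ 2 by rewrite /w expr_div_n r0sq.
have w21 : w ^+ 2 < 1 by have := arg1 x0 x0D; rewrite -w2E ger0_norm// sqr_ge0.
have w1 : w < 1 by rewrite -(ltr_pXn2r (n := 2))// ?nnegrE ?(ltW w0)// expr1n.
have wr : w * r = r0' by rewrite /w divfK// gt_eqF.
pose lam := eps * (1 + t0).
have lam0 : 0 < lam by rewrite mulr_gt0// ltr_pwDl// ltW.
pose f h := blowup k n (w ^+ 2 + (r ^+ 2)^-1 * h).
pose f1 h := (r ^+ 2)^-1 * blowup1 k n (w ^+ 2 + (r ^+ 2)^-1 * h).
have dq (h : R) : is_derive h 1 (fun h => w ^+ 2 + (r ^+ 2)^-1 * h) ((r ^+ 2)^-1).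
  apply: (is_derive_eq (is_derive_addf (is_derive_fun_cst (w ^+ 2) h 1) (is_derive_cmulf (r ^+ 2)^-1 (is_derive_id h 1)))).
  by rewrite add0r mulr1.
have rad0 : 0 < r ^+ 2 * (1 - w ^+ 2) by rewrite mulr_gt0// subr_gt0.
have ri0 : 0 < (r ^+ 2)^-1 by rewrite invr_gt0.
have w20 : 0 < w ^+ 2 by rewrite exprn_gt0.
have arg2 (h : R) : `|h| < r ^+ 2 * (1 - w ^+ 2) -> `|w ^+ 2 + (r ^+ 2)^-1 * h| < 1.
  move=> hr; apply: le_lt_trans (ler_normD _ _) _.
  rewrite (gtr0_norm w20) normrM (gtr0_norm ri0).
  by rewrite -ltrBrDl mulrC ltr_pdivrMr// mulrC.
have df (h : R) : `|h| < r ^+ 2 * (1 - w ^+ 2) -> is_derive h 1 f (f1 h).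
  move=> /arg2 hr.
  have Df : is_derive h 1 f _ := is_derive_comp_real (dq h) (is_derive_blowup n k0 hr).
  by apply: (is_derive_eq Df); rewrite /f1 /blowup1 mulrC.
have df1 : is_derive (0 : R) 1 f1 (blowup2 k n (w ^+ 2) / r ^+ 4).
  have hr : `|w ^+ 2 + (r ^+ 2)^-1 * 0| < 1 by rewrite mulr0 addr0 gtr0_norm// exprn_gt0.
  have Df : is_derive (0 : R) 1 f1 _ := is_derive_cmulf (r ^+ 2)^-1 (is_derive_comp_real (dq 0) (is_derive_blowup1 n k2 hr)).
  by apply: (is_derive_eq Df); rewrite mulr0 addr0; field; rewrite gt_eqF.
have jet := upper_jet_penalty eta t0T (upper_jet_affine_mul rad0 eps0 (ltW t00) df df1).
have f10 : f1 0 = blowup1 k n (w ^+ 2) / r ^+ 2 by rewrite /f1 mulr0 addr0 mulrC.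
have w2n : `|w ^+ 2| < 1 by rewrite gtr0_norm// exprn_gt0.
have F10 : 0 < f1 0.
  rewrite f10 divr_gt0// mulr_gt0 ?blowup_gt0// mulr_gt0 ?exprn_gt0//.
  by rewrite mulr_gt0 ?ltr0n.
have F20 : 0 <= blowup2 k n (w ^+ 2) / r ^+ 4.
  rewrite divr_ge0// ?exprn_ge0 ?(ltW r0)// mulr_ge0//.
  have P j : 0 <= (w ^+ 2) ^+ j by rewrite exprn_ge0// exprn_ge0// ltW.
  by rewrite addr_ge0// !mulr_ge0// ltW// blowup_gt0.
have e1 : \sum_(i < N) (r0'^-1 *: (x0 - x1)) ord0 i ^+ 2 = 1.
  rewrite (eq_bigr (fun i => r0' ^- 2 * (x0 ord0 i - x1 ord0 i) ^+ 2)); last first.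
    by move=> i _; rewrite !mxE exprMn exprVn.
  by rewrite -mulr_sumr -/(sqd x1 x0) -r0sq mulVf// gt_eqF// exprn_gt0.
have nu0 : 0 < 2 * r0' by rewrite mulr_gt0.
have B0 : 0 < lam * f1 0 by rewrite mulr_gt0.
have G0 : 0 <= lam * (blowup2 k n (w ^+ 2) / r ^+ 4) by rewrite mulr_ge0// ltW.
have loc t' x : 0 < t' -> (t' - t0) ^+ 2 < delta -> sqd x0 x < delta ->
    u (t', x) <= u (t0, x0) + (fun t h => eps * (1 + t) * f h - eps * (1 + t0) * f 0 +
      (eta / (T - t) - eta / (T - t0))) t' (2 * r0' * dot (r0'^-1 *: (x0 - x1)) x0 x + 1 * sqd x0 x).
  move=> _ td xd; have [_ _ xD] := touch t' x td xd.
  move=> H; apply: le_trans H _; rewrite -addrA lerD2l lerD2r.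
  have r0'N : r0' != 0 by rewrite gt_eqF.
  rewrite /W /= (sqd_shift x1 x0 x r0'N) -w2E /f mulr0 addr0 [(_ + _) / r ^+ 2]mulrDl -w2E.
  by rewrite [_ / r ^+ 2]mulrC; lra.
have := @test_upper_jet R N p q u N1 p1 usub cu t0 delta _ _ _ (2 * r0') 1 x0 _ _
  t00 delta0 e1 B0 G0 nu0 ler01 jet loc.
have := HC3 lam r w lam0 r0 (introT andP (conj w0 w1)).
rewrite wr -f10 -/lam; set RHS := _ `^ _ * _ => H1 H2.
have F0 : 0 < blowup k n (w ^+ 2) by rewrite blowup_gt0.
(* The time slope at the contact is this right side plus the positive penalty term, so the viscosity
   inequality fails even without the absorption. *)
have : RHS <= eps * blowup k n (w ^+ 2).
  apply: le_trans H1 _; rewrite ler_pM2r//.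
  have rp : 0 < r `^ p by rewrite powR_gt0.
  rewrite powRN mulrA ler_pdivrMr//; apply: le_trans Cr; rewrite ler_pM2l//.
  apply: ge0_ler_powR; rewrite ?subr_ge0 ?(ltW p1)// ?nnegrE ?(ltW lam0)//.
    by rewrite mulr_ge0 ?(ltW eps0)// addr_ge0// ltW.
  by rewrite ler_pM2l// lerD2l ltW.
have : 0 < eta / (T - t0) ^+ 2 by rewrite divr_gt0// exprn_gt0// subr_gt0.
have := powR_ge0 (lam * f1 0 * (2 * r0')) q.
have f0E : f 0 = blowup k n (w ^+ 2) by rewrite /f mulr0 addr0.
rewrite f0E in H2.
by move: H2; lra.
Qed.

End interior_bound.

Section decay.
Context (R : realType) (N : nat) (p q : R) (u : R * 'rV[R]_N -> R).
Hypotheses (N1 : (1 <= N)%N) (p1 : 1 < p) (p2 : p < 2) (usub : viscosity_subsolution p q u)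
  (cu : {within [set z : R * 'rV[R]_N | 0 <= z.1], continuous u}).

(** [interior_bound] is applied on balls of one fixed radius, depending on [eps] and [T] only,
    placed far enough for the initial data on them to be at most [eps / 2]. *)
Lemma decay_at_infinity :
  (forall eps, 0 < eps -> exists D, forall x, D <= sqd 0 x -> u (0, x) <= eps) ->
  forall eps T, 0 < eps -> 0 < T -> exists D, forall t x, 0 <= t < T -> D <= sqd 0 x -> u (t, x) <= eps.
Proof.
move=> dec eps T eps0 T0.
have [C3 C30 HC3] := @interior_bound R N p q N1 p1 p2.
have e20 : 0 < eps / 2 by rewrite divr_gt0.
have [D0 HD0] := dec _ e20.
have T1 : 0 < 1 + T by rewrite addr_gt0.
pose e' := eps / 2 / (1 + T).
have e'0 : 0 < e' by rewrite divr_gt0.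
pose c := C3 * (e' * (1 + T)) `^ (p - 1) / e'.
have c0 : 0 < c by rewrite divr_gt0// mulr_gt0// powR_gt0// mulr_gt0.
pose r := c `^ p^-1.
have r0 : 0 < r by rewrite powR_gt0.
have rp : r `^ p = c.
  by rewrite /r -powRrM mulVf ?powRr1 ?(ltW c0)// gt_eqF// (lt_trans ltr01).
(* From [|x1|^2 <= 2 |x|^2 + 2 |x - x1|^2], the whole ball around [x1] satisfies [D0 <= |x|^2]. *)
exists (2 * (D0 + r ^+ 2)) => t x1 tT x1D.
have Cr : C3 * (e' * (1 + T)) `^ (p - 1) <= e' * r `^ p.
  by rewrite rp /c [leRHS](_ : _ = C3 * (e' * (1 + T)) `^ (p - 1))// mulrC divfK// gt_eqF.
have := HC3 u usub cu x1 r e' (eps / 2) T r0 e'0 (ltW e20) T0 Cr _ t tT.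
move=> H; apply: le_trans (H _) _.
  move=> x xr; apply: HD0.
  have : sqd 0 x1 <= 2 * sqd 0 x + 2 * sqd x1 x.
    rewrite /sqd !mulr_sumr -big_split /=; apply: ler_sum => i _; rewrite !mxE.
    by have := sqr_ge0 (x1 ord0 i - 0 - 2 * (x1 ord0 i - x ord0 i)); nra.
  by move: x1D xr; lra.
have : e' * (1 + t) <= eps / 2.
  have -> : eps / 2 = e' * (1 + T) by rewrite /e' divfK// gt_eqF.
  by case/andP: tT => _ tT; rewrite ler_pM2l// lerD2l ltW.
lra.
Qed.

End decay.

(** * Comparison with power barriers *)

Section upper_jet_comp.
Context (R : realType).

(** The jet of a profile [f] whose argument is advanced by [g] in time and moved back by [h] in
    space, as for the barrier along one direction. *)
Lemma upper_jet_comp (f f1 g g1 : R -> R) (f2 g2 sig t0 r r' : R) : 0 < r -> 0 < r' -> 0 <= f2 ->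
  (forall y : R, `|y - sig| < r -> is_derive y 1 f (f1 y)) -> is_derive sig 1 f1 f2 ->
  (forall t : R, `|t - t0| < r' -> is_derive t 1 g (g1 t)) -> is_derive t0 1 g1 g2 ->
  upper_jet (fun t h => f (sig + (g t - g t0) - h) - f sig) t0 (f1 sig * g1 t0) (- f1 sig) f2.
Proof.
move=> r0 r'0 f20 df df1 dg dg1 e e0.
have e4 : 0 < e / 4 by rewrite divr_gt0.
have [d d0 Tf] := taylor2_le r0 df df1 e4.
have [d1 [L1 [d10 L10 T1]]] := taylor1_bound r'0 dg dg1.
have t00 : `|t0 - t0| < r' by rewrite subrr normr0.
have [d2 [L2 [d20 L20 T2]]] := is_derive_lipschitz (dg t0 t00).
(* Young weight for the square of [Dg - h], small enough that [(f2 + e / 4) (1 + e2) <= f2 + e]. *)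
pose e2 := e / 2 / (f2 + e).
have f2e : 0 < f2 + e by rewrite ltr_wpDl.
have e20 : 0 < e2 by rewrite !divr_gt0.
pose c := `|f1 sig| * L1 + (f2 + e / 4) / 2 * ((1 + e2^-1) * L2 ^+ 2).
have ie2 : 0 <= 1 + e2^-1 by rewrite addr_ge0// invr_ge0 ltW.
have fe : 0 < f2 + e / 4 by rewrite ltr_wpDl.
have c0 : 0 <= c.
  rewrite addr_ge0//; first by rewrite mulr_ge0// ltW.
  by rewrite mulr_ge0 ?divr_ge0 ?(ltW fe)// mulr_ge0// sqr_ge0.
exists c, (Num.min (Num.min d1 d2) (Num.min (d / 2) (d / (2 * L2)))); split => //.
  by rewrite !lt_min d10 d20 !divr_gt0// mulr_gt0.
move=> t h; rewrite !lt_min => /andP[/andP[/T1 H1 /T2 H2] /andP[_ tL]] /andP[_ /andP[hd _]].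
set Dg := g t - g t0 in H1 H2 *; set th := t - t0 in H1 H2 tL *.
have Dgd : `|Dg| < d / 2.
  apply: le_lt_trans H2 _; move: tL; rewrite !ltr_pdivlMr// ?mulr_gt0//; lra.
have yd : `|sig + Dg - h - sig| < d.
  have -> : sig + Dg - h - sig = Dg - h by ring.
  by apply: le_lt_trans (ler_normB _ _) _; move: Dgd hd; lra.
have := Tf _ yd; have -> : sig + Dg - h - sig = Dg - h by ring.
have E1 : f1 sig * Dg <= f1 sig * g1 t0 * th + `|f1 sig| * L1 * th ^+ 2.
  have -> : f1 sig * Dg = f1 sig * g1 t0 * th + f1 sig * (Dg - g1 t0 * th) by ring.
  rewrite lerD2l; apply: le_trans (ler_norm _) _; rewrite normrM -mulrA ler_wpM2l//.
  by apply: le_trans H1 _; rewrite real_normK ?num_real.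
have Dg2 : Dg ^+ 2 <= L2 ^+ 2 * th ^+ 2.
  rewrite -[Dg ^+ 2]real_normK ?num_real// -[th ^+ 2]real_normK ?num_real// -exprMn.
  by rewrite lerXn2r ?nnegrE// mulr_ge0// ltW.
have E2 : (Dg - h) ^+ 2 <= (1 + e2) * h ^+ 2 + (1 + e2^-1) * (L2 ^+ 2 * th ^+ 2).
  apply: (@le_trans _ _ ((1 + e2) * h ^+ 2 + (1 + e2^-1) * Dg ^+ 2)); last first.
    by rewrite lerD2l ler_wpM2l.
  rewrite -subr_ge0.
  have -> : (1 + e2) * h ^+ 2 + (1 + e2^-1) * Dg ^+ 2 - (Dg - h) ^+ 2 = e2 * (h + e2^-1 * Dg) ^+ 2.
    by field; rewrite gt_eqF.
  by rewrite mulr_ge0 ?sqr_ge0// ltW.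
have fe2 : 0 <= (f2 + e / 4) / 2 by rewrite divr_ge0// ltW.
have E3 : (f2 + e / 4) / 2 * (Dg - h) ^+ 2 <= (f2 + e) / 2 * h ^+ 2 +
    (f2 + e / 4) / 2 * ((1 + e2^-1) * L2 ^+ 2) * th ^+ 2.
  apply: le_trans (ler_wpM2l fe2 E2) _; rewrite mulrDr; apply: lerD; last by rewrite !mulrA.
  rewrite mulrA ler_wpM2r ?sqr_ge0//.
  have : (f2 + e / 4) * e2 <= e / 2.
    rewrite /e2 mulrA ler_pdivrMr// mulrC ler_wpM2l ?divr_ge0 ?(ltW e0)// lerD2l.
    by move: e0; lra.
  by move: e0; lra.
by rewrite /c; move: E1 E3; lra.
Qed.

End upper_jet_comp.

Section comparison.
Context (R : realType) (N : nat) (p q : R) (u : R * 'rV[R]_N -> R).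
Hypotheses (N1 : (1 <= N)%N) (p1 : 1 < p) (usub : viscosity_subsolution p q u)
  (cu : {within [set z : R * 'rV[R]_N | 0 <= z.1], continuous u}).

(** A supporting hyperplane of the norm at [x0]: [e] points towards the origin, where the barrier
    increases, and any unit vector serves at [x0 = 0]. *)
Lemma enorm_unit (x0 : 'rV[R]_N) : exists e : 'rV[R]_N, \sum_(i < N) e ord0 i ^+ 2 = 1 /\
  forall x, enorm x0 - dot e x0 x <= enorm x.
Proof.
have [e' [e'1 e'x]] : exists e' : 'rV[R]_N, \sum_(i < N) e' ord0 i ^+ 2 = 1 /\ dot e' 0 x0 = enorm x0.
  have [x00|x00] := eqVneq (enorm x0) 0.
    exists (delta_mx ord0 (Ordinal N1)); split.
      rewrite (bigD1 (Ordinal N1))//= !mxE !eqxx /= expr1n big1 ?addr0// => j jN.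
      by rewrite mxE (negbTE jN) andbF expr0n.
    rewrite x00; have x0E : x0 = 0.
      by apply: sqd_eq0; rewrite -enorm_sub_sqr subr0 x00 expr0n.
    by rewrite x0E dotxx.
  exists ((enorm x0)^-1 *: x0).
  have E : \sum_(i < N) x0 ord0 i ^+ 2 = enorm x0 ^+ 2.
    by rewrite sqr_sqrtr// sumr_ge0// => i _; exact: sqr_ge0.
  split.
    rewrite (eq_bigr (fun i => enorm x0 ^- 2 * x0 ord0 i ^+ 2)); last first.
      by move=> i _; rewrite mxE exprMn exprVn.
    by rewrite -mulr_sumr E mulVf// expf_neq0.
  rewrite /dot (eq_bigr (fun i => (enorm x0)^-1 * x0 ord0 i ^+ 2)); last first.
    by move=> i _; rewrite !mxE subr0; ring.
  by rewrite -mulr_sumr E expr2 mulKf.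
exists (- e'); split; first by rewrite -e'1; apply: eq_bigr => i _; rewrite mxE sqrrN.
move=> x.
have -> : enorm x0 - dot (- e') x0 x = dot e' 0 x.
  rewrite -e'x /dot -sumrB; apply: eq_bigr => i _; rewrite !mxE; ring.
apply: le_trans (ler_norm _) _.
rewrite -(ler_pXn2r (n := 2))// ?nnegrE ?enorm_ge0// real_normK ?num_real//.
by rewrite -[x in enorm x]subr0 enorm_sub_sqr; exact: dot_sqr_le.
Qed.

Lemma continuous_enorm : continuous (@enorm R N).
Proof.
move=> x; have -> : @enorm R N = fun x => Num.sqrt (sqd 0 x).
  by apply/funext => y; rewrite -enorm_sub subr0.
by apply: (@continuous_comp _ _ _ (sqd 0) Num.sqrt); [exact: continuous_sqd|exact: sqrt_continuous].
Qed.

Variables (Q a K s T l : R) (g g1 g2 : R -> R).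
Hypotheses (a0 : 0 < a) (aQ : (a + 1) * (Q - p + 1) = 1) (K0 : 0 < K)
  (KQ : 2 * ((p - 1) * (a + 1)) <= (K * a) `^ (Q - p + 1)).
Hypotheses (s0 : 0 <= s) (ls : l < s)
  (g0 : forall t, l < t < T -> 0 < g t)
  (dg : forall t : R, l < t < T -> is_derive t 1 g (g1 t))
  (dg1 : forall t : R, l < t < T -> is_derive t 1 g1 (g2 t)).
Hypothesis Qq : q = Q \/ (q <= Q /\ forall t, s <= t < T -> K * a <= g t `^ (a + 1)).

Let barrier t (x : 'rV[R]_N) := K * (enorm x + g t) `^ (- a).

(* With [b = |grad W|], the choice of [a] gives [Delta_p W <= b^Q / 2]; the time derivative of the
   barrier is [- b g'], so that the bound on [g'] leaves half of [b^Q] to absorb it. *)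
Lemma comparison :
  (forall t x, s < t < T -> barrier t x < u (t, x) ->
     2 * g1 t <= (K * a) `^ (Q - 1) * (enorm x + g t) `^ ((1 - Q) * (a + 1))) ->
  (forall x, u (s, x) <= barrier s x) ->
  (forall eps, 0 < eps -> exists D, forall t x, s <= t < T -> D <= sqd 0 x -> u (t, x) <= eps) ->
  forall t x, s <= t < T -> u (t, x) <= barrier t x.
Proof.
move=> Hg init dec t1 x1 st1.
rewrite leNgt; apply/negP => bad.
(* Half of the gap is added to the barrier, so that the decay of [u] at infinity gives the lateral
   inequality on a large ball. *)
pose eps := (u (t1, x1) - barrier t1 x1) / 2.
have eps0 : 0 < eps by rewrite divr_gt0// subr_gt0.
have bar0 t x : 0 <= barrier t x by rewrite mulr_ge0 ?powR_ge0// ltW.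
pose W (z : R * 'rV[R]_N) := eps + barrier z.1 z.2.
have [D' HD'] := dec eps eps0.
pose D := Num.max D' (sqd 0 x1).
have D'D : D' <= D by rewrite le_max lexx.
have x1D : sqd 0 x1 <= D by rewrite le_max lexx orbT.
have W0 t x : s <= t < T -> sqd 0 x <= D -> 0 <= W (t, x).
  by move=> _ _; rewrite addr_ge0// ltW.
have initW x : sqd 0 x <= D -> u (s, x) <= W (s, x).
  by move=> _; apply: le_trans (init x) _; rewrite /W /= lerDr ltW.
have lateral t x : s <= t < T -> D' <= sqd 0 x <= D -> u (t, x) <= W (t, x).
  by move=> st /andP[/(HD' t x st) ux _]; apply: le_trans ux _; rewrite /W /= lerDl.
have cW t : t < T -> {within cylinder s t 0 D, continuous W}.
  move=> tT; apply: continuous_in_subspaceT => z; rewrite inE => -[/andP[sz zt] _].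
  have lz : l < z.1 < T by rewrite (lt_le_trans ls sz) (le_lt_trans zt).
  apply: cvgD; first exact: cvg_cst.
  apply: cvgM; first exact: cvg_cst.
  have := @continuous_comp _ _ _ (fun z : R * 'rV[R]_N => enorm z.2 + g z.1) (fun y : R => y `^ (- a)) z; apply.
    apply: cvgD.
      by apply: (@continuous_comp _ _ _ (@snd R 'rV[R]_N) (@enorm R N)); [exact: cvg_snd|exact: continuous_enorm].
    apply: (@continuous_comp _ _ _ (@fst R 'rV[R]_N) g); first exact: cvg_fst.
    have [Dg _] := dg lz.
    exact/differentiable_continuous/derivable1_diffP.
  have sg : 0 < enorm z.2 + g z.1 by rewrite ltr_wpDl ?enorm_ge0// g0.
  have [Dp _] := is_derive1_powR (- a) sg.
  exact/differentiable_continuous/derivable1_diffP.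
have Wu : W (t1, x1) < u (t1, x1) by rewrite /W /=; move: bad; rewrite /eps; lra.
have [eta [t0 [x0 [delta [eta0 delta0 /andP[t0s t0T] _ [Wu0 touch]]]]]] :=
  first_contact cu s0 D'D cW W0 initW lateral st1 x1D Wu.
have lt0 : l < t0 < T by rewrite (lt_trans ls t0s).
have [e [e1 He]] := enorm_unit x0.
pose sig := enorm x0 + g t0.
have sig0 : 0 < sig by rewrite ltr_wpDl ?enorm_ge0// g0.
(* The barrier as a function of [y = |x| + g], later evaluated on a linear lower bound of [|x|],
   which lies above the barrier since [f] decreases. *)
pose f y := K * y `^ (- a).
pose f1 y := K * (- a * y `^ (- a - 1)).
pose f2 := K * (- a * ((- a - 1) * sig `^ (- a - 1 - 1))).
have df (y : R) : `|y - sig| < sig -> is_derive y 1 f (f1 y).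
  rewrite ltr_norml => /andP[ys _]; have y0 : 0 < y by move: ys; lra.
  exact: (is_derive_cmulf K (is_derive1_powR (- a) y0)).
have df1 : is_derive sig 1 f1 f2.
  exact: (is_derive_cmulf K (is_derive_cmulf (- a) (is_derive1_powR (- a - 1) sig0))).
pose b := K * a * sig `^ (- (a + 1)).
have bE : - f1 sig = b by rewrite /f1 /b opprD; ring.
have b0 : 0 < b by rewrite !mulr_gt0// powR_gt0.
have f2E : f2 = b * (a + 1) / sig.
  rewrite /f2 /b opprD -[X in _ = _ * _ / X]powRr1 ?(ltW sig0)// -powRN.
  have -> : sig `^ (- a - 1 - 1) = sig `^ (- a - 1) * sig `^ (- 1).
    by rewrite -powRD// (gt_eqF sig0) implybT.
  by ring.
have f20 : 0 <= f2 by rewrite f2E divr_ge0 ?(ltW sig0)// mulr_ge0 ?(ltW b0)// addr_ge0// ltW.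
pose r' := Num.min (t0 - l) (T - t0).
have r'0 : 0 < r' by case/andP: lt0 => lt0 _; rewrite lt_min !subr_gt0 lt0.
have near_lT t : `|t - t0| < r' -> l < t < T.
  rewrite lt_min !ltr_norml => /andP[/andP[lt _] /andP[_ tT]].
  by apply/andP; split; move: lt tT; lra.
have dg' (t : R) : `|t - t0| < r' -> is_derive t 1 g (g1 t) by move=> /near_lT/dg.
have jet := upper_jet_penalty eta t0T (upper_jet_comp sig0 r'0 f20 df df1 dg' (dg1 lt0)).
have [d [L [d0 L0 HL]]] := is_derive_lipschitz (dg lt0).
pose c := Num.min d (Num.min (sig / 4) (sig / (4 * L))).
have c0 : 0 < c by rewrite !lt_min d0 !divr_gt0// mulr_gt0.
pose del := Num.min delta (c ^+ 2).
have del0 : 0 < del by rewrite lt_min delta0 exprn_gt0.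
have loc t x : 0 < t -> (t - t0) ^+ 2 < del -> sqd x0 x < del ->
    u (t, x) <= u (t0, x0) + (fun t h => f (sig + (g t - g t0) - h) - f sig +
      (eta / (T - t) - eta / (T - t0))) t (1 * dot e x0 x + 0 * sqd x0 x).
  move=> _; rewrite !lt_min => /andP[td tc] /andP[xd xc].
  have [_ _ _ H] := touch t x td xd; apply: le_trans H _.
  rewrite mul1r mul0r addr0 -addrA lerD2l lerD2r.
  have {}tc : `|t - t0| < c.
    by rewrite -(ltr_pXn2r (n := 2))// ?nnegrE ?(ltW c0)// real_normK ?num_real.
  have sc : `|dot e x0 x| < c.
    rewrite -(ltr_pXn2r (n := 2))// ?nnegrE ?(ltW c0)// real_normK ?num_real//.
    exact: le_lt_trans (dot_sqr_le x0 x e1) xc.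
  move: tc sc; rewrite !lt_min => /and3P[td' _ tL] /and3P[_ ss _].
  have := HL t td' => gL.
  have : L * `|t - t0| < sig / 4 by move: tL; rewrite !ltr_pdivlMr ?mulr_gt0//; lra.
  move: gL ss; rewrite !ler_norml !ltr_norml => /andP[gl _] /andP[_ sr] tL'.
  have base0 : 0 < sig + (g t - g t0) - dot e x0 x by move: gl sr tL'; move: sig0; lra.
  have bb : sig + (g t - g t0) - dot e x0 x <= enorm x + g t.
    by have := He x; rewrite /sig; lra.
  have : barrier t x <= f (sig + (g t - g t0) - dot e x0 x).
    rewrite /barrier /f ler_pM2l// !powRN lef_pV2 ?posrE ?powR_gt0// ?(lt_le_trans base0 bb)//.
    by apply: ge0_ler_powR; rewrite ?(ltW a0)// nnegrE ltW// (lt_le_trans base0 bb).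
  by rewrite /W /= /f -/(barrier t0 x0) /barrier -/sig; lra.
have bN0 : 0 < - f1 sig by rewrite bE.
have t00 : 0 < t0 := le_lt_trans s0 t0s.
have := test_upper_jet N1 p1 usub cu t00 del0 e1 bN0 f20 ltr01 (lexx 0) jet loc.
have f1E : f1 sig = - b by rewrite -bE opprK.
rewrite bE f1E mulr1 expr1n mulr1 !mulr0 addr0 f2E => HH.
have eT : 0 < eta / (T - t0) ^+ 2 by rewrite divr_gt0// exprn_gt0// subr_gt0.
have sb : barrier t0 x0 < u (t0, x0) by move: Wu0; rewrite /W /=; move: eps0; lra.
have := Hg t0 x0 (introT andP (conj t0s t0T)) sb; rewrite -/sig => g1le.
have Ka0 : 0 < K * a by rewrite mulr_gt0.
have powb y : b `^ y = (K * a) `^ y * sig `^ (- (a + 1) * y).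
  by rewrite /b powRM ?(ltW Ka0) ?powR_ge0// -powRrM.
have bD y z : b `^ (y + z) = b `^ y * b `^ z by rewrite powRD// (gt_eqF b0) implybT.
(* By [aQ], [b^(Q - p + 1)] equals [(K a)^(Q - p + 1) / sig], so this is the hypothesis [KQ]. *)
have E1 : 2 * (b `^ (p - 2) * ((p - 1) * (b * (a + 1) / sig))) <= b `^ Q.
  have -> : Q = (p - 1) + (Q - p + 1) by ring.
  rewrite (bD (p - 1)) (powb (Q - p + 1)) mulNr aQ powRN powRr1 ?(ltW sig0)//.
  have -> : b `^ (p - 1) = b `^ (p - 2) * b.
    by rewrite -[X in _ * X]powRr1 ?(ltW b0)// -bD; congr (_ `^ _); ring.
  rewrite [leLHS](_ : _ = (b `^ (p - 2) * b / sig) * (2 * ((p - 1) * (a + 1)))); last by ring.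
  rewrite [leRHS](_ : _ = (b `^ (p - 2) * b / sig) * (K * a) `^ (Q - p + 1)); last by ring.
  by rewrite ler_pM2l// divr_gt0// mulr_gt0// powR_gt0.
have E2 : 2 * (b * g1 t0) <= b `^ Q.
  have -> : Q = 1 + (Q - 1) by ring.
  rewrite (bD 1) powRr1 ?(ltW b0)// mulrCA ler_pM2l// (powb (Q - 1)).
  by have -> : - (a + 1) * (Q - 1) = (1 - Q) * (a + 1) by ring.
have E3 : b `^ Q <= b `^ q.
  case: Qq => [->//|[qQ Hgt]]; apply: ger_powR => //; rewrite b0 /=.
  rewrite /b powRN ler_pdivrMr ?powR_gt0// mul1r.
  have := Hgt t0; rewrite (ltW t0s) t0T => /(_ isT) H; apply: le_trans H _.
  apply: ge0_ler_powR; rewrite ?addr_ge0 ?(ltW a0)// ?nnegrE ?(ltW sig0) ?(ltW (g0 lt0))//.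
  by rewrite /sig lerDr enorm_ge0.
(* Diffusion and the motion of [g] each cost at most half of [b^Q], hence at most [b^q] together,
   and the positive penalty slope gives the contradiction. *)
by move: HH E1 E2 E3 eT; lra.
Qed.

End comparison.

(** * Norms *)

Section integral_majorant.
Context (R : realType).
Local Open Scope ereal_scope.

(* Neither function has to be measurable. *)
Lemma ge0_le_integralT d (T : measurableType d) (mu : {measure set T -> \bar R}) (f g : T -> \bar R) :
  (forall x, 0 <= f x) -> (forall x, f x <= g x) -> \int[mu]_x f x <= \int[mu]_x g x.
Proof.
move=> f0 fg; have g0 x : 0 <= g x by exact: le_trans (f0 x) (fg x).
rewrite !ge0_integralTE//; apply: le_ereal_sup => _ [h hf <-]; exists h => // x.
exact: le_trans (hf x) (fg x).
Qed.

Lemma sigma_finite_lebesgue_rV n : sigma_finite setT (lebesgue_rV R n).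
Proof.
pose I (k : nat) : set (measurableTypeR R) := [set` `](- (k%:R : R))%R, (k%:R : R)[].
pose F (k : nat) := [set x : 'rV[R]_n | forall i, I k (x ord0 i)].
have mI k : measurable (I k) by exact: measurable_itv.
exists F => [|k].
  apply/seteqP; split => // x _.
  exists (Num.truncn (\sum_(i < n) `|x ord0 i|)%R).+1 => // i; rewrite /I /=.
  rewrite in_itv /= -ltr_norml; apply: le_lt_trans (truncnS_gt _).
  by rewrite (bigD1 i)//= lerDl sumr_ge0.
split.
  rewrite (_ : F k = \bigcap_(i in [set: 'I_n])
      ((fun x : 'rV[R]_n => x ord0 i : measurableTypeR R) @^-1` I k)).
    apply: fin_bigcap_measurable => // i _.
    by rewrite -[X in measurable X]setTI; exact: measurable_coord_rV.
  by apply/seteqP; split => x /= Bx i => [_|]; exact: Bx.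
rewrite (lebesgue_rV_box (A := fun=> I k))//.
suff : (\prod_(i < n) lebesgue_measure (I k)) \is a fin_num by rewrite fin_numE => /andP[_]; rewrite ltey.
apply: (big_ind (fun y => y \is a fin_num)) => // [x y|i _]; first exact: fin_numM.
by rewrite lebesgue_measure_itv /=; case: ifPn.
Qed.

(** A copy of the same measure that carries the sigma-finite structure used by Tonelli's theorem. *)
Definition lebesgue_rV_sf n : set 'rV[R]_n -> \bar R := lebesgue_rV R n.
Arguments lebesgue_rV_sf : clear implicits.

HB.instance Definition _ n := isMeasure.Build _ _ _ (lebesgue_rV_sf n)
  (measure0 (lebesgue_rV R n)) (measure_ge0 (lebesgue_rV R n))
  (@measure_semi_sigma_additive _ _ _ (lebesgue_rV R n)).

HB.instance Definition _ n := Measure_isSigmaFinite.Build _ _ _ (lebesgue_rV_sf n)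
  (sigma_finite_lebesgue_rV n).

Lemma measurable_prod_rV n (f : R -> R) : measurable_fun setT f ->
  measurable_fun setT (fun x : 'rV[R]_n => (\prod_(i < n) f (x ord0 i))%R).
Proof.
move=> mf; apply: measurable_prod => i _.
exact: (measurableT_comp mf (measurable_coord_rV i)).
Qed.

Lemma integral_prod_rV n (f : R -> R) (c : R) : (forall x, 0 <= f x)%R -> measurable_fun setT f ->
  \int[lebesgue_measure]_x (f x)%:E = c%:E ->
  \int[lebesgue_rV R n]_x (\prod_(i < n) f (x ord0 i))%:E = (c ^+ n)%:E.
Proof.
move=> f0 mf fc; elim: n => [|n IH].
  rewrite /= integral_dirac//; last by apply/measurable_EFinP; exact: measurable_prod_rV.
  by rewrite diracT mul1e big_ord0 expr0.
have P0 m (x : 'rV[R]_m) : (0 <= \prod_(i < m) f (x ord0 i))%R by apply: prodr_ge0.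
rewrite /= ge0_integral_pushforward//=; last 3 first.
- exact: measurable_cons_rV.
- by apply/measurable_EFinP; exact: measurable_prod_rV.
- by move=> x _; rewrite lee_fin P0.
rewrite preimage_setT.
pose h (z : measurableTypeR R * 'rV[R]_n) := (f z.1 * \prod_(i < n) f (z.2 ord0 i))%:E.
transitivity (\int[(@lebesgue_measure R) \x^ (lebesgue_rV_sf n)]_z h z).
  apply: eq_integral => z _; rewrite /h /= big_ord_recl cons_rV0.
  by congr (_ * _)%:E; apply: eq_bigr => i _; rewrite cons_rVS.
have mh : measurable_fun setT h.
  apply/measurable_EFinP/measurable_funM.
    exact: (measurableT_comp mf measurable_fst).
  have ms : measurable_fun setT (@snd (measurableTypeR R) 'rV[R]_n) by exact: measurable_snd.
  exact: (measurableT_comp (measurable_prod_rV mf) ms).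
have h0 z : 0 <= h z by rewrite lee_fin mulr_ge0// P0.
have c0 : (0 <= c)%R by rewrite -lee_fin -fc integral_ge0// => x _; rewrite lee_fin.
(* The recursive definition uses [\x^] while Tonelli is applied to [\x]; they agree on rectangles,
   hence everywhere. *)
transitivity (\int[(@lebesgue_measure R) \x (lebesgue_rV_sf n)]_z h z).
  apply: eq_measure_integral => /= A mA _; apply/esym.
  by apply: product_measure_unique => //= *; rewrite product_measure2E.
rewrite (fubini_tonelli2 h)//.
transitivity (\int[lebesgue_rV R n]_x (c%:E * (\prod_(i < n) f (x ord0 i))%:E)).
  apply: eq_integral => x _; rewrite /fubini_G /h /=.
  under eq_integral do rewrite EFinM muleC.
  rewrite ge0_integralZl//; last 3 first.
  - exact/measurable_EFinP.
  - by move=> y _; rewrite lee_fin.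
  - by rewrite lee_fin P0.
  by rewrite fc muleC.
rewrite ge0_integralZl//; last 2 first.
- by apply/measurable_EFinP; exact: measurable_prod_rV.
- by move=> y _; rewrite lee_fin P0.
by rewrite IH -EFinM exprS.
Qed.

Lemma powR_cvgy0 (d : R) : (0 < d)%R -> (x `^ (- d))%R @[x --> +oo%R] --> (0 : R)%R.
Proof.
move=> d0; apply/cvgrPdist_lt => e e0; near=> x.
rewrite sub0r normrN ger0_norm ?powR_ge0//.
have x0 : (0 < x)%R by near: x; exact: nbhs_pinfty_gt.
have xe : (e `^ (- d^-1) < x)%R by near: x; apply: nbhs_pinfty_gt; rewrite realE powR_ge0.
have ed0 : (0 < e `^ (- d^-1))%R by exact: powR_gt0.
have -> : e = ((e `^ (- d^-1)) `^ (- d))%R.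
  by rewrite -powRrM mulrNN mulVf ?gt_eqF// powRr1// ltW.
rewrite (powRN x) (powRN (e `^ _)%R) ltf_pV2 ?posrE ?powR_gt0//.
by apply: gt0_ltr_powR => //; rewrite nnegrE ltW.
Unshelve. all: by end_near. Qed.

Lemma integral_power_decay (r g : R) : (1 < r)%R -> (0 < g)%R ->
  \int[lebesgue_measure]_x ((`|x| + g) `^ (- r))%:E = (2 * (g `^ (1 - r) / (r - 1)))%:E.
Proof.
move=> r1 g0.
have base0 (x : R) : (0 < `|x| + g)%R by rewrite ltr_wpDl.
have cpow (y : R) : (0 < y)%R -> {for y, continuous (fun y : R => y `^ (- r))%R}.
  move=> y0; have [D _] := is_derive1_powR (- r) y0.
  exact/differentiable_continuous/derivable1_diffP.
have cf : continuous (fun x : R => (`|x| + g) `^ (- r))%R.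
  move=> x; have := @continuous_comp R R R (fun x => `|x| + g)%R (fun y : R => y `^ (- r))%R x; apply.
    by apply: cvgD; [exact: norm_continuous|exact: cvg_cst].
  exact: cpow.
rewrite ge0_symfun_integralT; last 3 first.
- by move=> x; exact: powR_ge0.
- exact: cf.
- by move=> x /=; rewrite normrN.
rewrite -set_itvcy EFinM; congr (_ * _).
have gN : (- g < 0)%R by rewrite oppr_lt0.
have r10 : (r - 1 != 0)%R by rewrite subr_eq0 gt_eqF.
pose F (x : R) := (- ((x + g) `^ (1 - r) / (r - 1)))%R.
have dF (x : R) : (- g < x)%R -> is_derive x (1%R : R) F ((x + g) `^ (- r))%R.
  move=> xg; have xg0 : (0 < x + g)%R by rewrite -ltrBlDr sub0r.
  have d1 : is_derive x (1%R : R) (fun x => x + g)%R 1%R by exact: (is_derive_shift x 1%R g).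
  have d2 := is_derive_comp_real d1 (is_derive1_powR (1 - r) xg0).
  have d3 : is_derive x (1%R : R) F _ := is_deriveN (is_derive_mulf d2 (is_derive_fun_cst (r - 1)^-1%R x (1%R : R))).
  apply: (is_derive_eq d3); rewrite (_ : (1 - r - 1 = - r)%R); last by ring.
  by rewrite mulr0 add0r mulr1; field.
have -> : (g `^ (1 - r) / (r - 1))%:E = 0%:E - (F 0)%:E.
  by rewrite -EFinB /F sub0r opprK add0r.
transitivity (\int[lebesgue_measure]_(x in `[0%R, +oo[) ((x + g) `^ (- r))%:E).
  by apply: eq_integral => x; rewrite inE /= in_itv /= andbT => x0; rewrite ger0_norm.
apply: ge0_continuous_FTC2y.
- by move=> x _; exact: powR_ge0.
- apply: continuous_in_subspaceT => x; rewrite inE /= in_itv /= andbT => x0.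
  have := @continuous_comp R R R (fun x => x + g)%R (fun y : R => y `^ (- r))%R x; apply.
    by apply: cvgD; [exact: cvg_id|exact: cvg_cst].
  by apply: cpow; rewrite ltr_wpDl.
- rewrite -oppr0 -[X in (- X)%R](mul0r (r - 1)^-1%R); apply: cvgN; apply: cvgM; last exact: cvg_cst.
  rewrite (_ : (1 - r = - (r - 1))%R); last by ring.
  have d0 : (0 < r - 1)%R by rewrite subr_gt0.
  have Z := powR_cvgy0 d0.
  by rewrite -(cvg_shiftr g) in Z.
- by move=> x x0; have [] := dF x (lt_trans gN x0).
- have [D _] := dF 0%R gN.
  apply: cvg_at_right_filter.
  exact/differentiable_continuous/derivable1_diffP.
- move=> x; rewrite in_itv /= andbT => x0; rewrite derive1E.
  by have [_ ->] := dF x (lt_trans gN x0).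
Qed.

(** Sharing the exponent equally among the coordinates replaces polar coordinates by a product of
    one-dimensional integrals, which converge as soon as [a / n > 1]. *)
Lemma power_le_prod n (a g : R) (x : 'rV[R]_n) : (0 < n)%N -> (0 < a)%R -> (0 < g)%R ->
  ((enorm x + g) `^ (- a) <= \prod_(i < n) (`|x ord0 i| + g) `^ (- (a / n%:R)))%R.
Proof.
move=> n0 a0 g0.
have an : (0 < a / n%:R)%R by rewrite divr_gt0// ltr0n.
have -> : ((enorm x + g) `^ (- a) = \prod_(i < n) (enorm x + g) `^ (- (a / n%:R)))%R.
  rewrite prodr_const card_ord -powR_mulrn ?powR_ge0// -powRrM; congr (_ `^ _)%R.
  by field; rewrite pnatr_eq0 -lt0n.
apply: ler_prod => i _; rewrite powR_ge0 /=.
have e0 : (0 < enorm x + g)%R by rewrite ltr_wpDl// enorm_ge0.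
have i0 : (0 < `|x ord0 i| + g)%R by rewrite ltr_wpDl.
rewrite !(powRN _ (a / n%:R)) lef_pV2 ?posrE ?powR_gt0//.
by apply: ge0_ler_powR; rewrite ?(ltW an) ?nnegrE ?(ltW e0) ?(ltW i0)// lerD2r coord_le_enorm.
Qed.

Definition decay_mass n (a : R) : R := ((2 / (a / n%:R - 1)) ^+ n)%R.

Lemma integral_le_mass n (a g K : R) (f : 'rV[R]_n -> R) : (0 < n)%N -> (n%:R < a)%R -> (0 < g)%R ->
  (0 <= K)%R -> (forall x, 0 <= f x <= K * (enorm x + g) `^ (- a))%R ->
  \int[lebesgue_rV R n]_x `|(f x)%:E| <= (K * (decay_mass n a * g `^ (n%:R - a)))%:E.
Proof.
move=> n0 na g0 K0 fK.
have n0' : (0 < n%:R :> R)%R by rewrite ltr0n.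
have a0 : (0 < a)%R by apply: le_lt_trans na.
have an : (1 < a / n%:R)%R by rewrite ltr_pdivlMr// mul1r.
pose h (y : R) := ((`|y| + g) `^ (- (a / n%:R)))%R.
have mh : measurable_fun setT h.
  apply: (measurableT_comp (measurable_powR _)).
  apply: continuous_measurable_fun => y.
  by apply: cvgD; [exact: norm_continuous|exact: cvg_cst].
have h0 y : (0 <= h y)%R by exact: powR_ge0.
have := integral_prod_rV n h0 mh (integral_power_decay an g0) => Ih.
have P0 (x : 'rV[R]_n) : (0 <= \prod_(i < n) h (x ord0 i))%R by apply: prodr_ge0.
apply: (@le_trans _ _ (\int[lebesgue_rV R n]_x (K%:E * (\prod_(i < n) h (x ord0 i))%:E))).
  apply: ge0_le_integralT => x; first exact: abse_ge0.
  have /andP[fx0 fxK] := fK x.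
  rewrite /= lee_fin ger0_norm//; apply: le_trans fxK _.
  by apply: ler_wpM2l => //; exact: power_le_prod.
rewrite ge0_integralZl//; last 2 first.
- by apply/measurable_EFinP; exact: measurable_prod_rV.
- by move=> y _; rewrite lee_fin P0.
rewrite Ih -EFinM lee_fin ler_wpM2l// /decay_mass le_eqVlt; apply/orP; left; apply/eqP.
rewrite [(2 * _)%R](_ : _ = 2 / (a / n%:R - 1) * g `^ (1 - a / n%:R))%R; last by ring.
rewrite exprMn; congr (_ * _)%R.
rewrite -powR_mulrn ?powR_ge0// -powRrM; congr (_ `^ _)%R.
by field; rewrite gt_eqF.
Qed.

End integral_majorant.

Section norms.
Context (R : realType) (N : nat) (u : R * 'rV[R]_N -> R) (t a g K : R).
Hypotheses (N0 : (0 < N)%N) (g0 : 0 < g) (K0 : 0 <= K)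
  (uK : forall x, 0 <= u (t, x) <= K * (enorm x + g) `^ (- a)).

Lemma norm1_le : N%:R < a -> (norm1 u t <= (K * (decay_mass N a * g `^ (N%:R - a)))%:E)%E.
Proof.
by move=> Na; rewrite /norm1 Lnorm1; apply: (integral_le_mass (f := fun x => u (t, x))).
Qed.

Lemma normoo_le : 0 < a -> (normoo u t <= (K * g `^ (- a))%:E)%E.
Proof.
(* The branch treated first is the convention that the norm is 0 when the whole space is null. *)
move=> a0; rewrite /normoo unlock /Lnorm; case: ifPn => [_|_]; last first.
  by rewrite lee_fin mulr_ge0 ?powR_ge0.
apply/ess_supP; apply: nearW => x /=.
have /andP[ux0 uxK] := uK x; rewrite lee_fin ger0_norm//; apply: le_trans uxK _.
have e0 : 0 < enorm x + g by rewrite ltr_wpDl// enorm_ge0.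
rewrite ler_wpM2l// !powRN lef_pV2 ?posrE ?powR_gt0//.
by apply: ge0_ler_powR; rewrite ?(ltW a0) ?nnegrE ?(ltW e0) ?(ltW g0)// lerDr enorm_ge0.
Qed.

End norms.

(** * Barriers above a solution of the Cauchy problem *)

Section solution_barriers.
Context (R : realType) (N : nat) (p q : R) (u0 : 'rV[R]_N -> R).
Hypotheses (N1 : (1 <= N)%N) (p1 : 1 < p) (p2 : p < 2).
Variables (C0 Q a : R).
Hypotheses (C00 : 0 < C0) (a0 : 0 < a) (Qp : 0 < Q - p + 1) (aQ : (a + 1) * (Q - p + 1) = 1)
  (u0C : decay_bound u0 C0 a).

Lemma powRN_le (b x y : R) : 0 <= b -> 0 < x -> x <= y -> y `^ (- b) <= x `^ (- b).
Proof.
move=> b0 x0 xy; have y0 := lt_le_trans x0 xy.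
rewrite !powRN lef_pV2 ?posrE ?powR_gt0//.
by apply: ge0_ler_powR => //; rewrite nnegrE ltW.
Qed.

(** A bound at every point: continuity of a solution at time 0 gives it on the unit ball, the decay
    hypothesis outside. *)
Lemma initial_bounded (u : R * 'rV[R]_N -> R) : nonneg_cauchy_solution p q u0 u ->
  exists2 M0, 0 < M0 & forall x, u0 x <= M0.
Proof.
move=> [_ cu u00 _]; have [K HK] := cylinder_bounded 0 0 1 cu.
exists (`|K| + C0); first by rewrite ltr_wpDl.
move=> x; have [x1|x1] := leP (sqd 0 x) 1.
  have := HK (0, x); rewrite /cylinder /= lexx => /(_ (conj isT x1)); rewrite u00.
  by have := ler_norm K; move: C00; lra.
have e1 : 1 < enorm x.
  by rewrite -(ltr_pXn2r (n := 2))// ?nnegrE ?enorm_ge0// expr1n -[x]subr0 enorm_sub_sqr.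
have xN0 : x != 0.
  by apply: contraTneq x1 => ->; rewrite sqdxx -leNgt ler01.
apply: le_trans (u0C xN0) _.
have : enorm x `^ (- a) <= 1.
  by have := powRN_le (ltW a0) ltr01 (ltW e1); rewrite powR1.
by have := normr_ge0 K; move: C00; nra.
Qed.

Lemma initial_le_barrier M0 g0 K x : (forall x, u0 x <= M0) -> 0 < M0 -> 0 < g0 ->
  2 `^ a * C0 <= K -> 2 `^ a * M0 * g0 `^ a <= K -> u0 x <= K * (enorm x + g0) `^ (- a).
Proof.
move=> uM M00 g00 K1 K2.
have e0 := enorm_ge0 x.
have s0 : 0 < enorm x + g0 by rewrite ltr_wpDl.
have two (y : R) : 0 < y -> (2 * y) `^ (- a) * 2 `^ a = y `^ (- a).
  move=> y0; rewrite powRM ?(ltW y0)// mulrAC -powRD; last by rewrite pnatr_eq0 implybT.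
  by rewrite addNr powRr0 mul1r.
have [xg|gx] := ltP (enorm x) g0.
  have : (2 * g0) `^ (- a) <= (enorm x + g0) `^ (- a).
    by apply: powRN_le (ltW a0) s0 _; rewrite mulr2n mulrDl mul1r lerD2r ltW.
  have g0a : g0 `^ (- a) * g0 `^ a = 1.
    by rewrite -powRD; [rewrite addNr powRr0|rewrite (gt_eqF g00) implybT].
  move=> H; apply: le_trans (uM x) _.
  have -> : M0 = 2 `^ a * M0 * g0 `^ a * (2 * g0) `^ (- a).
    transitivity (M0 * (g0 `^ a * ((2 * g0) `^ (- a) * 2 `^ a))); last by ring.
    by rewrite two// [g0 `^ a * _]mulrC g0a mulr1.
  by apply: ler_pM => //; rewrite ?powR_ge0// mulr_ge0 ?powR_ge0// mulr_ge0 ?powR_ge0// ltW.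
have x0 : 0 < enorm x by exact: lt_le_trans gx.
have xN0 : x != 0.
  by apply: contraTneq x0 => ->; rewrite -leNgt -[X in enorm X](subrr (0 : 'rV[R]_N)) enorm_sub sqdxx sqrtr0.
apply: le_trans (u0C xN0) _.
have : (2 * enorm x) `^ (- a) <= (enorm x + g0) `^ (- a).
  by apply: powRN_le (ltW a0) s0 _; move: gx; lra.
move=> H; rewrite -two// [leLHS](_ : _ = 2 `^ a * C0 * (2 * enorm x) `^ (- a)); last by ring.
by apply: ler_pM => //; rewrite ?powR_ge0// mulr_ge0 ?powR_ge0// ltW.
Qed.

(** The [K] for which [(K a)^(Q - p + 1) = 2 (p - 1) (a + 1)], as [Q - p + 1 = 1 / (a + 1)]. *)
Definition barrier_threshold : R := (2 * ((p - 1) * (a + 1))) `^ (a + 1) / a.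

Lemma barrier_threshold_gt0 : 0 < barrier_threshold.
Proof.
by rewrite divr_gt0// powR_gt0// mulr_gt0// mulr_gt0 ?subr_gt0// addr_gt0.
Qed.

Lemma barrier_thresholdP K : barrier_threshold <= K ->
  2 * ((p - 1) * (a + 1)) <= (K * a) `^ (Q - p + 1).
Proof.
move=> KT; have c0 : 0 < 2 * ((p - 1) * (a + 1)) by rewrite mulr_gt0// mulr_gt0 ?subr_gt0// addr_gt0.
have -> : 2 * ((p - 1) * (a + 1)) = (barrier_threshold * a) `^ (Q - p + 1).
  by rewrite /barrier_threshold divfK ?gt_eqF// -powRrM aQ powRr1// ltW.
have T0 := barrier_threshold_gt0.
apply: ge0_ler_powR; rewrite ?(ltW Qp)// ?nnegrE ?ler_pM2r//.
- by rewrite mulr_ge0 ?ltW.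
- by rewrite mulr_ge0 ?(ltW a0)// (le_trans (ltW T0)).
Qed.

Lemma decay_bound_decay eps : 0 < eps -> exists D, forall x, D <= sqd 0 x -> u0 x <= eps.
Proof.
move=> eps0; pose d := (C0 / eps) `^ a^-1.
have d0 : 0 < d by rewrite powR_gt0// divr_gt0.
exists (d ^+ 2) => x; rewrite -enorm_sub_sqr subr0 => dx.
have {}dx : d <= enorm x.
  by rewrite -(ler_pXn2r (n := 2))// ?nnegrE ?enorm_ge0// ltW.
have xN0 : x != 0.
  apply: contraTneq (lt_le_trans d0 dx) => ->.
  by rewrite -leNgt -[X in enorm X](subrr (0 : 'rV[R]_N)) enorm_sub sqdxx sqrtr0.
apply: le_trans (u0C xN0) _.
have : C0 * enorm x `^ (- a) <= C0 * d `^ (- a).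
  by rewrite ler_pM2l//; exact: powRN_le (ltW a0) d0 dx.
move=> H; apply: le_trans H _.
have ce0 : 0 <= C0 / eps by rewrite divr_ge0 ?ltW.
rewrite /d -powRrM mulrN mulVf ?gt_eqF// powR_inv1//.
by rewrite invf_div mulrCA mulfV ?mulr1// gt_eqF.
Qed.

Variable u : R * 'rV[R]_N -> R.
Hypothesis sol : nonneg_cauchy_solution p q u0 u.

Lemma solution_barrier (K s T l : R) (g g1 g2 : R -> R) : barrier_threshold <= K ->
  0 <= s -> l < s -> (forall t, l < t < T -> 0 < g t) ->
  (forall t : R, l < t < T -> is_derive t 1 g (g1 t)) ->
  (forall t : R, l < t < T -> is_derive t 1 g1 (g2 t)) ->
  q = Q \/ (q <= Q /\ forall t, s <= t < T -> K * a <= g t `^ (a + 1)) ->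
  (forall t x, s < t < T -> K * (enorm x + g t) `^ (- a) < u (t, x) ->
     2 * g1 t <= (K * a) `^ (Q - 1) * (enorm x + g t) `^ ((1 - Q) * (a + 1))) ->
  (forall x, u (s, x) <= K * (enorm x + g s) `^ (- a)) ->
  forall t x, s <= t < T -> u (t, x) <= K * (enorm x + g t) `^ (- a).
Proof.
move=> KT s0 ls g0 dg dg1 Qq Hg init t x stT.
have [[_ usub _] cu u00 _] := sol.
have K0 : 0 < K := lt_le_trans barrier_threshold_gt0 KT.
have KP := barrier_thresholdP KT.
apply: (comparison N1 p1 usub cu a0 aQ K0 KP s0 ls g0 dg dg1 Qq Hg) => //.
move=> eps eps0.
have T0 : 0 < T.
  by case/andP: stT => st tT; exact: le_lt_trans (le_trans s0 st) tT.
have dec e : 0 < e -> exists D, forall x, D <= sqd 0 x -> u (0, x) <= e.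
  by move=> /decay_bound_decay[D HD]; exists D => y /HD; rewrite u00.
have [D HD] := decay_at_infinity N1 p1 p2 usub cu dec eps0 T0.
exists D => t' x' /andP[st' t'T]; apply: HD; by rewrite t'T (le_trans s0 st').
Qed.

(** For constant [g] the condition on [g'] is trivial, so a bound valid at one time persists
    forever. *)
Lemma stationary_barrier (K g0 s : R) : barrier_threshold <= K -> 0 < g0 -> 0 <= s ->
  q = Q \/ (q <= Q /\ K * a <= g0 `^ (a + 1)) ->
  (forall x, u (s, x) <= K * (enorm x + g0) `^ (- a)) ->
  forall t x, s <= t -> u (t, x) <= K * (enorm x + g0) `^ (- a).
Proof.
move=> KT g00 s0 Qq init t x st.
have K0 : 0 < K := lt_le_trans barrier_threshold_gt0 KT.
apply: (@solution_barrier K s (t + 1) (s - 1) (fun=> g0) (fun=> 0) (fun=> 0)) => //.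
- by rewrite ltrBlDr ltrDl.
- by case: Qq => [->|[qQ H]]; [left|right; split].
- by move=> t' x' _ _; rewrite mulr0 mulr_ge0// powR_ge0.
- by rewrite st ltrDl ltr01.
Qed.

End solution_barriers.

Lemma is_derive_power_affine (R : realType) (k A B b t : R) : 0 < A + B * t ->
  is_derive t 1 (fun t => k * (A + B * t) `^ b) (k * (b * B) * (A + B * t) `^ (b - 1)).
Proof.
move=> At.
have dl : is_derive t 1 (fun t : R => A + B * t) B.
  have -> : (fun t : R => A + B * t) = (fun=> A) + (B \*: (@id R)) by [].
  by apply: is_derive_eq; rewrite add0r /GRing.scale /= mulr1.
have dp := is_derive1_powR b At.
have dc : is_derive t 1 (fun t : R => (A + B * t) `^ b) (b * (A + B * t) `^ (b - 1) * B).
  have := @is_derive1_comp R (fun y => y `^ b) (fun t => A + B * t) t _ _ dp dl.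
  by move=> /is_derive_eq; apply.
have -> : (fun t => k * (A + B * t) `^ b) = k \*: (fun t => (A + B * t) `^ b) by [].
by apply: is_derive_eq; rewrite /GRing.scale /=; ring.
Qed.

(** * The three regimes *)

Section barrier_decay.
Context (R : realType) (N : nat) (p q : R) (u0 : 'rV[R]_N -> R).
Hypotheses (N1 : (1 <= N)%N) (p1 : 1 < p) (p2 : p < 2).
Variables (C0 Q a M0 : R).
Hypotheses (C00 : 0 < C0) (a0 : 0 < a) (Qp : 0 < Q - p + 1) (aQ : (a + 1) * (Q - p + 1) = 1)
  (u0C : decay_bound u0 C0 a) (M00 : 0 < M0) (u0M : forall x, u0 x <= M0).

Let S := barrier_threshold p a + 2 `^ a * C0 + 2 `^ a * M0.

Let S_bounds : [/\ 0 < S, barrier_threshold p a <= S, 2 `^ a * C0 <= S & 2 `^ a * M0 <= S].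
Proof.
have t0 := barrier_threshold_gt0 p1 a0.
have c0 : 0 < 2 `^ a * C0 by rewrite mulr_gt0// powR_gt0.
have m0 : 0 < 2 `^ a * M0 by rewrite mulr_gt0// powR_gt0.
by rewrite /S; split; move: t0 c0 m0; lra.
Qed.

Let beta := (Q - p + 1) / (2 * Q - p).

Let contact_exponent : 2 * Q - p != 0 -> (1 - Q) * (a + 1) = 1 - beta^-1.
Proof.
move=> D0; have d0 : Q - p + 1 != 0 by rewrite gt_eqF.
have -> : a + 1 = (Q - p + 1)^-1 by apply: (mulIf d0); rewrite aQ mulVf.
by rewrite /beta; field; rewrite d0 D0.
Qed.

(** Valid for either sign of [e]; it replaces [|x| + g] by [g] in the region [|x| < g]. *)
Lemma powR_double_lower (e g r : R) : 0 < g -> g <= r <= 2 * g ->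
  Num.min 1 (2 `^ e) * g `^ e <= r `^ e.
Proof.
move=> g0 /andP[gr r2]; have r0 := lt_le_trans g0 gr.
have ge0 := powR_ge0 g e.
have [e0|e0] := leP 0 e.
  have : g `^ e <= r `^ e by rewrite ge0_ler_powR// nnegrE ltW.
  by apply: le_trans; rewrite ler_piMl// ge_min lexx.
have : (2 * g) `^ e <= r `^ e.
  by rewrite -[e]opprK; apply: powRN_le => //; rewrite oppr_ge0 ltW.
by apply: le_trans; rewrite powRM ?(ltW g0)// ler_wpM2r// ge_min lexx orbT.
Qed.

Lemma algebraic_barrier : q = Q -> p < 2 * Q ->
  exists K k, [/\ 0 < K, 0 < k & forall u, nonneg_cauchy_solution p q u0 u ->
    forall (t : R) x, 0 < t -> u (t, x) <= K * (enorm x + k * t `^ beta) `^ (- a)].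
Proof.
move=> qQ pQ; have [S0 ST SC SM] := S_bounds.
have D0 : 0 < 2 * Q - p by rewrite subr_gt0.
have b0 : 0 < beta by rewrite divr_gt0.
have ee := contact_exponent (lt0r_neq0 D0).
pose K := 2 `^ a * S; pose e := (1 - Q) * (a + 1).
have two1 : 1 <= 2 `^ a :> R by rewrite -[leLHS](powRr0 2) ler_powR ?ler1n// ltW.
have SK : S <= K by rewrite ler_peMl// ltW.
have K0 := lt_le_trans S0 SK.
pose c := (K * a) `^ (Q - 1) * Num.min 1 (2 `^ e).
have c0 : 0 < c by rewrite mulr_gt0// ?powR_gt0// ?mulr_gt0// lt_min ltr01 powR_gt0.
(* The second entry ensures [2 g' <= c g^e]; [k <= 1] lets the initial comparison follow from the
   stationary barrier. *)
pose k := Num.min 1 ((c / (2 * beta)) `^ beta).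
have tb : 0 < 2 * beta by rewrite pmulr_rgt0.
have cb0 : 0 < c / (2 * beta) by exact: divr_gt0.
have k0 : 0 < k by rewrite lt_min ltr01 powR_gt0.
have k1 : k <= 1 by rewrite ge_min lexx.
have kb : k * (2 * beta) <= c * k `^ e.
  have : k `^ beta^-1 <= c / (2 * beta).
    have <- : ((c / (2 * beta)) `^ beta) `^ beta^-1 = c / (2 * beta).
      by rewrite -powRrM mulfV ?gt_eqF// powRr1// ltW.
    by rewrite ge0_ler_powR ?invr_ge0 ?nnegrE ?powR_ge0 ?(ltW b0) ?(ltW k0)// ge_min lexx orbT.
  rewrite (ler_pdivlMr _ _ tb) => H.
  have {1}-> : k = k `^ beta^-1 * k `^ e.
    by rewrite -powRD ?(gt_eqF k0) ?implybT// /e ee addrC subrK powRr1// ltW.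
  by rewrite mulrAC ler_wpM2r ?powR_ge0.
exists K, k; split=> // u sol t x t0.
have stat (s : R) y : 0 <= s -> u (s, y) <= S * (enorm y + 1) `^ (- a).
  move=> s0; apply: (stationary_barrier N1 p1 p2 C00 a0 Qp aQ u0C sol ST ltr01 (lexx 0)) => //; first by left.
  move=> z; have [_ _ -> _] := sol.
  by apply: (initial_le_barrier C00 a0 u0C) u0M M00 ltr01 SC _; rewrite powR1 mulr1.
have g0 (s : R) : -1 < s -> 0 < 1 + 1 * s by rewrite mul1r; lra.
have : u (t, x) <= K * (enorm x + k * (1 + 1 * t) `^ beta) `^ (- a).
  apply: (@solution_barrier R N p q u0 N1 p1 p2 C0 Q a C00 a0 Qp aQ u0C u sol K 0 (t + 1) (-1)
    (fun t => k * (1 + 1 * t) `^ beta) (fun t => k * (beta * 1) * (1 + 1 * t) `^ (beta - 1))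
    (fun t => k * (beta * 1) * ((beta - 1) * 1) * (1 + 1 * t) `^ (beta - 1 - 1))).
  - exact: le_trans SK.
  - exact: lexx.
  - by rewrite ltrN10.
  - by move=> s /andP[/g0 ? _]; rewrite mulr_gt0// powR_gt0.
  - by move=> s /andP[/g0 ? _]; exact: is_derive_power_affine.
  - by move=> s /andP[/g0 ? _]; exact: is_derive_power_affine.
  - by left.
  - move=> s y /andP[s0 _] contact.
    have T0 : 0 < 1 + 1 * s by apply: g0; apply: lt_trans s0; rewrite ltrN10.
    set T := 1 + 1 * s in T0 contact *; set g := k * T `^ beta.
    have gp : 0 < g by rewrite mulr_gt0// powR_gt0.
    have yg : enorm y < g.
      rewrite ltNge; apply/negP => gy; move: contact; apply/negP; rewrite -leNgt.
      apply: le_trans (stat s y (ltW s0)) _.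
      have y0 : 0 <= enorm y := enorm_ge0 y.
      have : (2 * (enorm y + 1)) `^ (- a) <= (enorm y + g) `^ (- a).
        by apply: powRN_le; [exact: ltW|exact: ltr_wpDl|move: gy; lra].
      rewrite powRM ?addr_ge0// => H.
      have := ler_wpM2l (ltW K0) H; apply: le_trans.
      rewrite /K mulrACA -powRD ?pnatr_eq0 ?implybT// addrN powRr0 mul1r.
      by [].
    have H := @powR_double_lower e g (enorm y + g) gp.
    have {}H : Num.min 1 (2 `^ e) * g `^ e <= (enorm y + g) `^ e.
      by apply: H; rewrite lerDr enorm_ge0 /= mulr2n mulrDl mul1r lerD2r ltW.
    have {}H := ler_wpM2l (powR_ge0 (K * a) (Q - 1)) H.
    apply: le_trans H; rewrite [leRHS]mulrA -/c.
    have -> : g `^ e = k `^ e * T `^ (beta - 1).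
      rewrite powRM ?powR_ge0 ?(ltW k0)// -powRrM; congr (_ * _ `^ _).
      by rewrite /e ee mulrBr mulr1 mulfV ?gt_eqF.
    have -> : 2 * (k * (beta * 1) * T `^ (beta - 1)) = k * (2 * beta) * T `^ (beta - 1) by ring.
    by rewrite [leRHS]mulrA ler_wpM2r// powR_ge0.
  - move=> y; apply: le_trans (stat 0 y (lexx 0)) _.
    rewrite mulr0 addr0 powR1 mulr1; apply: ler_pM => //; rewrite ?powR_ge0 ?(ltW S0)//.
    by apply: powRN_le; rewrite ?(ltW a0) ?lerD2l// ltr_wpDl ?enorm_ge0.
  - by rewrite (ltW t0) ltrDl ltr01.
move=> H; apply: (le_trans H); apply: (ler_wpM2l (ltW K0)).
apply: powRN_le; rewrite ?(ltW a0)//.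
  by rewrite ltr_wpDl ?enorm_ge0// mulr_gt0// powR_gt0.
rewrite lerD2l ler_pM2l// ge0_ler_powR ?nnegrE ?(ltW b0) ?(ltW t0)//.
  by rewrite mul1r addr_ge0// ltW.
by rewrite mul1r lerDr.
Qed.

(** Here [(1 - Q) (a + 1) = 1], so the condition on [g'] is linear, and it only improves as [|x|]
    grows; no confinement of contacts is needed. *)
Lemma exponential_barrier : q = Q -> 2 * Q = p ->
  exists K c, [/\ 0 < K, 0 < c & forall u, nonneg_cauchy_solution p q u0 u ->
    forall (t : R) x, 0 < t -> u (t, x) <= K * (enorm x + expR (c * t)) `^ (- a)].
Proof.
move=> qQ pQ; have [S0 ST SC SM] := S_bounds.
have e1 : (1 - Q) * (a + 1) = 1 by rewrite -[RHS]aQ mulrC; congr (_ * _); move: pQ; lra.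
pose c := (S * a) `^ (Q - 1) / 2.
have c0 : 0 < c by rewrite divr_gt0// powR_gt0// mulr_gt0.
exists S, c; split=> // u sol t x t0.
have dexp (k s : R) : is_derive s 1 (fun s => k * expR (c * s)) (k * c * expR (c * s)).
  have dl : is_derive s 1 (fun s : R => c * s) c.
    have -> : (fun s : R => c * s) = c \*: (@id R) by [].
    by apply: is_derive_eq; rewrite /GRing.scale /= mulr1.
  have dc : is_derive s 1 (fun s : R => expR (c * s)) (expR (c * s) * c).
    have := @is_derive1_comp R expR (fun t => c * t) s _ _ (is_derive_expR _) dl.
    by move=> /is_derive_eq; apply.
  have -> : (fun s => k * expR (c * s)) = k \*: (fun s => expR (c * s)) by [].
  by apply: is_derive_eq; rewrite /GRing.scale /=; ring.
rewrite -[expR (c * t)]mul1r.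
apply: (@solution_barrier R N p q u0 N1 p1 p2 C0 Q a C00 a0 Qp aQ u0C u sol S 0 (t + 1) (-1)
    (fun t => 1 * expR (c * t)) (fun t => 1 * c * expR (c * t)) (fun t => 1 * c * c * expR (c * t))).
- exact: ST.
- exact: lexx.
- by rewrite ltrN10.
- by move=> s _; rewrite mul1r expR_gt0.
- by left.
- move=> s y _ _; rewrite e1 powRr1; last by rewrite addr_ge0 ?enorm_ge0 ?mul1r ?expR_ge0.
  have -> : 2 * (1 * c * expR (c * s)) = (S * a) `^ (Q - 1) * expR (c * s) by rewrite /c; field.
  by rewrite mul1r ler_wpM2l ?powR_ge0// lerDr enorm_ge0.
- move=> y; have [_ _ -> _] := sol; rewrite mulr0 expR0 mulr1.
  by apply: (initial_le_barrier C00 a0 u0C) u0M M00 ltr01 SC _; rewrite powR1 mulr1.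
- by rewrite (ltW t0) ltrDl ltr01.
Qed.

(** Since [beta < 0], the function [g] explodes at time [A / B], but the moving barrier exists only
    before it. The bound reached shortly before is frozen by [stationary_barrier] and carried to all
    later times. *)
Lemma finite_time_extinction : q <= Q -> 2 * Q < p ->
  exists2 Te, 0 < Te & forall u, nonneg_cauchy_solution p q u0 u ->
    forall (t : R) x, Te <= t -> u (t, x) = 0.
Proof.
move=> qQ pQ; have [S0 ST SC SM] := S_bounds.
have D0 : 2 * Q - p < 0 by rewrite subr_lt0.
have b0 : beta < 0 by rewrite pmulr_rlt0// invr_lt0.
have ee := contact_exponent (ltr0_neq0 D0).
set e := (1 - Q) * (a + 1) in ee.
(* This [K] fits the initial data when [g = g0]; then [K a <= g0^(a + 1)] amounts to [S a <= g0],
   and [1 <= g0] gives [S <= K]. *)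
pose g0 := Num.max 1 (S * a); pose K := S * g0 `^ a.
have g01 : 1 <= g0 by rewrite le_max lexx.
have g0p := lt_le_trans ltr01 g01.
have SK : S <= K.
  rewrite ler_peMr ?(ltW S0)//; have {1}<- : 1 `^ a = 1 :> R by rewrite powR1.
  by rewrite ge0_ler_powR ?nnegrE ?(ltW a0) ?(ltW g0p).
have K0 := lt_le_trans S0 SK.
have Kg : K * a <= g0 `^ (a + 1).
  rewrite powRD ?(gt_eqF g0p) ?implybT// powRr1 ?(ltW g0p)// /K mulrAC mulrC.
  by rewrite ler_wpM2l ?powR_ge0// le_max lexx orbT.
pose A := g0 `^ beta^-1.
have A0 : 0 < A by rewrite powR_gt0.
have Ab : A `^ beta = g0 by rewrite -powRrM mulVf ?lt_eqF// powRr1// ltW.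
(* With this speed [2 g'] equals [(K a)^(Q - 1) g^e] exactly; as [e = 1 - 1 / beta >= 0], the
   condition then holds for every [x]. *)
pose B := (K * a) `^ (Q - 1) / 2 / - beta.
have nb0 : 0 < - beta by rewrite oppr_gt0.
have B0 : 0 < B by rewrite divr_gt0// divr_gt0// powR_gt0// mulr_gt0.
exists (A / B); first by rewrite divr_gt0.
move=> u sol t x tT.
have pos (s : R) : s < A / B -> 0 < A + - B * s.
  by rewrite ltr_pdivlMr// mulrC mulNr subr_gt0.
have early (s : R) y : 0 <= s < A / B -> u (s, y) <= K * (enorm y + 1 * (A + - B * s) `^ beta) `^ (- a).
  move=> /andP[s0 sT].
  apply: (@solution_barrier R N p q u0 N1 p1 p2 C0 Q a C00 a0 Qp aQ u0C u sol K 0 (A / B) (-1)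
    (fun t => 1 * (A + - B * t) `^ beta) (fun t => 1 * (beta * - B) * (A + - B * t) `^ (beta - 1))
    (fun t => 1 * (beta * - B) * ((beta - 1) * - B) * (A + - B * t) `^ (beta - 1 - 1))).
  - exact: le_trans SK.
  - exact: lexx.
  - by rewrite ltrN10.
  - by move=> r /andP[_ /pos ?]; rewrite mul1r powR_gt0.
  - by move=> r /andP[_ /pos ?]; exact: is_derive_power_affine.
  - by move=> r /andP[_ /pos ?]; exact: is_derive_power_affine.
  - right; split=> // r /andP[r0 /pos rT]; apply: le_trans Kg _.
    rewrite mul1r ge0_ler_powR ?nnegrE ?(ltW g0p) ?powR_ge0 ?addr_ge0 ?(ltW a0)//.
    rewrite -Ab -[beta]opprK; apply: powRN_le => //; first by rewrite oppr_ge0 ltW.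
    by rewrite mulNr gerBl mulr_ge0 ?(ltW B0).
  - move=> r y' /andP[_ /pos r0] _; rewrite -/e.
    have -> : 2 * (1 * (beta * - B) * (A + - B * r) `^ (beta - 1)) =
       (K * a) `^ (Q - 1) * (A + - B * r) `^ (beta - 1).
      by rewrite /B; field; rewrite lt_eqF.
    rewrite ler_wpM2l ?powR_ge0//.
    have -> : beta - 1 = beta * e by rewrite ee mulrBr mulr1 mulfV ?lt_eqF.
    rewrite powRrM mul1r ge0_ler_powR ?nnegrE ?addr_ge0 ?enorm_ge0 ?powR_ge0 ?lerDr ?enorm_ge0//.
    by rewrite ee subr_ge0 (le_trans _ ler01)// invr_le0 ltW.
  - move=> y'; have [_ _ -> _] := sol; rewrite mulr0 addr0 mul1r Ab.
    apply: (initial_le_barrier C00 a0 u0C) u0M M00 g0p _ _; first exact: le_trans SK.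
    by rewrite ler_wpM2r ?powR_ge0.
  - by rewrite s0.
pose gamma := - a * beta.
have gam0 : 0 < gamma by rewrite nmulr_rgt0 ?oppr_lt0.
(* Here [y = A - B s] measures the time left at [s] before [A / B]; the bound tends to 0 with
   [y]. *)
have small (y : R) : 0 < y <= A -> u (t, x) <= K * y `^ gamma.
  move=> /andP[y0 yA]; pose s := (A - y) / B.
  have ys : A + - B * s = y by rewrite mulNr /s mulrC divfK ?gt_eqF//; ring.
  have s0 : 0 <= s by rewrite divr_ge0 ?subr_ge0// ltW.
  have sT : s < A / B by rewrite ltr_pM2r ?invr_gt0// gtrBl.
  have yb0 : 0 < y `^ beta by rewrite powR_gt0.
  have := @stationary_barrier R N p q u0 N1 p1 p2 C0 Q a C00 a0 Qp aQ u0C u sol K (y `^ beta) s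
    (le_trans ST SK) yb0 s0 _ _ t x (ltW (lt_le_trans sT tT)).
  move=> H; apply: le_trans (H _ _) _.
  - right; split=> //; apply: le_trans Kg _.
    rewrite ge0_ler_powR ?nnegrE ?(ltW g0p) ?(ltW yb0) ?addr_ge0 ?(ltW a0)//.
    by rewrite -Ab -[beta]opprK; apply: powRN_le => //; rewrite oppr_ge0 ltW.
  - by move=> z; have := early s z; rewrite ys mul1r; apply; rewrite s0.
  rewrite ler_wpM2l ?(ltW K0)// /gamma [- a * _]mulrC (powRrM y beta (- a)).
  by apply: powRN_le; rewrite ?(ltW a0)// lerDr enorm_ge0.
have [_ _ _ unn] := sol.
have t0 : 0 <= t by apply: le_trans tT; rewrite divr_ge0 ?ltW.
apply/eqP; rewrite eq_le unn// andbT leNgt; apply/negP => m0.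
pose y := Num.min A ((u (t, x) / (2 * K)) `^ gamma^-1).
have mK : 0 < u (t, x) / (2 * K) by rewrite divr_gt0// mulr_gt0.
have y0 : 0 < y by rewrite lt_min A0 powR_gt0.
have := small y; rewrite y0 ge_min lexx => /(_ isT).
have : y `^ gamma <= u (t, x) / (2 * K).
  have <- : ((u (t, x) / (2 * K)) `^ gamma^-1) `^ gamma = u (t, x) / (2 * K).
    by rewrite -powRrM mulVf ?gt_eqF// powRr1// ltW.
  by rewrite ge0_ler_powR ?nnegrE ?powR_ge0 ?(ltW gam0) ?(ltW y0)// ge_min lexx orbT.
move=> /(ler_wpM2l (ltW K0)).
have -> : K * (u (t, x) / (2 * K)) = u (t, x) / 2 by field; rewrite gt_eqF.
by move: m0; lra.
Qed.

End barrier_decay.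

(** * Exponent arithmetic and the constants of the three claims *)

Lemma barrier_exponent (R : realType) (p Q : R) : p - 1 < Q -> Q < p ->
  let a := (p - Q) / (Q - p + 1) in
  [/\ 0 < a, 0 < Q - p + 1 & (a + 1) * (Q - p + 1) = 1].
Proof.
move=> Q1 Qp a; have d0 : 0 < Q - p + 1 by move: Q1; lra.
split=> //; first by rewrite divr_gt0// subr_gt0.
by rewrite /a; field; rewrite gt_eqF.
Qed.

(** Clearing denominators, [N < a] reads [(N + 1) q < (N + 1) p - N]; it makes the barrier
    integrable. *)
Lemma dim_lt_barrier_exponent (R : realType) (N : nat) (p q : R) :
  p - 1 < q -> q < q_star N p -> N%:R < (p - q) / (q - p + 1).
Proof.
move=> q1 qs; have d0 : 0 < q - p + 1 by move: q1; lra.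
rewrite ltr_pdivlMr//; move: qs; rewrite /q_star ltrBrDr -ltrBrDl.
have N1 : 0 < N%:R + 1 :> R by rewrite ltr_wpDl.
by rewrite (ltr_pdivrMr _ _ N1); lra.
Qed.

Theorem theorem1p2 (R : realType) (N : nat) (p q : R) (u0 : 'rV[R]_N -> R)
  (hN : (1 <= N)%N)
  (hpc : p_c R N < p) (hp1 : 1 < p) (hp2 : p < 2) (hq : 0 < q)
  (hL1 : in_L1 u0) (hW : in_W1oo u0)
  (hnneg : forall x, 0 <= u0 x) (hnz : exists x, u0 x != 0) :
  (p / 2 < q < q_star N p ->
   (exists2 C0 : R, 0 < C0 & decay_bound u0 C0 ((p - q) / (q - p + 1))) ->
   exists2 C : R, 0 < C &
     forall u, nonneg_cauchy_solution p q u0 u ->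
     forall t : R, 0 < t ->
       ((t `^ ((N%:R + 1) * (q_star N p - q) / (2 * q - p)))%:E * norm1 u t
        + (t `^ ((p - q) / (2 * q - p)))%:E * normoo u t <= C%:E)%E) /\
  (q = p / 2 ->
   (exists2 C0 : R, 0 < C0 & decay_bound u0 C0 ((p - q) / (q - p + 1))) ->
   exists C C' : R, [/\ 0 < C, 0 < C' &
     forall u, nonneg_cauchy_solution p q u0 u ->
     forall t : R, 0 < t ->
       (norm1 u t + normoo u t <= (C' * expR (- (C * t)))%:E)%E]) /\
  (q < p / 2 ->
   (exists C0 Q : R,
     [/\ 0 < C0,
         decay_bound u0 C0 ((p - Q) / (Q - p + 1)),
         q_1 N p < q -> Q = q &
         q <= q_1 N p -> q_1 N p < Q < p / 2]) ->
   exists2 Te : R, 0 < Te &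
     forall u, nonneg_cauchy_solution p q u0 u ->
     forall t x, Te <= t -> u (t, x) = 0).
Proof.
have N1 : 0 < N%:R + 1 :> R by rewrite ltr_wpDl.
have frac0 : 0 < N%:R / (N%:R + 1) :> R by rewrite divr_gt0// ltr0n.
have mass0 a : N%:R < a -> 0 < decay_mass N a.
  move=> Na; rewrite exprn_gt0// divr_gt0// subr_gt0 ltr_pdivlMr ?ltr0n//.
  by rewrite mul1r.
split; [|split].
- move=> /andP[pq qs] [C0 C00 u0C].
  (* The constant precedes the quantification over solutions. The bound [M0] on [u0] is read off one
     solution [v] and serves for all; without a solution the claim is vacuous. *)
  have [[v sv]|nosol] := pselect (exists u, nonneg_cauchy_solution p q u0 u); last first.
    by exists 1 => // u su; case: nosol; exists u.
  have q1 : p - 1 < q by move: pq hp2; lra.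
  have qp : q < p by move: qs; rewrite /q_star; move: frac0; lra.
  have Na := dim_lt_barrier_exponent q1 qs.
  have [a0 d0 aQ] := barrier_exponent q1 qp.
  have [M0 M00 u0M] := initial_bounded C00 a0 u0C sv.
  have pq2 : p < 2 * q by move: pq; lra.
  have [K [k [K0 k0 bound]]] := algebraic_barrier hN hp1 hp2 C00 a0 d0 aQ u0C M00 u0M erefl pq2.
  set a := (p - q) / (q - p + 1) in a0 aQ Na u0C bound.
  set b := (q - p + 1) / (2 * q - p) in bound.
  have dD : q - p + 1 != 0 by rewrite gt_eqF.
  have qD : 2 * q - p != 0 by rewrite gt_eqF// subr_gt0.
  exists (K * (decay_mass N a * k `^ (N%:R - a)) + K * k `^ (- a)).
    by rewrite addr_gt0// mulr_gt0 ?powR_gt0// mulr_gt0 ?powR_gt0// mass0.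
  move=> u su t t0; have [_ _ _ unn] := su.
  have tb0 : 0 < t `^ b by rewrite powR_gt0.
  have g0 : 0 < k * t `^ b by rewrite mulr_gt0.
  have ub x : 0 <= u (t, x) <= K * (enorm x + k * t `^ b) `^ (- a).
    by rewrite unn ?(ltW t0)// bound.
  have -> : (N%:R + 1) * (q_star N p - q) / (2 * q - p) = b * (a - N%:R).
    by rewrite /b /a /q_star; field; rewrite dD qD gt_eqF.
  have -> : (p - q) / (2 * q - p) = b * a by rewrite /b /a; field; rewrite dD qD.
  have cancel c : t `^ (b * - c) * t `^ (b * c) = 1.
    by rewrite -powRD ?(gt_eqF t0) ?implybT// mulrN addNr powRr0.
  have w0 c : (0 <= (t `^ c)%:E)%E by rewrite lee_fin powR_ge0.
  apply: (le_trans (leeD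
    (lee_wpmul2l (w0 _) (norm1_le hN g0 (ltW K0) ub Na))
    (lee_wpmul2l (w0 _) (normoo_le g0 (ltW K0) ub a0)))).
  (* The weights of the statement are [t^(b (a - N))] and [t^(b a)], the inverses of the time
     factors of the two norm bounds. *)
  have scaling w c : t `^ (b * - c) * (w * (k * t `^ b) `^ c) = w * k `^ c.
    rewrite powRM ?(ltW k0) ?(ltW tb0)// -(powRrM t b).
    transitivity (w * k `^ c * (t `^ (b * - c) * t `^ (b * c))); first by ring.
    by rewrite cancel mulr1.
  have sN : a - N%:R = - (N%:R - a) by rewrite opprB.
  have sa : b * a = b * - - a by rewrite opprK.
  have s1 := scaling (K * decay_mass N a) (N%:R - a).
  have s2 := scaling K (- a).
  rewrite -!EFinM -EFinD lee_fin sN sa s2 !(mulrA K (decay_mass N a)) s1.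
  exact: lexx.
- move=> qE [C0 C00 u0C].
  have [[v sv]|nosol] := pselect (exists u, nonneg_cauchy_solution p q u0 u); last first.
    by exists 1, 1; split=> // u su; case: nosol; exists u.
  have q1 : p - 1 < q by rewrite qE; move: hp2; lra.
  have qp : q < p by rewrite qE; move: hp1; lra.
  (* For [q = p / 2] this is the hypothesis [p_c < p]. *)
  have qs : q < q_star N p.
    rewrite /q_star ltrBrDr -ltrBrDl qE; move: hpc; rewrite /p_c.
    rewrite -mulrA; lra.
  have Na := dim_lt_barrier_exponent q1 qs.
  have [a0 d0 aQ] := barrier_exponent q1 qp.
  have [M0 M00 u0M] := initial_bounded C00 a0 u0C sv.
  have pq2 : 2 * q = p by rewrite qE; field.
  have [K [c [K0 c0 bound]]] := exponential_barrier hN hp1 hp2 C00 a0 d0 aQ u0C M00 u0M erefl pq2.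
  set a := (p - q) / (q - p + 1) in a0 aQ Na u0C bound.
  (* The rate is that of the L1 norm; the sup norm decays at the faster rate [c * a]. *)
  exists (c * (a - N%:R)), (K * decay_mass N a + K); split.
  + by rewrite mulr_gt0// subr_gt0.
  + by rewrite addr_gt0// mulr_gt0// mass0.
  move=> u su t t0; have [_ _ _ unn] := su.
  have g0 : 0 < expR (c * t) by rewrite expR_gt0.
  have ub x : 0 <= u (t, x) <= K * (enorm x + expR (c * t)) `^ (- a).
    by rewrite unn ?(ltW t0)// bound.
  apply: (le_trans (leeD (norm1_le hN g0 (ltW K0) ub Na) (normoo_le g0 (ltW K0) ub a0))).
  rewrite -EFinD lee_fin -!expRM.
  have -> : c * t * (N%:R - a) = - (c * (a - N%:R) * t) by ring.
  rewrite mulrDl mulrA lerD2l ler_pM2l// ler_expR.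
  have ct : 0 < c * t by rewrite mulr_gt0.
  have -> : c * t * - a = - (c * (a - N%:R) * t) - c * t * N%:R by ring.
  by rewrite gerBl mulr_ge0// ltW.
- move=> qp2 [C0 [Q [C00 u0C Qq Q1]]].
  have [[v sv]|nosol] := pselect (exists u, nonneg_cauchy_solution p q u0 u); last first.
    by exists 1 => // u su; case: nosol; exists u.
  (* Both alternatives of the hypothesis on [Q] reduce to these inequalities, and [q_1 < Q] yields
     [p - 1 < Q]. *)
  have [q1Q qQ Qp2] : [/\ q_1 N p < Q, q <= Q & Q < p / 2].
    have [qq1|q1q] := leP q (q_1 N p); last by rewrite (Qq q1q).
    by have /andP[q1Q ->] := Q1 qq1; rewrite q1Q (le_trans qq1)// ltW.
  have pQ : p - 1 < Q by apply: le_lt_trans q1Q; rewrite le_max lexx.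
  have Qp : Q < p by move: Qp2 hp1; lra.
  have [a0 d0 aQ] := barrier_exponent pQ Qp.
  have [M0 M00 u0M] := initial_bounded C00 a0 u0C sv.
  have Q2 : 2 * Q < p by move: Qp2; lra.
  have [Te Te0 H] := finite_time_extinction hN hp1 hp2 C00 a0 d0 aQ u0C M00 u0M qQ Q2.
  by exists Te => // u su t x; exact: H.
Qed.
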